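(* For every $N\in\mathbb N$, the matrix $M^{(N)}$ is symmetric and positive semidefinite, and for every $U=(u_1,\dots,u_N)\in\mathbb R^N$, writing $u=\sum_{k\le N}u_kh_k$, $$0\le\langle M^{(N)}U,U\rangle_{\mathbb R^N}=\mathcal M_s(u,u)=[u]^2_{H^s(\mathbb R^d)}\le C_s\|\nabla u\|_{L^2}^2=C_s\sum_{k\le N}\lambda_ku_k^2,\qquad C_s:=1+\lambda_1^{-1}.$$ Consequently $A^{(N)}:=\theta\Lambda^{(N)}+\beta M^{(N)}$ is symmetric with $$\theta\lambda_1|U|^2\le\theta\langle\Lambda^{(N)}U,U\rangle\le\langle A^{(N)}U,U\rangle\le(\theta+\beta C_s)\langle\Lambda^{(N)}U,U\rangle,\qquad U\in\mathbb R^N.$$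
   Context: $\mathcal O\subset\mathbb R^d$ ($d\ge1$) is a bounded domain with $C^{1,1}$ boundary, $s\in(0,1)$, $\theta,\beta>0$. Functions in $H^1_0(\mathcal O)$ are extended by zero to $\mathbb R^d$. $\mathcal M_s(u,w)=\frac{C(d,s)}2\iint_{\mathbb R^d\times\mathbb R^d}\frac{(u(x)-u(y))(w(x)-w(y))}{|x-y|^{d+2s}}\,dx\,dy$ and $[u]^2_{H^s(\mathbb R^d)}=\mathcal M_s(u,u)$, where $C(d,s)$ is the standard normalising constant, for which $[u]^2_{H^s(\mathbb R^d)}=\int_{\mathbb R^d}|\xi|^{2s}|\hat u(\xi)|^2d\xi$ (unitary Fourier transform). $\{h_k\}\subset H_0^1(\mathcal O)$ is an $L^2$-orthonormal basis of Dirichlet eigenfunctions, $-\Delta h_k=\lambda_kh_k$, $0<\lambda_1\le\lambda_2\le\cdots$. $\Lambda^{(N)}=\mathrm{diag}(\lambda_1,\dots,\lambda_N)$ and $M^{(N)}_{kj}:=\mathcal M_s(h_k,h_j)$, $1\le k,j\le N$. *)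

(* Defs.v *)
From HB Require Import structures.
From mathcomp Require Import all_boot all_order all_algebra.
From mathcomp Require Import all_classical all_reals all_analysis.

Set Implicit Arguments.
Unset Strict Implicit.
Unset Printing Implicit Defensive.

Import Order.TTheory GRing.Theory Num.Theory.
Import numFieldNormedType.Exports.

Local Open Scope classical_set_scope.
Local Open Scope ring_scope.

(* Product (equivalently, Borel) sigma-algebra on ['rV[R]_d]. *)
Section measurable_rV.
Variables (R : realType) (d : nat).

Let coord (i : 'I_d) (x : 'rV[R]_d) : measurableTypeR R := x ord0 i.

Let rV_set0 : g_sigma_preimage coord set0.
Proof. exact: sigma_algebra0. Qed.

Let rV_setC A : g_sigma_preimage coord A -> g_sigma_preimage coord (~` A).
Proof. exact: sigma_algebraC. Qed.

Let rV_bigcup (F : _^nat) : (forall i, g_sigma_preimage coord (F i)) ->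
  g_sigma_preimage coord (\bigcup_i (F i)).
Proof. exact: sigma_algebra_bigcup. Qed.

HB.instance Definition _ := @isMeasurable.Build default_measure_display
  'rV[R]_d (g_sigma_preimage coord) rV_set0 rV_setC rV_bigcup.

Lemma measurable_coord (i : 'I_d) :
  measurable_fun [set: 'rV[R]_d] (fun x => x ord0 i : measurableTypeR R).
Proof.
move=> _ Y mY; rewrite setTI; apply: sub_sigma_algebra => /=.
rewrite -bigcup_seq/=; exists i => /=; first by rewrite mem_index_enum.
by exists Y => //; rewrite setTI.
Qed.

Lemma measurable_fun_rVP d' (T : measurableType d') (f : T -> 'rV[R]_d) :
  (forall i, measurable_fun [set: T] (fun t => f t ord0 i : measurableTypeR R)) ->
  measurable_fun [set: T] f.
Proof.
move=> mf; apply: (@measurability _ _ _ _ _ _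
  (\big[setU/set0]_(i < d) preimage_set_system setT (coord i) measurable)) => //.
move=> _ [B + <-]; rewrite -bigcup_seq => -[i _ [Y mY <-]].
by have := mf i measurableT Y mY; rewrite !setTI.
Qed.

End measurable_rV.

Section lebesgue_rV.
Variable R : realType.

Definition rV_cons d (p : measurableTypeR R * 'rV[R]_d) : 'rV[R]_d.+1 :=
  row_mx (p.1 : R)%:M p.2.

Definition rV_uncons d (x : 'rV[R]_d.+1) : measurableTypeR R * 'rV[R]_d :=
  (x ord0 ord0, \row_i x ord0 (lift ord0 i)).

Lemma rV_consK d : cancel (@rV_cons d) (@rV_uncons d).
Proof.
case=> a x; rewrite /rV_uncons /rV_cons; congr pair => /=.
  by rewrite mxE; case: splitP => // j _; rewrite mxE (ord1 j) eqxx.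
apply/(@rowP R) => i; rewrite !mxE; case: splitP => [j|j] /=.
  by rewrite ord1.
by rewrite /bump /= => -[] /val_inj ->.
Qed.

Lemma rV_cons0 d p : @rV_cons d p ord0 ord0 = p.1.
Proof. exact: (congr1 fst (rV_consK p)). Qed.

Lemma rV_consS d p i : @rV_cons d p ord0 (lift ord0 i) = p.2 ord0 i.
Proof.
transitivity ((rV_uncons (rV_cons p)).2 ord0 i); first by rewrite [RHS]mxE.
by rewrite rV_consK.
Qed.

Lemma rV_unconsK d : cancel (@rV_uncons d) (@rV_cons d).
Proof.
move=> x; apply/rowP => i; rewrite /rV_cons /rV_uncons /= !mxE.
case: splitP => j ij; rewrite !mxE.
  by rewrite (ord1 j) eqxx mulr1n; congr (x _ _); apply/val_inj; rewrite /= ij (ord1 j).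
by congr (x _ _); apply/val_inj; rewrite /= ij.
Qed.

Lemma measurable_rV_cons d : measurable_fun setT (@rV_cons d).
Proof.
apply: measurable_fun_rVP => i.
rewrite /rV_cons; under eq_fun do rewrite mxE.
case: splitP => j _; last exact: measurableT_comp (measurable_coord j) _.
under eq_fun do rewrite mxE (ord1 j) eqxx mulr1n.
exact: measurable_fst.
Qed.

Lemma measurable_rV_uncons d : measurable_fun setT (@rV_uncons d).
Proof.
apply/measurable_fun_pairP; split => /=; first exact: measurable_coord.
apply: measurable_fun_rVP => i.
rewrite /comp /=; under eq_fun do rewrite mxE.
exact: measurable_coord.
Qed.

Section step.
Variables (d : nat) (m : {sigma_finite_measure set 'rV[R]_d -> \bar R}).

Definition lebesgue_rV_step : set 'rV[R]_d.+1 -> \bar R :=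
  pushforward (@lebesgue_measure R \x m)%E (@rV_cons d).

HB.instance Definition _ := Measure.copy lebesgue_rV_step
  (measure_function_pushforward__canonical__measure_function_Measure
    (@lebesgue_measure R \x m)%E (@measurable_rV_cons d)).

Let step_sigma_finite : sigma_finite setT lebesgue_rV_step.
Proof.
have /sigma_finiteP[F [TF ndF Foo]] := sigma_finiteT (@lebesgue_measure R).
have /sigma_finiteP[G [TG ndG Goo]] := sigma_finiteT m.
exists (fun i => @rV_uncons d @^-1` (F i `*` G i)).
  rewrite -preimage_bigcup (_ : \bigcup_i (F i `*` G i) = setT) ?preimage_setT//.
  rewrite -setXTT TF TG predeqE => -[x y]; split.
    by move=> [n _ []/= ? ?]; split; exists n.
  move=> [/= [n _ Fnx] [k _ Gky]]; exists (maxn n k) => //; split.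
  - by move: x Fnx; exact/subsetPset/ndF/leq_maxl.
  - by move: y Gky; exact/subsetPset/ndG/leq_maxr.
move=> i; have [mF Fi] := Foo i; have [mG Gi] := Goo i; split.
  rewrite -[X in measurable X]setTI; apply: measurable_rV_uncons => //.
  exact: measurableX.
rewrite /lebesgue_rV_step /pushforward -comp_preimage.
rewrite (_ : _ \o _ = id) ?preimage_id; last exact/funext/rV_consK.
by rewrite product_measure1E// lte_mul_pinfty// ge0_fin_numE.
Qed.

HB.instance Definition _ := Measure_isSigmaFinite.Build _ _ _
  lebesgue_rV_step step_sigma_finite.

End step.

Fixpoint lebesgue_rV d : {sigma_finite_measure set 'rV[R]_d -> \bar R} :=
  if d is d'.+1 then lebesgue_rV_step (lebesgue_rV d') else \d_(0 : 'rV[R]_0).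


Lemma lebesgue_rV_box d (A : 'I_d -> set (measurableTypeR R)) :
  (forall i, measurable (A i)) ->
  lebesgue_rV d [set x | forall i, A i (x ord0 i)] =
  (\prod_i @lebesgue_measure R (A i))%E.
Proof.
elim: d A => [|d IH] A mA.
  rewrite big_ord0 /= diracE (_ : 0 \in _)//; apply/mem_set => -[].
  by [].
rewrite big_ord_recl -IH; last by move=> i; exact: mA.
rewrite -product_measure1E//; last first.
  rewrite [X in measurable X](_ : _ = \bigcap_(i in [set: 'I_d])
     (fun x : 'rV[R]_d => x ord0 i : measurableTypeR R) @^-1` A (lift ord0 i)).
    apply: fin_bigcap_measurable => // i _; rewrite -[X in measurable X]setTI.
    exact: measurable_coord.
  by apply/seteqP; split=> x /= Ax i => [_|]; exact: Ax.
congr ((_ \x _)%E _); apply/seteqP; split=> -[a x] /=.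
  move=> Ax; split=> [|i]; first by have := Ax ord0; rewrite rV_cons0.
  by have := Ax (lift ord0 i); rewrite rV_consS.
move=> [Aa Ax] i; case: (unliftP ord0 i) => [j|] ->.
  by rewrite rV_consS; exact: Ax.
by rewrite rV_cons0.
Qed.

End lebesgue_rV.

Section euclidean.
Variable R : realType.

Definition dotv m (U V : 'cV[R]_m) : R := \sum_i U i ord0 * V i ord0.

(* The library norm on ['rV[R]_d] is the sup norm. *)
Definition enorm d (x : 'rV[R]_d) : R := Num.sqrt (\sum_i x ord0 i ^+ 2).

Definition partial d (i : 'I_d) (f : 'rV[R]_d -> R) : 'rV[R]_d -> R :=
  fun x => 'D_(delta_mx ord0 i) f x.

Fixpoint Ck d (k : nat) (f : 'rV[R]_d -> R) : Prop :=
  if k is k'.+1 then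
    continuous f /\
    forall i, (forall x, derivable f x (delta_mx ord0 i)) /\ Ck k' (partial i f)
  else continuous f.

Definition C11 d (f : 'rV[R]_d -> R) : Prop :=
  Ck 1 f /\ exists L : R, forall i x y,
    `|partial i f x - partial i f y| <= L * enorm (x - y).

Definition bounded_domain d (O : set 'rV[R]_d) : Prop :=
  [/\ O !=set0, open O, connected O & bounded_set O].

(* Near each boundary point, after a rigid motion [x |-> (x - x0) *m Q], the
   set [O] is the strict epigraph of a C^{1,1} function of the first [n]
   coordinates. *)
Definition C11_boundary n (O : set 'rV[R]_n.+1) : Prop :=
  forall x0, (closure O `\` interior O) x0 ->
  exists (Q : 'M[R]_n.+1) (r : R) (g : 'rV[R]_n -> R),
    [/\ Q *m Q^T = 1%:M, 0 < r, C11 g &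
      forall x, enorm (x - x0) < r ->
        let y := (x - x0) *m Q in
        O x <-> g (col' ord_max y) < y ord0 ord_max].

End euclidean.

Section sobolev.
Variables (R : realType) (d : nat).
Implicit Types (O : set 'rV[R]_d) (u v : 'rV[R]_d -> R).

Local Notation leb := (lebesgue_rV R d).

(* [L^2(O)], its elements being extended by zero to the whole space. *)
Definition L2 O u : Prop :=
  u \in Lfun leb 2%:E /\ (forall x, ~ O x -> u x = 0).

Definition dotL2 u v : R := (\int[leb]_x (u x * v x))%R.

Definition sqnormL2 u : R := dotL2 u u.

Definition test_function O (phi : 'rV[R]_d -> R) : Prop :=
  (forall k, Ck k phi) /\
  let supp := closure [set x | phi x != 0] in compact supp /\ supp `<=` O.

Definition weak_gradient O u (G : 'I_d -> 'rV[R]_d -> R) : Prop :=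
  forall i, L2 O (G i) /\
    forall phi, test_function O phi ->
      dotL2 u (partial i phi) = - dotL2 (G i) phi.

(* The weak gradient is unique up to a.e. equality; [wgrad O u] is a chosen
   representative (and is 0 if [u] has no weak gradient). *)
Definition wgrad O u : 'I_d -> 'rV[R]_d -> R :=
  xget (fun _ _ => 0) [set G | weak_gradient O u G].

Definition dotgrad O u v : R := \sum_i dotL2 (wgrad O u i) (wgrad O v i).

Definition sqnorm_grad O u : R := dotgrad O u u.

Definition H1 O u : Prop := L2 O u /\ exists G, weak_gradient O u G.

(* Closure of the test functions in the [H^1] norm. *)
Definition H10 O u : Prop :=
  H1 O u /\ exists phi : nat -> 'rV[R]_d -> R,
    [/\ forall m, test_function O (phi m),
        sqnormL2 (phi m \- u) @[m --> \oo] --> (0 : R) &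
        forall i, sqnormL2 (partial i (phi m) \- wgrad O u i) @[m --> \oo]
          --> (0 : R)].

Definition L2_orthonormal_basis O (h : nat -> 'rV[R]_d -> R) : Prop :=
  [/\ forall k, L2 O (h k),
      forall j k, dotL2 (h j) (h k) = (j == k)%:R &
      forall f, L2 O f ->
        sqnormL2 (fun x => f x - \sum_(k < m) dotL2 f (h k) * h k x)
          @[m --> \oo] --> (0 : R)].

(* Weak form of [- Delta u = l u] with [u = 0] on the boundary. *)
Definition dirichlet_eigen O (l : R) u : Prop :=
  H10 O u /\ forall v, H10 O v -> dotgrad O u v = l * dotL2 u v.

Definition dirichlet_eigenbasis O (lam : nat -> R)
    (h : nat -> 'rV[R]_d -> R) : Prop :=
  [/\ L2_orthonormal_basis O h,
      forall k, dirichlet_eigen O (lam k) (h k),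
      0 < lam 0%N &
      forall k, lam k <= lam k.+1].

End sobolev.

Section fractional.
Variables (R : realType) (n : nat) (s : R).
Local Notation d := n.+1.
Local Notation leb := (lebesgue_rV R d).
Implicit Types u w : 'rV[R]_d -> R.

(* Since [0 `^ a = 0] and [x / 0 = 0], the quotients below vanish where the
   kernel does, i.e. on null sets. *)
Definition frac_kernel (z : 'rV[R]_d) : R := enorm z `^ (d%:R + 2 * s).

(* The normalising constant for which the seminorm below has Fourier symbol
   [|xi|^(2 s)]. *)
Definition frac_const : R :=
  (\int[leb]_z ((1 - cos (z ord0 ord0)) / frac_kernel z))%R^-1.

Definition Ms_integrand u w (z : 'rV[R]_d * 'rV[R]_d) : R :=
  (u z.1 - u z.2) * (w z.1 - w z.2) / frac_kernel (z.1 - z.2).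

(* Extended-real valued, so that the finiteness of the seminorm is not hidden
   by a default value. *)
Definition Ms u w : \bar R :=
  ((frac_const / 2)%:E * \int[leb \x leb]_z (Ms_integrand u w z)%:E)%E.

Definition sqseminorm_Hs u : \bar R := Ms u u.

End fractional.

Section galerkin.
Variables (R : realType) (n : nat) (s theta beta : R).
Variables (lam : nat -> R) (h : nat -> 'rV[R]_n.+1 -> R).

(* Indices start at 0: [lam 0], [h 0] are the first eigenvalue and
   eigenfunction. *)
Definition galerkin_fun N (U : 'cV[R]_N) : 'rV[R]_n.+1 -> R :=
  fun x => \sum_(k < N) U k ord0 * h k x.

Definition Lambda_mx N : 'M[R]_N := diag_mx (\row_(k < N) lam k).

Definition M_mx N : 'M[R]_N := \matrix_(k, j) fine (Ms s (h k) (h j)).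

Definition A_mx N : 'M[R]_N := theta *: Lambda_mx N + beta *: M_mx N.

Definition C_s : R := 1 + (lam 0%N)^-1.

End galerkin.

(* Main.v *)
(* Let [p = d / 2 + s]. The kernel [|z|^(-d - 2s)] is the mixture
   [Gamma(p)^-1 \int_0^oo a^(p-1) e^(-a |z|^2 / 4) da] of Gaussians, which
   replaces the Fourier transform. The Gaussian form
   [Q_c(u) = \iint (u(x) - u(y))^2 e^(-c |x - y|^2) dx dy] satisfies, with
   [K_c = (pi / c)^(d / 2)],
     [Q_c(u) <= 2 K_c |u|^2], since a Gaussian is a superposition of products
       [g(x) g(y)] of Gaussians, and
     [Q_c(u) <= K_c / (2 c) |grad u|^2], from [|u(. + z) - u| <= |z . grad u|] in
       [L^2] for test functions, and by density in [H^1_0].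
   With [c = a / 4], the first bound for [a <= 1] and the second one for [a > 1]
   bound [M_s(u, u)] by [\int_0^1 a^(s-1) da] and [\int_1^oo a^(s-2) da]. Both are
   at most [J = \int_0^oo a^(s-1) / (1 + a) da], and up to the same factors the
   integral defining [1 / C(d, s)] is at least [J], because
   [1 - e^(-1 / a) >= 1 / (1 + a)]. Hence
   [M_s(u, u) <= |u|^2 + |grad u|^2]; for [u] in the span of the [h_k] the
   eigenvalue relation gives [|grad u|^2 = \sum_k lam_k u_k^2 >= lam_0 |u|^2]. *)
Require Import Defs.
From mathcomp Require Import all_boot all_order all_algebra.
From mathcomp Require Import all_classical all_reals all_analysis.
From mathcomp Require Import ring lra measurable_realfun.

Set Implicit Arguments.
Unset Strict Implicit.
Unset Printing Implicit Defensive.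

Import Order.TTheory GRing.Theory Num.Theory.
Import numFieldNormedType.Exports.

Local Open Scope classical_set_scope.
Local Open Scope ring_scope.

(** * Lebesgue measure on row vectors *)

(** [frac_const] is never evaluated. Subordination multiplies both the form and the integral
    defining [1 / C(d, s)] by the same unevaluated gamma integral [Gam], and both then carry the
    same [K = (4 pi)^(d/2)], because [a^(p-1) K_(a/4) = K a^(s-1)]. These factors cancel in the
    quotient, and the 2 of [2 K] meets the 1/2 in [Ms]; hence [|u|^2] and [|grad u|^2] both get the
    coefficient 1. The comparison with [J] cannot be made separately on [(0, 1]] and on [(1, oo)]:
    the part of [J] over each half is strictly smaller than the power integral there. The missing
    piece, at most [ln 2], is paid for by the part of [J] over the other half. Density must not
    spoil the constant either, so the passage to [H^1_0] uses a triangle inequality with weight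
    [1 + e], where the remainder is controlled by the [L^2] bound at fixed [c], and [e] tends to 0
    last. Finally, weak gradients are chosen representatives, unique only almost everywhere. The
    estimates therefore carry an explicit gradient, and for a linear combination the chosen one is
    compared with it through [L^2] pairings only. *)

Section measurable_rV_functions.
Context {R : realType}.

(** A ball of the sup norm is a box, that is, a finite intersection of coordinate slabs. *)
Lemma measurable_rV_ball d (x : 'rV[R]_d) e : 0 < e ->
  measurable (ball x e : set 'rV[R]_d).
Proof.
move=> e0.
rewrite [X in measurable X](_ : _ = \bigcap_(i in [set: 'I_d])
   (fun y : 'rV[R]_d => y ord0 i : measurableTypeR R) @^-1` ball (x ord0 i) e).
  apply: fin_bigcap_measurable => // i _; rewrite -[X in measurable X]setTI.
  by apply: measurable_coord => //; rewrite ball_itv; exact: measurable_itv.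
apply/seteqP; split=> y /=.
  by move=> [_ xy] i _; exact: xy.
by move=> xy; split=> // i j; rewrite (ord1 i); exact: xy.
Qed.

(** The balls with rational centre and radius [1 / (k + 1)] form a countable base; [U] is the union
    of those contained in it, the others being replaced by [set0]. *)
Lemma measurable_rV_open d (U : set 'rV[R]_d) : open U -> measurable U.
Proof.
move=> oU; pose c (q : 'rV[rat]_d) : 'rV[R]_d := map_mx ratr q.
rewrite [X in measurable X](_ : _ = \bigcup_(p : 'rV[rat]_d * nat)
   if pselect (ball (c p.1) p.2.+1%:R^-1 `<=` U) then ball (c p.1) p.2.+1%:R^-1
   else set0).
  apply: countable_bigcupT_measurable => // -[q k] /=.
  by case: pselect => ? /=; [exact: measurable_rV_ball|exact: measurable0].
apply/seteqP; split=> [x Ux|x [[q k] _] /=]; last first.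
  by case: pselect => // qU; exact: qU.
have /(nbhs_ballP x)[e /= e0 xe] : nbhs x U by exact: open_nbhs_nbhs.
(* The radius must be below [e / 2]: a point of the rational ball around [x] can be two radii away
   from [x]. *)
pose k := Num.truncn (2 / e).
have ke : k.+1%:R^-1 < e / 2.
  by rewrite -(invf_div 2 e) ltf_pV2 ?posrE ?divr_gt0// truncnS_gt.
have qP i : {q : rat | ball (x ord0 i) k.+1%:R^-1 (ratr q : R)}.
  have : exists q : rat, ball (x ord0 i) k.+1%:R^-1 (ratr q : R).
    have [|q] := @rat_in_itvoo R (x ord0 i) (x ord0 i + k.+1%:R^-1).
      by rewrite ltrDl invr_gt0.
    rewrite in_itv/= => /andP[xq qx]; exists q; rewrite /ball/= distrC.
    by rewrite gtr0_norm ?subr_gt0// ltrBlDl.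
  by move/cid.
exists (\row_i projT1 (qP i), k) => //=.
have xc : ball (c (\row_i projT1 (qP i))) k.+1%:R^-1 x.
  split=> [|i j]; first by rewrite invr_gt0.
  by rewrite !mxE (ord1 i); apply: ball_sym; exact: projT2 (qP j).
case: pselect => // nU; exfalso; apply: nU => y cy; apply: xe.
apply: (@le_ball _ _ _ (k.+1%:R^-1 + k.+1%:R^-1)).
  by rewrite (splitr e) ltW// ltrD.
by apply: ball_triangle cy; exact: ball_sym.
Qed.

(** The sigma-algebra is generated by the coordinates, so the open preimages have to go through
    [measurable_rV_open]. *)
Lemma continuous_rV_measurable d (f : 'rV[R]_d -> R) :
  continuous f -> measurable_fun setT f.
Proof.
move=> /continuousP cf.
apply: (measurability _ (RGenOpens.measurableE R)).
move=> _ [_ [a [b ->]] <-]; rewrite setTI; apply: measurable_rV_open.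
by apply: cf; exact: interval_open.
Qed.

Lemma measurable_rVD d d' (T : measurableType d') (f g : T -> 'rV[R]_d) :
  measurable_fun setT f -> measurable_fun setT g ->
  measurable_fun setT (fun x => f x + g x).
Proof.
move=> mf mg; apply: measurable_fun_rVP => i.
under eq_fun do rewrite mxE.
by apply: measurable_funD;
  [exact: measurableT_comp (measurable_coord i) mf
  |exact: measurableT_comp (measurable_coord i) mg].
Qed.

Lemma measurable_rVB d d' (T : measurableType d') (f g : T -> 'rV[R]_d) :
  measurable_fun setT f -> measurable_fun setT g ->
  measurable_fun setT (fun x => f x - g x).
Proof.
move=> mf mg; apply: measurable_fun_rVP => i.
under eq_fun do rewrite 2!mxE.
by apply: measurable_funB;
  [exact: measurableT_comp (measurable_coord i) mf
  |exact: measurableT_comp (measurable_coord i) mg].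
Qed.

Lemma enorm_ge0 d (x : 'rV[R]_d) : 0 <= enorm x.
Proof. exact: sqrtr_ge0. Qed.

Lemma sqr_enorm d (x : 'rV[R]_d) : enorm x ^+ 2 = \sum_i x ord0 i ^+ 2.
Proof. by rewrite sqr_sqrtr// sumr_ge0// => i _; rewrite sqr_ge0. Qed.

Lemma enormN d (x : 'rV[R]_d) : enorm (- x) = enorm x.
Proof.
by rewrite /enorm; congr Num.sqrt; apply: eq_bigr => i _; rewrite mxE sqrrN.
Qed.

Lemma enorm_eq0 d (x : 'rV[R]_d) : enorm x = 0 -> x = 0.
Proof.
move=> x0; have : \sum_i x ord0 i ^+ 2 == 0 by rewrite -sqr_enorm x0 expr0n.
rewrite psumr_eq0; last by move=> i _; exact: sqr_ge0.
move=> /allP x2; apply/rowP => i; rewrite mxE; apply/eqP.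
by rewrite -sqrf_eq0; apply: (implyP (x2 i _)); rewrite ?mem_index_enum.
Qed.

Lemma measurable_enorm d : measurable_fun setT (@enorm R d).
Proof.
rewrite [X in measurable_fun _ X](_ : _ =
   fun x : 'rV[R]_d => (\sum_(i <- index_enum 'I_d) x ord0 i ^+ 2) `^ 2^-1).
  apply: (measurableT_comp (measurable_powR _)).
  by apply: measurable_sum => i; apply: measurable_funX; exact: measurable_coord.
by apply/funext => x; rewrite powR12_sqrt// sumr_ge0// => i _; rewrite sqr_ge0.
Qed.

End measurable_rV_functions.

(** * Affine substitution on the line *)

Section lebesgue_change_of_variable.
Context {R : realType}.
Local Notation mu := (@lebesgue_measure R).

(** Translation and dilation in one rule: [k] times the image of [mu] under [x |-> k x + c] agrees
    with [mu] on half-open intervals, so the two measures coincide by uniqueness of the Lebesgue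
    measure. *)
Lemma ge0_integral_affine (k c : R) (D : set R) (f : R -> \bar R) :
  0 < k -> measurable D -> measurable_fun D f -> (forall x, D x -> 0 <= f x)%E ->
  (\int[mu]_(x in D) f x =
   k%:E * \int[mu]_(x in (fun x => k * x + c)%R @^-1` D) f (k * x + c)%R)%E.
Proof.
move=> k0 mD mf f0; pose phi (x : R) : measurableTypeR R := k * x + c.
have mphi : measurable_fun setT phi.
  by apply: measurable_funD => //; exact: measurable_funM.
pose nu := measure_function_pushforward__canonical__measure_function_Measure
  mu mphi.
have nuE (A : set R) : measurable A -> mu A = mscale (NngNum (ltW k0)) nu A.
  move=> mA; apply: lebesgue_measure_unique => //= _ [[a b]] _ <-.
  rewrite /mscale/= /pushforward.
  have -> : phi @^-1` `]a, b] = `](a - c) / k, (b - c) / k]%classic.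
    apply/seteqP; split => x /=; rewrite !in_itv/= /phi.
      by move=> /andP[ax xb]; rewrite ltr_pdivrMr// ler_pdivlMr// ltrBlDr lerBrDr
        [x * k]mulrC ax xb.
    by rewrite ltr_pdivrMr// ler_pdivlMr// ltrBlDr lerBrDr [x * k]mulrC.
  rewrite !lebesgue_measure_itv/= !lte_fin ltr_pM2r ?invr_gt0// ltrBlDr subrK.
  case: ifPn => _; last by rewrite mule0.
  by rewrite -!EFinB -EFinM -mulrBl opprB addrA subrK mulrCA divff ?mulr1 ?gt_eqF.
transitivity (\int[mscale (NngNum (ltW k0)) nu]_(x in D) f x)%E.
  by apply: eq_measure_integral => A mA _; exact: nuE.
rewrite ge0_integral_mscale//; congr (_ * _)%E.
by rewrite ge0_integral_pushforward// => x; rewrite inE => /f0.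
Qed.

End lebesgue_change_of_variable.

(** * Iterated integrals and translation invariance in dimension [d] *)

Section integral_rV.
Context {R : realType}.
Local Notation mu := (@lebesgue_measure R).
Local Notation leb := (lebesgue_rV R).

Lemma measurable_rV_cons2 d d' (T : measurableType d') (f : T -> R)
    (g : T -> 'rV[R]_d) :
  measurable_fun setT f -> measurable_fun setT g ->
  measurable_fun setT (fun x => rV_cons (f x, g x)).
Proof.
move=> mf mg; apply: (measurableT_comp (@measurable_rV_cons R d)).
exact: measurable_fun_pair.
Qed.

Lemma ge0_integral_rV0 (f : 'rV[R]_0 -> \bar R) :
  (\int[leb 0]_x f x = f 0%R)%E.
Proof.
rewrite integral_dirac ?diracT ?mul1e//.
move=> _ Y mY; rewrite setTI.
have [f0Y|f0Y] := pselect (Y (f 0)).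
  by rewrite (_ : _ @^-1` _ = setT)//; apply/seteqP; split=> // x _ /=;
    rewrite (_ : x = 0)//; apply/rowP => -[].
by rewrite (_ : _ @^-1` _ = set0)//; apply/seteqP; split=> // x /=;
  rewrite (_ : x = 0)//; apply/rowP => -[].
Qed.

(** The measure in dimension [d + 1] is by construction the image of [mu \x leb d] under [rV_cons];
    Tonelli then gives the recursion behind the inductions on the dimension. *)
Lemma ge0_integral_rVS d (f : 'rV[R]_d.+1 -> \bar R) :
  measurable_fun setT f -> (forall x, 0 <= f x)%E ->
  (\int[leb d.+1]_x f x = \int[mu]_a \int[leb d]_x f (rV_cons (a, x)))%E.
Proof.
move=> mf f0.
transitivity (\int[pushforward (mu \x leb d)%E (@rV_cons R d)]_x f x)%E.
  by [].
rewrite ge0_integral_pushforward//; last exact: measurable_rV_cons.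
rewrite preimage_setT fubini_tonelli1//.
  by apply: (measurableT_comp mf); exact: measurable_rV_cons.
by move=> x; exact: f0.
Qed.

Lemma rV_consD d (a b : R) (x y : 'rV[R]_d) :
  rV_cons (a, x) + rV_cons (b, y) = rV_cons (a + b, x + y).
Proof.
apply/rowP => i; rewrite mxE; case: (unliftP ord0 i) => [j|] ->.
  by rewrite !rV_consS /= mxE.
by rewrite !rV_cons0.
Qed.

(** Induction on the dimension: the inner integral absorbs the shift of the last coordinates, and
    the affine rule with factor 1 absorbs that of the first one. *)
Lemma ge0_integral_rV_shift d (v : 'rV[R]_d) (f : 'rV[R]_d -> \bar R) :
  measurable_fun setT f -> (forall x, 0 <= f x)%E ->
  (\int[leb d]_x f (x + v)%R = \int[leb d]_x f x)%E.
Proof.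
elim: d v f => [|d IH] v f mf f0.
  by rewrite !ge0_integral_rV0 add0r; congr f; apply/rowP => -[].
rewrite -(rV_unconsK v); case: (rV_uncons v) => b w.
have mfc a : measurable_fun setT (fun x => f (rV_cons (a, x))).
  by apply: (measurableT_comp mf); exact: measurable_rV_cons2.
rewrite (ge0_integral_rVS mf f0) ge0_integral_rVS; last 2 first.
- by apply: (measurableT_comp mf); exact: measurable_rVD.
- by move=> x; exact: f0.
under eq_integral => a _.
  under eq_integral => x _ do rewrite rV_consD.
  rewrite (IH w (fun x => f (rV_cons (a + b, x))))//.
  over.
rewrite [RHS](@ge0_integral_affine _ 1 b)//.
- by rewrite mul1e preimage_setT; apply: eq_integral => a _; rewrite mul1r.
- apply: (@measurable_fun_fubini_tonelli_F _ _ _ _ _ (leb d)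
      (fun p => f (rV_cons p))) => //.
  by apply: (measurableT_comp mf); exact: measurable_rV_cons.
- by move=> x _; exact: integral_ge0.
Qed.

End integral_rV.

(** * Gaussian integrals *)

Section gaussian_line.
Context {R : realType}.
Local Notation mu := (@lebesgue_measure R).
Implicit Types (F f : R -> R) (b c g x z : R).

(** The tool for integration by parts. The fundamental theorem on [[-(n+1), n+1]] leaves two
    boundary terms, each at most [1 / (n + 1)] by the decay of [F], and dominated convergence passes
    to the whole line. *)
Lemma Rintegral_derive_eq0 F f : (forall x, is_derive x 1 F (f x)) ->
  continuous f -> mu.-integrable setT (EFin \o f) ->
  (forall x, `|F x| * `|x| <= 1) -> (\int[mu]_x f x)%R = 0.
Proof.
move=> dF cf intf F1.
pose D n := `[(- n.+1%:R : R), n.+1%:R]%classic.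
have cF : continuous F.
  by move=> x; apply/differentiable_continuous/derivable1_diffP; exact: ex_derive.
have F2 n : (\int[mu]_x ((EFin \o f) \_ (D n)) x)%E = (F n.+1%:R - F (- n.+1%:R))%:E.
  rewrite -integral_mkcond (continuous_FTC2 (F := F)) ?EFinB//.
  - by rewrite ltrNl (lt_trans _ (ltr0Sn _ n))// oppr_lt0 ltr0Sn.
  - exact: continuous_subspaceT.
  - split=> [x _||].
    + exact: ex_derive.
    + exact/cvg_at_right_filter/cF.
    + exact/cvg_at_left_filter/cF.
  - by move=> x _; rewrite derive1E derive_val.
have mf n : measurable_fun setT ((EFin \o f) \_ (D n)).
  apply/(measurable_restrictT _ _).1; first exact: measurable_itv.
  by apply: measurable_funTS; exact: measurable_int intf.
have fcvg : {ae mu, forall x, setT x ->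
    ((EFin \o f) \_ (D n)) x @[n --> \oo] --> (f x)%:E}.
  apply: nearW => x _; apply: (@cvg_near_cst _ _ _ _ _ _); exists (Num.truncn `|x|) => // n /= xn.
  rewrite patchE mem_set// /D /= in_itv/= -ler_norml.
  rewrite (le_trans (ltW (truncnS_gt _)))// ler_nat ltnS.
  exact: leq_trans xn _.
have fdom : {ae mu, forall x n, setT x ->
    (`|((EFin \o f) \_ (D n)) x| <= `|(f x)%:E|)%E}.
  apply: nearW => x n _; rewrite /= patchE; case: ifP => // _.
  by rewrite [`|point|%E]abse0 lee_fin.
have [_ _] := @dominated_convergence _ _ _ mu setT measurableT
  (fun n => (EFin \o f) \_ (D n)) (EFin \o f) (abse \o (EFin \o f)) mf (measurable_int _ intf) fcvg
  (integrable_abse intf) fdom.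
have cvg0 : (F n.+1%:R - F (- n.+1%:R))%:E @[n --> \oo] --> 0%E.
  apply: cvg_EFin; first exact: nearW.
  apply/norm_cvg0P.
  apply: (@squeeze_cvgr _ _ _ _ (cst 0) (fun n : nat => 2 * n.+1%:R^-1)).
  - apply: nearW => n; rewrite normr_ge0/= (le_trans (ler_normB _ _))//.
    rewrite mulr_natl mulr2n lerD// -[leRHS]mul1r ler_pdivlMr//.
      by rewrite -[X in _ * X]normr_nat F1.
    by have := F1 (- n.+1%:R); rewrite normrN normr_nat.
  - exact: cvg_cst.
  - by rewrite -[X in _ --> X](mulr0 2); apply: cvgM; [exact: cvg_cst|exact: cvg_harmonic].
move=> cvgf; rewrite /Rintegral.
suff -> : (\int[mu]_x (f x)%:E = 0)%E by [].
move: cvg0; rewrite -(funext F2) => cvg0.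
by apply: (cvg_unique _ cvgf cvg0).
Qed.

Lemma is_derive_gauss_fun x : is_derive x 1 (@gauss_fun R) (- (2 * x) * gauss_fun x).
Proof.
rewrite (_ : gauss_fun = expR \o - (id ^+ 2))//.
have d2 : is_derive x (1 : R) (- (id ^+ 2) : R -> R) (- (2 * x)).
  by apply: is_derive_eq; rewrite expr1 /GRing.scale/= mulr1.
by apply: is_derive_eq; rewrite mulrC.
Qed.

(** From [e^t >= 1 + t] at [t = x^2]. This rational decay is enough for the boundary terms in
    [Rintegral_derive_eq0]. *)
Lemma gauss_fun_le_inv x : gauss_fun x <= (1 + x ^+ 2)^-1.
Proof.
rewrite /gauss_fun expRN lef_pV2 ?posrE ?expR_gt0 ?expR_ge1Dx//.
by rewrite ltr_pwDl// sqr_ge0.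
Qed.

Lemma normM_gauss_le x : `|x| * gauss_fun x <= 1.
Proof.
rewrite (le_trans (ler_wpM2l _ (gauss_fun_le_inv x)))//.
rewrite ler_pdivrMr ?ltr_pwDl ?sqr_ge0// mul1r.
have := sqr_ge0 (`|x| - 1); rewrite -(real_normK (num_real x)).
have := normr_ge0 x; nra.
Qed.

Lemma normM2_gauss_le x : `|x * gauss_fun x| * `|x| <= 1.
Proof.
rewrite normrM (ger0_norm (gauss_fun_ge0 x)) mulrAC -expr2 (real_normK (num_real x)).
rewrite (le_trans (ler_wpM2l _ (gauss_fun_le_inv x))) ?sqr_ge0//.
by rewrite ler_pdivrMr ?ltr_pwDl ?sqr_ge0// mul1r lerDr.
Qed.

Definition gauss c z : R := expR (- (c * z ^+ 2)).

(** The total mass of [gauss c] on the line; its [d]-th power is the [K_c] of the overview. *)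
Definition gauss_mass c : R := Num.sqrt (pi / c).

Lemma gauss_ge0 c z : 0 <= gauss c z.
Proof. exact: expR_ge0. Qed.

Lemma continuous_gauss c : continuous (gauss c).
Proof.
move=> x; apply: (@continuous_comp _ _ _ (fun x : R => - (c * x ^+ 2)) expR).
  by apply: cvgN; apply: cvgM; [exact: cvg_cst|exact: exprn_continuous].
exact: continuous_expR.
Qed.

Lemma measurable_gauss c : measurable_fun setT (gauss c).
Proof. exact: continuous_measurable_fun (@continuous_gauss c). Qed.

Lemma gauss_mass_gt0 c : 0 < c -> 0 < gauss_mass c.
Proof. by move=> c0; rewrite sqrtr_gt0 divr_gt0// pi_gt0. Qed.

Lemma gauss_scale c z : 0 <= c -> gauss_fun (Num.sqrt c * z) = gauss c z.
Proof. by move=> c0; rewrite /gauss_fun /gauss exprMn sqr_sqrtr. Qed.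

(** The substitution [y = sqrt c * x], which reduces every width [c] to the standard [gauss_fun]. *)
Lemma ge0_integral_gauss_scale c (h : R -> R) : 0 < c -> measurable_fun setT h ->
  (forall x, 0 <= h x) ->
  (\int[mu]_x (h (Num.sqrt c * x) * gauss c x)%:E =
   (Num.sqrt c)^-1%:E * \int[mu]_x (h x * gauss_fun x)%:E)%E.
Proof.
move=> c0 mh h0.
rewrite [in RHS](@ge0_integral_affine _ (Num.sqrt c) 0)//; last 3 first.
- by rewrite sqrtr_gt0.
- by apply/measurable_EFinP; apply: measurable_funM => //; exact: measurable_gauss_fun.
- by move=> x _; rewrite lee_fin mulr_ge0// gauss_fun_ge0.
rewrite muleA -EFinM mulVf; last by rewrite gt_eqF// sqrtr_gt0.
rewrite mul1e preimage_setT.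
by apply: eq_integral => x _; rewrite addr0 gauss_scale// ltW.
Qed.

Lemma integral_gauss c : 0 < c -> (\int[mu]_x (gauss c x)%:E = (gauss_mass c)%:E)%E.
Proof.
move=> c0; have := @ge0_integral_gauss_scale c (cst 1) c0 (measurable_cst _) (fun=> ler01).
under eq_integral do rewrite mul1r.
under [in X in _ = X -> _]eq_integral do rewrite mul1r.
by rewrite integralT_gauss => ->; rewrite -EFinM /gauss_mass mulrC sqrtrM ?pi_ge0// sqrtrV// ltW.
Qed.

Lemma integrable_gauss c : 0 < c -> mu.-integrable setT (EFin \o gauss c).
Proof.
move=> c0; apply/integrableP; split; first by apply/measurable_EFinP; exact: measurable_gauss.
under eq_integral do rewrite /= ger0_norm ?gauss_ge0//.
by rewrite integral_gauss// ltry.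
Qed.

(* [gauss_fun x = gauss (1 / 2) x ^+ 2], and one factor absorbs the polynomial. *)
Lemma integrable_sqr_gauss (h : R -> R) (k : R) : measurable_fun setT h ->
  (forall x, `|h x| <= k * (1 + x ^+ 2)) ->
  mu.-integrable setT (EFin \o (fun x => h x * gauss_fun x)).
Proof.
move=> mh hk.
have k0 : 0 <= k by have := hk 0; rewrite expr0n addr0 mulr1; exact: le_trans.
have h2 : (0 : R) < 1 / 2 by rewrite divr_gt0.
apply: (@le_integrable _ _ _ mu setT measurableT _
    (EFin \o (fun x => (k * 2) * gauss (1 / 2) x))).
- by apply/measurable_EFinP; apply: measurable_funM => //; exact: measurable_gauss_fun.
- move=> x _ /=; rewrite lee_fin normrM [in leRHS]ger0_norm; last first.
    by rewrite mulr_ge0 ?gauss_ge0 ?mulr_ge0.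
  rewrite (ger0_norm (gauss_fun_ge0 x)).
  have -> : gauss_fun x = gauss (1 / 2) x * gauss (1 / 2) x.
    by rewrite /gauss -expRD /gauss_fun; congr expR; field.
  rewrite mulrA ler_wpM2r ?gauss_ge0//.
  rewrite (le_trans (ler_wpM2r (gauss_ge0 _ _) (hk x)))// -mulrA ler_wpM2l//.
  rewrite /gauss expRN ler_pdivrMr ?expR_gt0//.
  have := expR_ge1Dx (1 / 2 * x ^+ 2); have := sqr_ge0 x; lra.
- rewrite (_ : _ \o _ = (fun x => (k * 2)%:E * (gauss (1 / 2) x)%:E)%E).
    exact/integrableZl/integrable_gauss.
  by apply/funext => x /=; rewrite EFinM.
Qed.

Lemma Rintegral_gauss_fun : (\int[mu]_x gauss_fun x)%R = Num.sqrt pi.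
Proof. by rewrite /Rintegral integralT_gauss. Qed.

Lemma integrable_id_gauss : mu.-integrable setT (EFin \o (fun x => x * gauss_fun x)).
Proof.
apply: (@integrable_sqr_gauss id 1) => // x; rewrite mul1r.
by have := sqr_ge0 (`|x| - 1); rewrite -(real_normK (num_real x)); have := normr_ge0 x; nra.
Qed.

Lemma integrable_exp2_gauss : mu.-integrable setT (EFin \o (fun x => x ^+ 2 * gauss_fun x)).
Proof.
apply: (@integrable_sqr_gauss (fun x => x ^+ 2) 1); first exact: measurable_funX.
by move=> x; rewrite mul1r ger0_norm ?sqr_ge0// lerDr.
Qed.

Lemma Rintegral_id_gauss : (\int[mu]_x (x * gauss_fun x))%R = 0.
Proof.
apply: (@Rintegral_derive_eq0 (fun x => - 2^-1 * gauss_fun x)).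
- move=> x; have dg := is_derive_gauss_fun x.
  rewrite (_ : (fun x => _) = (- 2^-1 : R) \*: (gauss_fun : R -> R))//.
  by apply: is_derive_eq; rewrite /GRing.scale/=; field.
- by move=> x; apply: cvgM; [exact: cvg_id|exact: continuous_gauss_fun].
- exact: integrable_id_gauss.
- move=> x; have := normM_gauss_le x.
  rewrite normrM (ger0_norm (gauss_fun_ge0 x)) normrN [`|2^-1|]gtr0_norm ?invr_gt0//.
  have := mulr_ge0 (normr_ge0 x) (gauss_fun_ge0 x); lra.
Qed.

(** The derivative of [x e^(-x^2)] is [(1 - 2 x^2) e^(-x^2)] and has integral 0, so the second
    moment is half the mass. *)
Lemma Rintegral_exp2_gauss : (\int[mu]_x (x ^+ 2 * gauss_fun x))%R = Num.sqrt pi / 2.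
Proof.
have : (\int[mu]_x (gauss_fun x - 2 * (x ^+ 2 * gauss_fun x)))%R = 0.
  apply: (@Rintegral_derive_eq0 (fun x => x * gauss_fun x)).
  - move=> x; have dg := is_derive_gauss_fun x.
    rewrite (_ : (fun x => _) = id * (gauss_fun : R -> R))//.
    by apply: is_derive_eq; rewrite /GRing.scale/=; ring.
  - move=> x; apply: cvgB; first exact: continuous_gauss_fun.
    apply: cvgM; first exact: cvg_cst.
    by apply: cvgM; [exact: exprn_continuous|exact: continuous_gauss_fun].
  - rewrite (_ : _ \o _ = ((EFin \o gauss_fun) \-
      (fun x => 2%:E * (x ^+ 2 * gauss_fun x)%:E))%E).
      apply: integrableB => //; first exact: integrableT_gauss.
      exact/integrableZl/integrable_exp2_gauss.
    by apply/funext => x /=; rewrite EFinB EFinM.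
  - exact: normM2_gauss_le.
have i2 := integrable_exp2_gauss.
rewrite RintegralB//; [|exact: integrableT_gauss|].
  rewrite RintegralZl// Rintegral_gauss_fun => /eqP; rewrite subr_eq0 => /eqP ->.
  by rewrite mulrC mulKf.
rewrite (_ : _ \o _ = (fun x => 2%:E * (x ^+ 2 * gauss_fun x)%:E)%E).
  exact: integrableZl.
by apply/funext => x /=; rewrite EFinM.
Qed.

(** After scaling, the slope becomes [k = g / sqrt c]. The square is expanded into moments: the
    cross term drops with the first moment, and the second moment turns [k^2] into
    [k^2 / 2 = g^2 / (2 c)]. *)
Lemma integral_affine_sqr_gauss c b g : 0 < c ->
  (\int[mu]_x ((b + x * g) ^+ 2 * gauss c x)%:E =
   ((b ^+ 2 + g ^+ 2 / (2 * c)) * gauss_mass c)%:E)%E.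
Proof.
move=> c0; have sc0 : 0 < Num.sqrt c by rewrite sqrtr_gt0.
pose k := g / Num.sqrt c.
transitivity (\int[mu]_x ((b + (Num.sqrt c * x) * k) ^+ 2 * gauss c x)%:E)%E.
  apply: eq_integral => x _; congr (((b + _) ^+ 2 * _)%:E).
  by rewrite /k mulrAC mulrCA divff ?gt_eqF// mulr1 mulrC.
rewrite (@ge0_integral_gauss_scale c (fun x => (b + x * k) ^+ 2))//; last 2 first.
  by apply: measurable_funX; apply: measurable_funD => //; exact: measurable_funM.
  by move=> x; exact: sqr_ge0.
have i0 := @integrableT_gauss R.
have i1 := integrable_id_gauss; have i2 := integrable_exp2_gauss.
transitivity ((Num.sqrt c)^-1%:E * \int[mu]_x ((b ^+ 2)%:E * (gauss_fun x)%:E +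
   ((2 * b * k)%:E * (x * gauss_fun x)%:E + (k ^+ 2)%:E * (x ^+ 2 * gauss_fun x)%:E)))%E.
  congr (_ * _)%E; apply: eq_integral => x _.
  by rewrite -!EFinM -!EFinD; congr EFin; ring.
rewrite integralD//; last 2 first.
  exact: integrableZl.
  by apply: integrableD => //; exact: integrableZl.
rewrite integralD//; try exact: integrableZl.
rewrite !integralZl//.
have -> : (\int[mu]_x (x * gauss_fun x)%:E = 0)%E.
  by rewrite -[LHS]fineK ?integrable_fin_num//; congr EFin; exact: Rintegral_id_gauss.
have -> : (\int[mu]_x (x ^+ 2 * gauss_fun x)%:E = (Num.sqrt pi / 2)%:E)%E.
  by rewrite -[LHS]fineK ?integrable_fin_num//; congr EFin; exact: Rintegral_exp2_gauss.
rewrite integralT_gauss mule0 add0e -!EFinM; congr EFin.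
rewrite /gauss_mass sqrtrM ?pi_ge0// sqrtrV ?ltW// /k exprMn exprVn sqr_sqrtr ?ltW//.
by field; rewrite !gt_eqF.
Qed.

(* The characteristic function solves [C' = - (b / 2) C]. *)
Lemma Rintegral_cos_gauss b :
  (\int[mu]_x (cos (b * x) * gauss_fun x))%R = Num.sqrt pi * expR (- (b ^+ 2 / 4)).
Proof.
pose C b := (\int[mu]_x (cos (b * x) * gauss_fun x))%R.
pose f b x := cos (b * x) * gauss_fun x.
have mbx (d : R) : measurable_fun setT (fun x : R => d * x) by exact: measurable_funM.
have mcos (d : R) : measurable_fun setT (fun x : R => cos (d * x)).
  by apply: measurableT_comp (mbx d); exact: continuous_measurable_fun (@continuous_cos R).
have msin (d : R) : measurable_fun setT (fun x : R => sin (d * x)).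
  by apply: measurableT_comp (mbx d); exact: continuous_measurable_fun (@continuous_sin R).
have x1 (x : R) : `|x| <= 1 + x ^+ 2.
  by have := sqr_ge0 (`|x| - 1); rewrite -(real_normK (num_real x)); have := normr_ge0 x; nra.
have intf d : mu.-integrable setT (EFin \o f d).
  apply: (@integrable_sqr_gauss (fun x => cos (d * x)) 1) => // x.
  by rewrite mul1r (le_trans (cos_max _))// lerDl sqr_ge0.
have intsin d : mu.-integrable setT (EFin \o (fun x => (x * sin (d * x)) * gauss_fun x)).
  apply: (@integrable_sqr_gauss (fun x => x * sin (d * x)) 1).
    exact: measurable_funM.
  move=> x; rewrite mul1r normrM (le_trans _ (x1 x))//.
  by rewrite -[leRHS]mulr1 ler_wpM2l// sin_max.
have df d x : is_derive d (1 : R) (fun d : R => f d x) (- (x * sin (d * x) * gauss_fun x)).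
  have d1 : is_derive d (1 : R) (fun d : R => d * x) x.
    rewrite (_ : (fun d : R => _) = x \*: (id : R -> R)).
      by apply: is_derive_eq; rewrite /GRing.scale/= mulr1.
    by apply/funext => y; rewrite /= /GRing.scale/= mulrC.
  rewrite (_ : (fun d : R => f d x) = gauss_fun x \*: (cos \o (fun d : R => d * x))).
    by apply: is_derive_eq; rewrite /GRing.scale/=; ring.
  by apply/funext => y; rewrite /= /GRing.scale/= mulrC.
(* Integration by parts: the derivative of [sin (d x) e^(-x^2)] integrates to 0. *)
have sinE d : (\int[mu]_x (x * sin (d * x) * gauss_fun x))%R = d / 2 * C d.
  have : (\int[mu]_x (d * f d x - 2 * (x * sin (d * x) * gauss_fun x)))%R = 0.
    apply: (@Rintegral_derive_eq0 (fun x => sin (d * x) * gauss_fun x)).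
    - move=> x; have dg := is_derive_gauss_fun x.
      have d1 : is_derive x (1 : R) (fun x : R => d * x) d.
        rewrite (_ : (fun d : R => _) = d \*: (id : R -> R))//.
        by apply: is_derive_eq; rewrite /GRing.scale/= mulr1.
      rewrite (_ : (fun x => _) = (sin \o (fun x : R => d * x)) * (gauss_fun : R -> R))//.
      by apply: is_derive_eq; rewrite /GRing.scale/= /f; ring.
    - have cd : continuous (fun x : R => d * x).
        by move=> x; apply: cvgM; [exact: cvg_cst|exact: cvg_id].
      move=> x; apply: cvgB; apply: cvgM; try exact: cvg_cst.
        apply: cvgM; last exact: continuous_gauss_fun.
        by apply: continuous_comp; [exact: cd|exact: continuous_cos].
      apply: cvgM; last exact: continuous_gauss_fun.
      apply: cvgM; first exact: cvg_id.
      by apply: continuous_comp; [exact: cd|exact: continuous_sin].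
    - rewrite (_ : _ \o _ = ((fun x => d%:E * (f d x)%:E) \-
        (fun x => 2%:E * (x * sin (d * x) * gauss_fun x)%:E))%E).
        by apply: integrableB => //; [exact/integrableZl/intf|exact/integrableZl/intsin].
      by apply/funext => x /=; rewrite EFinB !EFinM.
    - move=> x; rewrite normrM -mulrA (ger0_norm (gauss_fun_ge0 x)).
      rewrite (le_trans _ (normM_gauss_le x))// [leLHS]mulrA mulrC mulrA.
      by rewrite ler_wpM2r ?gauss_fun_ge0// -[leRHS]mulr1 ler_wpM2l// sin_max.
  rewrite RintegralB//; last 2 first.
    rewrite (_ : _ \o _ = (fun x => d%:E * (f d x)%:E)%E); first exact/integrableZl/intf.
    by apply/funext => x.
    rewrite (_ : _ \o _ = (fun x => 2%:E * (x * sin (d * x) * gauss_fun x)%:E)%E).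
      exact/integrableZl/intsin.
    by apply/funext => x.
  rewrite !RintegralZl// => /eqP; rewrite subr_eq0 => /eqP e.
  by rewrite mulrAC /C -/(f d) e mulrC mulKf.
(* Differentiation under the integral, on the interval of radius 1 around [d]; the dominating
   function [(1 + x^2) e^(-x^2)] does not depend on the parameter. *)
have dC d : is_derive d (1 : R) C (- (d / 2 * C d)).
  have Id : `](d - 1), (d + 1)[%classic d by rewrite /= in_itv/= ltrBlDr ltrDl ltr01.
  have derf1 (y x : R) : `](d - 1), (d + 1)[%classic y -> [set: R] x ->
      derivable (fun d : R => f d x) y (1 : R) by move=> _ _; exact: ex_derive.
  have Gub (y x : R) : `](d - 1), (d + 1)[%classic y -> [set: R] x ->
      `|partial1of2 f y x| <= (1 + x ^+ 2) * gauss_fun x.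
    move=> _ _; rewrite partial1of2E derive_val normrN normrM.
    rewrite (ger0_norm (gauss_fun_ge0 x)) ler_wpM2r ?gauss_fun_ge0//.
    rewrite normrM (le_trans _ (x1 x))//.
    by rewrite -[leRHS]mulr1 ler_wpM2l// sin_max.
  have G0 (x : R) : 0 <= (1 + x ^+ 2) * gauss_fun x.
    by rewrite mulr_ge0 ?gauss_fun_ge0// addr_ge0// sqr_ge0.
  have iG : mu.-integrable setT (EFin \o (fun x => (1 + x ^+ 2) * gauss_fun x)).
    apply: (@integrable_sqr_gauss (fun x => 1 + x ^+ 2) 1).
      by apply: measurable_funD => //; exact: measurable_funX.
    by move=> x; rewrite mul1r ger0_norm// addr_ge0// sqr_ge0.
  have dCd := @derivable_under_integral _ _ _ mu f setT measurableT d _ _ Id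
    (fun x _ => intf x) derf1 _ G0 iG Gub.
  have eC := @differentiation_under_integral _ _ _ mu f setT measurableT d _ _ Id
    (fun x _ => intf x) derf1 _ G0 iG Gub.
  apply: DeriveDef; first exact: dCd.
  rewrite -derive1E [LHS]eC -sinE.
  transitivity ((\int[mu]_x (-1 * (x * sin (d * x) * gauss_fun x)))%R).
    by apply: eq_Rintegral => x _; rewrite partial1of2E derive_val mulN1r.
  by rewrite RintegralZl// mulN1r.
have e4 d : is_derive d (1 : R) (fun d : R => expR (d ^+ 2 / 4)) (d / 2 * expR (d ^+ 2 / 4)).
  have d1 : is_derive d (1 : R) (fun d : R => d ^+ 2 / 4) (d / 2).
    rewrite (_ : (fun d : R => _) = (4^-1 : R) \*: (id ^+ 2 : R -> R)).
      by apply: is_derive_eq; rewrite /GRing.scale/= expr1; field.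
    by apply/funext => y; rewrite /= /GRing.scale/= mulrC.
  rewrite (_ : (fun d : R => _) = expR \o (fun d : R => d ^+ 2 / 4))//.
  by apply: is_derive_eq; rewrite mulrC.
(* By the differential equation the product with [e^(b^2 / 4)] has derivative 0, so it keeps its
   value at 0. *)
have : C b * expR (b ^+ 2 / 4) = C 0 * expR (0 ^+ 2 / 4).
  apply: (@is_derive_0_is_cst _ (fun d => C d * expR (d ^+ 2 / 4))) => d.
  have := dC d; have := e4 d => e4d dCd.
  rewrite (_ : (fun d : R => _) = C * (fun d : R => expR (d ^+ 2 / 4)))//.
  by apply: is_derive_eq; rewrite /GRing.scale/=; ring.
have -> : C 0 = Num.sqrt pi.
  rewrite -Rintegral_gauss_fun; apply: eq_Rintegral => x _.
  by rewrite mul0r cos0 mul1r.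
rewrite expr0n mul0r expR0 mulr1 -/(C b) => <-.
by rewrite expRN mulfK// gt_eqF ?expR_gt0.
Qed.

(** Scaling replaces [cos x] by [cos (b y)] with [b = 1 / sqrt c], so the characteristic function
    contributes [b^2 / 4 = 1 / (4 c)]. At [c = a / 4] the factor becomes [1 - e^(-1/a)]. *)
Lemma integral_1Bcos_gauss c : 0 < c ->
  (\int[mu]_x ((1 - cos x) * gauss c x)%:E =
   ((1 - expR (- (4 * c)^-1)) * gauss_mass c)%:E)%E.
Proof.
move=> c0; have sc0 : 0 < Num.sqrt c by rewrite sqrtr_gt0.
pose b := (Num.sqrt c)^-1.
have mcos : measurable_fun setT (fun x : R => cos (b * x)).
  apply: measurableT_comp; first exact: continuous_measurable_fun (@continuous_cos R).
  exact: measurable_funM.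
transitivity (\int[mu]_x ((1 - cos (b * (Num.sqrt c * x))) * gauss c x)%:E)%E.
  by apply: eq_integral => x _; rewrite mulrA mulVf ?gt_eqF// mul1r.
rewrite (@ge0_integral_gauss_scale c (fun x => 1 - cos (b * x)))//; last first.
  exact: measurable_funB.
have i0 := @integrableT_gauss R.
have i1 : mu.-integrable setT (EFin \o (fun x => cos (b * x) * gauss_fun x)).
  apply: (@integrable_sqr_gauss (fun x => cos (b * x)) 1) => // x.
  by rewrite mul1r (le_trans (cos_max _))// lerDl sqr_ge0.
transitivity ((Num.sqrt c)^-1%:E * \int[mu]_x ((gauss_fun x)%:E -
   (cos (b * x) * gauss_fun x)%:E))%E.
  by congr (_ * _)%E; apply: eq_integral => x _; rewrite -EFinB mulrBl mul1r.
rewrite integralB// integralT_gauss.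
have -> : (\int[mu]_x (cos (b * x) * gauss_fun x)%:E =
    (Num.sqrt pi * expR (- (b ^+ 2 / 4)))%:E)%E.
  by rewrite -[LHS]fineK ?integrable_fin_num//; congr EFin; exact: Rintegral_cos_gauss.
rewrite -EFinB -EFinM; congr EFin.
have -> : b ^+ 2 / 4 = (4 * c)^-1 by rewrite /b exprVn sqr_sqrtr ?ltW// -invfM mulrC.
rewrite /gauss_mass sqrtrM ?pi_ge0// sqrtrV ?ltW//; ring.
Qed.

End gaussian_line.

(** * Gaussian integrals in dimension [d] *)

Section gaussian_space.
Context {R : realType}.
Local Notation mu := (@lebesgue_measure R).
Local Notation leb := (lebesgue_rV R).

Definition gauss_rV d (c : R) (z : 'rV[R]_d) : R := expR (- (c * enorm z ^+ 2)).

Lemma gauss_rV_ge0 d c (z : 'rV[R]_d) : 0 <= gauss_rV c z.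
Proof. exact: expR_ge0. Qed.

Lemma gauss_rVN d c (z : 'rV[R]_d) : gauss_rV c (- z) = gauss_rV c z.
Proof. by rewrite /gauss_rV enormN. Qed.

Lemma measurable_gauss_rV d c : measurable_fun setT (@gauss_rV d c).
Proof.
apply: measurableT_comp => //; apply: measurable_funN; apply: measurable_funM => //.
by apply: measurable_funX; exact: measurable_enorm.
Qed.

Lemma gauss_rV_cons d c a (x : 'rV[R]_d) :
  gauss_rV c (rV_cons (a, x)) = gauss c a * gauss_rV c x.
Proof.
rewrite /gauss_rV /gauss -expRD !sqr_enorm big_ord_recl rV_cons0/=.
under eq_bigr do rewrite rV_consS.
by rewrite mulrDr opprD.
Qed.

Lemma integral_gauss_rV d c : 0 < c ->
  (\int[leb d]_x (gauss_rV c x)%:E = (gauss_mass c ^+ d)%:E)%E.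
Proof.
move=> c0; elim: d => [|d IH].
  by rewrite ge0_integral_rV0 expr0 /gauss_rV sqr_enorm big_ord0 mulr0 oppr0 expR0.
rewrite ge0_integral_rVS; last 2 first.
- by apply/measurable_EFinP; exact: measurable_gauss_rV.
- by move=> x; rewrite lee_fin gauss_rV_ge0.
transitivity (\int[mu]_a ((gauss c a)%:E * (gauss_mass c ^+ d)%:E))%E.
  apply: eq_integral => a _.
  under eq_integral do rewrite gauss_rV_cons EFinM.
  rewrite ge0_integralZl ?IH//.
  - by apply/measurable_EFinP; exact: measurable_gauss_rV.
  - by move=> x _; rewrite lee_fin gauss_rV_ge0.
  - by rewrite lee_fin gauss_ge0.
rewrite ge0_integralZr//.
- by rewrite integral_gauss// -EFinM exprS.
- by apply/measurable_EFinP; exact: measurable_gauss.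
- by move=> x _; rewrite lee_fin gauss_ge0.
- by rewrite lee_fin exprn_ge0// ltW// gauss_mass_gt0.
Qed.

(** The constant term [b] makes the induction work: with the first coordinate [a] frozen, the inner
    integral is of the same form with [b + a * g ord0] in place of [b]. At [b = 0] this is the
    Gaussian average of a squared directional derivative. *)
Lemma integral_affine_sqr_gauss_rV d c b (g : 'I_d -> R) : 0 < c ->
  (\int[leb d]_x ((b + \sum_i x ord0 i * g i) ^+ 2 * gauss_rV c x)%:E =
   ((b ^+ 2 + (\sum_i g i ^+ 2) / (2 * c)) * gauss_mass c ^+ d)%:E)%E.
Proof.
have mf d' (b' : R) (g' : 'I_d' -> R) : measurable_fun setT
    (fun x : 'rV[R]_d' => ((b' + \sum_i x ord0 i * g' i) ^+ 2 * gauss_rV c x)%:E).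
  apply/measurable_EFinP; apply: measurable_funM; last exact: measurable_gauss_rV.
  apply: measurable_funX; apply: measurable_funD => //.
  by apply: measurable_sum => i; apply: measurable_funM => //; exact: measurable_coord.
move=> c0; elim: d b g => [|d IH] b g.
  rewrite ge0_integral_rV0 expr0 /gauss_rV sqr_enorm !big_ord0.
  by rewrite mulr0 oppr0 expR0 mul0r !addr0 !mulr1.
rewrite ge0_integral_rVS//; last first.
  by move=> x; rewrite lee_fin mulr_ge0 ?sqr_ge0 ?gauss_rV_ge0.
pose S := \sum_(i < d) g (lift ord0 i) ^+ 2.
have G0 := gauss_mass_gt0 c0.
have S0 : 0 <= S / (2 * c).
  by rewrite divr_ge0 ?sumr_ge0 ?mulr_ge0 ?(ltW c0)// => i _; rewrite sqr_ge0.
transitivity (\int[mu]_a ((gauss_mass c ^+ d)%:E * (((b + a * g ord0) ^+ 2 * gauss c a)%:E +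
   (S / (2 * c))%:E * (gauss c a)%:E)))%E.
  apply: eq_integral => a _.
  transitivity ((gauss c a)%:E * \int[leb d]_x
     (((b + a * g ord0) + \sum_i x ord0 i * g (lift ord0 i)) ^+ 2 * gauss_rV c x)%:E)%E.
    rewrite -ge0_integralZl//; last first.
    - by rewrite lee_fin gauss_ge0.
    - by move=> x _; rewrite lee_fin mulr_ge0 ?sqr_ge0 ?gauss_rV_ge0.
    - exact: mf.
    apply: eq_integral => x _; rewrite gauss_rV_cons -EFinM; congr EFin.
    rewrite big_ord_recl rV_cons0 addrA mulrCA; congr (_ * ((_ + _) ^+ 2 * _)).
    by apply: eq_bigr => i _; rewrite rV_consS.
  by rewrite IH -!EFinM; congr EFin; rewrite -/S; ring.
have mg : measurable_fun setT (fun a : R => (gauss c a)%:E).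
  by apply/measurable_EFinP; exact: measurable_gauss.
have mg2 : measurable_fun setT (fun a : R => ((b + a * g ord0) ^+ 2 * gauss c a)%:E).
  apply/measurable_EFinP; apply: measurable_funM; last exact: measurable_gauss.
  by apply: measurable_funX; apply: measurable_funD => //; exact: measurable_funM.
have mg3 : measurable_fun setT (fun a : R => ((S / (2 * c))%:E * (gauss c a)%:E)%E).
  by apply: emeasurable_funM.
have g20 (a : R) : (0 <= ((b + a * g ord0) ^+ 2 * gauss c a)%:E)%E.
  by rewrite lee_fin mulr_ge0 ?sqr_ge0 ?gauss_ge0.
have g30 (a : R) : (0 <= (S / (2 * c))%:E * (gauss c a)%:E)%E.
  by rewrite -EFinM lee_fin mulr_ge0 ?gauss_ge0.
rewrite ge0_integralZl//; last first.
- by rewrite lee_fin exprn_ge0// ltW.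
- by move=> a _; exact: adde_ge0.
- exact: emeasurable_funD.
rewrite ge0_integralD// ge0_integralZl//; last first.
- by move=> a _; rewrite lee_fin gauss_ge0.
rewrite integral_affine_sqr_gauss// integral_gauss// -!EFinM.
by congr EFin; rewrite big_ord_recl -/S [gauss_mass c ^+ d.+1]exprS; field; rewrite gt_eqF.
Qed.

Lemma integral_1Bcos_gauss_rV d c : 0 < c ->
  (\int[leb d.+1]_x ((1 - cos (x ord0 ord0)) * gauss_rV c x)%:E =
   ((1 - expR (- (4 * c)^-1)) * gauss_mass c ^+ d.+1)%:E)%E.
Proof.
move=> c0; have mcos : measurable_fun setT (fun a : R => 1 - cos a).
  by apply: measurable_funB => //; exact: continuous_measurable_fun (@continuous_cos R).
have cos0 (a : R) : 0 <= 1 - cos a by rewrite subr_ge0 cos_le1.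
rewrite ge0_integral_rVS; last 2 first.
- apply/measurable_EFinP; apply: measurable_funM; last exact: measurable_gauss_rV.
  exact: measurableT_comp mcos (measurable_coord _).
- by move=> x; rewrite lee_fin mulr_ge0 ?gauss_rV_ge0.
transitivity (\int[mu]_a (((1 - cos a) * gauss c a)%:E * (gauss_mass c ^+ d)%:E))%E.
  apply: eq_integral => a _.
  under eq_integral do rewrite rV_cons0/= gauss_rV_cons mulrA EFinM.
  rewrite ge0_integralZl ?integral_gauss_rV//.
  - by apply/measurable_EFinP; exact: measurable_gauss_rV.
  - by move=> x _; rewrite lee_fin gauss_rV_ge0.
  - by rewrite lee_fin mulr_ge0 ?gauss_ge0.
rewrite ge0_integralZr//.
- by rewrite integral_1Bcos_gauss// -EFinM exprS mulrA.
- by apply/measurable_EFinP; apply: measurable_funM => //; exact: measurable_gauss.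
- by move=> x _; rewrite lee_fin mulr_ge0 ?gauss_ge0.
- by rewrite lee_fin exprn_ge0// ltW// gauss_mass_gt0.
Qed.

Lemma integral_gauss_rV_shift d c (m : 'rV[R]_d) : 0 < c ->
  (\int[leb d]_x (gauss_rV c (x - m))%:E = (gauss_mass c ^+ d)%:E)%E.
Proof.
move=> c0; rewrite -(integral_gauss_rV d c0).
apply: (ge0_integral_rV_shift (- m) (f := fun x => (gauss_rV c x)%:E)).
  by apply/measurable_EFinP; exact: measurable_gauss_rV.
by move=> x; rewrite lee_fin gauss_rV_ge0.
Qed.

End gaussian_space.

(** * Power integrals on the half-line *)

Section power_integrals.
Context {R : realType}.
Local Notation mu := (@lebesgue_measure R).

(** Monotone convergence: a bound uniform over compact intervals, where the fundamental theorem
    applies, passes to the improper integral. *)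
Lemma ge0_integral_bigcup_le (F : (set R)^nat) (f : R -> \bar R) (K : \bar R) :
  nondecreasing_seq F -> (forall i, measurable (F i)) -> measurable_fun setT f ->
  (forall x, 0 <= f x)%E -> (forall i, \int[mu]_(x in F i) f x <= K)%E ->
  (\int[mu]_(x in \bigcup_i F i) f x <= K)%E.
Proof.
move=> ndF mF mf f0 fK.
have h : (\int[mu]_(x in F i) f x)%E @[i --> \oo] --> (\int[mu]_(x in \bigcup_i F i) f x)%E.
  by apply: ge0_nondecreasing_set_cvg_integral => // i; exact: measurable_funTS.
rewrite -(cvg_lim _ h)//; apply: lime_le; first exact: cvgP h.
exact: nearW.
Qed.

(** For [p > 0] and [r > 0] this is [4^p Gamma(p) r^(-2p)]; only its positivity and its scaling in
    [r] are used. *)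
Definition gamma_integral (p r : R) : \bar R :=
  (\int[mu]_(a in `]0%R, +oo[) (a `^ (p - 1) * expR (- (a / 4 * r ^+ 2)))%:E)%E.

Lemma measurable_gamma_integrand (p r : R) :
  measurable_fun setT (fun a : R => a `^ (p - 1) * expR (- (a / 4 * r ^+ 2))).
Proof.
apply: measurable_funM; first exact: measurable_powR.
by apply: measurableT_comp => //; apply: measurable_funN; do 2 apply: measurable_funM => //.
Qed.

(** The substitution [a = x / r^2] gives [r^(-2)] from the differential and [r^(-2(p-1))] from the
    power. With [r = |z|] this produces the fractional kernel. *)
Lemma gamma_integralE (p r : R) : 0 < r ->
  (gamma_integral p r = (r `^ (- (2 * p)))%:E * gamma_integral p 1)%E.
Proof.
move=> r0; rewrite /gamma_integral.
have k0 : 0 < (r ^+ 2)^-1 by rewrite invr_gt0 exprn_gt0.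
rewrite (@ge0_integral_affine _ (r ^+ 2)^-1 0)//; last 2 first.
- by apply/measurable_EFinP; apply: measurable_funTS; exact: measurable_gamma_integrand.
- by move=> x _; rewrite lee_fin mulr_ge0 ?powR_ge0 ?expR_ge0.
have -> : (fun x : R => (r ^+ 2)^-1 * x + 0) @^-1` `]0%R, +oo[ = `]0%R, +oo[%classic.
  by apply/seteqP; split => x /=; rewrite !in_itv/= !andbT addr0 pmulr_rgt0.
transitivity ((r ^+ 2)^-1%:E * \int[mu]_(x in `]0%R, +oo[)
    ((r `^ (- (2 * (p - 1))))%:E * (x `^ (p - 1) * expR (- (x / 4 * 1 ^+ 2)))%:E))%E.
  congr (_ * _)%E; apply: eq_integral => x; rewrite inE/= in_itv/= andbT => x0.
  rewrite -[RHS]EFinM; congr EFin; rewrite addr0 [RHS]mulrA.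
  congr (_ * expR (- _)); last by field; rewrite gt_eqF.
  rewrite powRM ?(ltW x0) ?(ltW k0)//; congr (_ * _).
  by rewrite -powR_invn ?(ltW r0)// -powRrM mulNr.
rewrite ge0_integralZl//; last 3 first.
- by apply/measurable_EFinP; apply: measurable_funTS; exact: measurable_gamma_integrand.
- by move=> x _; rewrite lee_fin mulr_ge0 ?powR_ge0 ?expR_ge0.
- by rewrite lee_fin powR_ge0.
rewrite muleA -EFinM; congr (_%:E * _)%E.
rewrite -powR_invn ?(ltW r0)// -powRD; last by apply/implyP => _; rewrite gt_eqF.
by congr (_ `^ _); ring.
Qed.

Lemma gamma_integral_gt0 (p r : R) : (0 < gamma_integral p r)%E.
Proof.
have itv12 : (`[1%R, 2%R] : set R) `<=` `]0%R, +oo[.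
  by move=> x /=; rewrite !in_itv/= andbT => /andP[x1 _]; rewrite (lt_le_trans _ x1).
(* On [[1, 2]] the power is monotone in a direction given by the sign of [p - 1], hence at least the
   smaller of its end values; the exponential is smallest at 2. *)
pose m := Num.min 1 (2 `^ (p - 1)) * expR (- (2 / 4 * r ^+ 2)).
have m0 : 0 < m by rewrite mulr_gt0 ?expR_gt0// lt_min ltr01 powR_gt0.
apply: (@lt_le_trans _ _ (\int[mu]_(a in `[1%R, 2%R]) m%:E)%E).
  by rewrite integral_cst//= lebesgue_measure_itv/= lte_fin ltrDl ltr01
    -EFinB -EFinM lte_fin addrK mulr1.
apply: (@le_trans _ _ (\int[mu]_(a in `[1%R, 2%R]) (a `^ (p - 1) * expR (- (a / 4 * r ^+ 2)))%:E)%E).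
  apply: ge0_le_integral => //.
  - by move=> x _; rewrite lee_fin ltW.
  - by apply/measurable_EFinP; apply: measurable_funTS; exact: measurable_gamma_integrand.
  move=> x /=; rewrite in_itv/= => /andP[x1 x2]; rewrite lee_fin ler_pM//.
  - rewrite ge_min; have [p1|p1] := leP 1 p.
      have e : 1 `^ (p - 1) = 1 :> R by rewrite powR1.
      by rewrite -[X in X <= _]e ge0_ler_powR ?nnegrE ?subr_ge0 ?(le_trans _ x1).
    have x0 : 0 < x by rewrite (lt_le_trans _ x1).
    have q0 : 0 <= 1 - p by rewrite subr_ge0 ltW.
    apply/orP; right; have -> : p - 1 = - (1 - p) by rewrite opprB.
    by rewrite !powRN lef_pV2 ?posrE ?powR_gt0// ge0_ler_powR ?nnegrE// ltW.
  - by rewrite ler_expR lerN2 ler_wpM2r ?sqr_ge0// ler_wpM2r.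
apply: ge0_subset_integral => //.
  by apply/measurable_EFinP; apply: measurable_funTS; exact: measurable_gamma_integrand.
by move=> x _; rewrite lee_fin mulr_ge0 ?powR_ge0 ?expR_ge0.
Qed.

Lemma integral_powR_itv (r a b : R) : r != 0 -> 0 < a -> a < b ->
  (\int[mu]_(x in `[a, b]) (x `^ (r - 1))%:E = ((b `^ r - a `^ r) / r)%:E)%E.
Proof.
move=> r0 a0 ab.
have dF (x : R) : 0 < x -> is_derive x (1 : R) (fun x : R => x `^ r / r) (x `^ (r - 1)).
  move=> x0; have xin : x \in `]0, +oo[ by rewrite in_itv/= x0.
  have d1 := is_derive1_powR r x0.
  rewrite (_ : (fun x : R => _) = r^-1 \*: ((@powR R) ^~ r)).
    by apply: is_derive_eq; rewrite /GRing.scale/= mulKf.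
  by apply/funext => y; rewrite /= /GRing.scale/= mulrC.
have cF (x : R) : 0 < x -> {for x, continuous (fun x : R => x `^ r / r)}.
  move=> x0; have := dF x x0 => d.
  by apply/differentiable_continuous/derivable1_diffP; exact: ex_derive.
have cf (x : R) : 0 < x -> {for x, continuous (fun x : R => x `^ (r - 1))}.
  move=> x0; apply/differentiable_continuous/derivable1_diffP.
  by apply: derivable_powR; rewrite in_itv/= x0.
rewrite (continuous_FTC2 (F := fun x : R => x `^ r / r))//.
- by rewrite -EFinB mulrBl.
- apply: continuous_in_subspaceT => x; rewrite inE/= in_itv/= => /andP[ax _].
  exact: (cf _ (lt_le_trans a0 ax)).
- split => [x||].
  + rewrite in_itv/= => /andP[ax _].
    by have := dF x (lt_trans a0 ax) => d; exact: ex_derive.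
  + exact/cvg_at_right_filter/cF.
  + by apply/cvg_at_left_filter/cF; exact: lt_trans ab.
- move=> x; rewrite in_itv/= => /andP[ax _].
  by have := dF x (lt_trans a0 ax) => d; rewrite derive1E derive_val.
Qed.

Lemma integral_inv1D_01 :
  (\int[mu]_(x in `[0%R, 1%R]) ((1 + x)^-1)%:E = (ln 2 : R)%:E)%E.
Proof.
have dF (x : R) : 0 <= x -> is_derive x (1 : R) (fun x : R => ln (1 + x)) (1 + x)^-1.
  move=> x0; have x1 : 0 < 1 + x by rewrite ltr_pwDl.
  have d1 : is_derive x (1 : R) (fun x : R => 1 + x) 1.
    by rewrite (_ : (fun x => _) = cst 1 + id)//; apply: is_derive_eq; rewrite add0r.
  have d2 := is_derive1_ln x1.
  rewrite (_ : (fun x => _) = (@ln R) \o (fun x : R => 1 + x))//.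
  by apply: is_derive_eq; rewrite mulr1.
have cF (x : R) : 0 <= x -> {for x, continuous (fun x : R => ln (1 + x))}.
  move=> x0; have := dF x x0 => d.
  by apply/differentiable_continuous/derivable1_diffP; exact: ex_derive.
rewrite (continuous_FTC2 (F := fun x : R => ln (1 + x)))//.
- by rewrite addr0 ln1 -EFinB subr0.
- apply: continuous_in_subspaceT => x; rewrite inE/= in_itv/= => /andP[x0 _].
  apply: cvgV; first by rewrite gt_eqF// ltr_pwDl.
  by apply: cvgD; [exact: cvg_cst|exact: cvg_id].
- split => [x||].
  + rewrite in_itv/= => /andP[x0 _].
    by have := dF x (ltW x0) => d; exact: ex_derive.
  + exact/cvg_at_right_filter/cF.
  + exact/cvg_at_left_filter/cF.
- move=> x; rewrite in_itv/= => /andP[x0 _].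
  by have := dF x (ltW x0) => d; rewrite derive1E derive_val.
Qed.

(** The inversion [x |-> 1 / x] carries this integral to that of [1 / (1 + x)] over [[0, 1]]. The
    common value [ln 2] is what allows the two halves of the half-line to be traded against each
    other. *)
Lemma integral_inv1D_1y :
  (\int[mu]_(x in `[1%R, +oo[) ((x * (1 + x))^-1)%:E = (ln 2 : R)%:E)%E.
Proof.
(* This is [ln (x / (1 + x))], in a form that shows the limit 0 at infinity. *)
pose F (x : R) := ln (1 - (1 + x)^-1).
have dF (x : R) : 0 < x -> is_derive x (1 : R) F (x * (1 + x))^-1.
  move=> x0; have x1 : 0 < 1 + x by rewrite ltr_pwDl// ltW.
  have x2 : 0 < 1 - (1 + x)^-1 by rewrite subr_gt0 invf_lt1// ltrDl.
  have d1 : is_derive x (1 : R) (fun x : R => 1 + x) 1.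
    by rewrite (_ : (fun x => _) = cst 1 + id)//; apply: is_derive_eq; rewrite add0r.
  have d0 : is_derive x (1 : R) (fun x : R => (1 + x)^-1) (- (1 + x) ^- 2).
    have := is_deriveV (lt0r_neq0 x1 : (fun x : R => 1 + x) x != 0) d1.
    by rewrite /GRing.scale/= mulr1.
  have d2 : is_derive x (1 : R) (fun x : R => 1 - (1 + x)^-1) ((1 + x) ^- 2).
    rewrite (_ : (fun x => _) = cst 1 - (fun x : R => (1 + x)^-1))//.
    by apply: is_derive_eq; rewrite sub0r opprK.
  have d3 := is_derive1_ln x2.
  rewrite (_ : F = (@ln R) \o (fun x : R => 1 - (1 + x)^-1))//.
  by apply: is_derive_eq; field; rewrite !gt_eqF// addrAC subrr add0r.
have cF (x : R) : 0 < x -> {for x, continuous F}.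
  move=> x0; have := dF x x0 => d.
  by apply/differentiable_continuous/derivable1_diffP; exact: ex_derive.
rewrite (@ge0_continuous_FTC2y _ _ F _ 0)//.
- rewrite sub0e -EFinN /F -lnV; last by rewrite posrE subr_gt0 invf_lt1// ltrDl.
  by congr (ln _)%:E; field.
- by move=> x x1; rewrite invr_ge0 mulr_ge0// ?addr_ge0// (le_trans _ x1).
- apply: continuous_in_subspaceT => x; rewrite inE/= in_itv/= andbT => x1.
  have x0 : 0 < x by rewrite (lt_le_trans _ x1).
  apply: cvgV; first by rewrite gt_eqF// mulr_gt0// addr_gt0.
  by apply: cvgM; [exact: cvg_id|apply: cvgD; [exact: cvg_cst|exact: cvg_id]].
- rewrite -(@ln1 R); apply: continuous_cvg; first exact: continuous_ln.
  rewrite -[X in _ --> X](subr0 1); apply: cvgB; first exact: cvg_cst.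
  apply/gtr0_cvgV0; first by near=> x; rewrite addr_gt0//; near: x; exact: nbhs_pinfty_gt.
  apply/cvgryPge => M; near=> z; apply: (@le_trans _ _ z); last by rewrite lerDr.
  by near: z; apply: nbhs_pinfty_ge; exact: num_real.
- move=> x x1; have := dF x (lt_trans ltr01 x1) => d; exact: ex_derive.
- exact/cvg_at_right_filter/cF.
- move=> x; rewrite in_itv/= andbT => x1.
  by have := dF x (lt_trans ltr01 x1) => d; rewrite derive1E derive_val.
Unshelve. all: by end_near. Qed.

End power_integrals.

(** * Comparison of power integrals over [(0, 1]] and [(1, oo)] with [J] *)

Section power_integral_comparison.
Context {R : realType}.
Local Notation mu := (@lebesgue_measure R).
Variable s : R.
Hypothesis s01 : 0 < s < 1.
Let s0 : 0 < s. Proof. by case/andP: s01. Qed.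
Let s1 : s < 1. Proof. by case/andP: s01. Qed.

Let mpow (r : R) : measurable_fun setT (fun a : R => (a `^ r)%:E).
Proof. by apply/measurable_EFinP; exact: measurable_powR. Qed.

(** Integrability at 0, where [s > 0] enters; it serves the finiteness of the seminorm, not its
    constant. *)
Lemma integral_powR_01_le : (\int[mu]_(a in `]0%R, 1%R]) (a `^ (s - 1))%:E <= (s^-1)%:E)%E.
Proof.
(* The index [n.+2] keeps the left endpoint strictly below 1, as [integral_powR_itv] requires. *)
rewrite (_ : `]0%R, 1%R]%classic = \bigcup_n (`[(n.+2%:R^-1 : R), 1]%classic)); last first.
  apply/seteqP; split => [x|x [n _]]/=; rewrite !in_itv/= => /andP[x0 x1].
    exists (Num.truncn x^-1) => //=; rewrite in_itv/= x1 andbT invf_ple ?posrE//.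
    by rewrite (le_trans (ltW (truncnS_gt _)))// ler_nat.
  by rewrite x1 andbT (lt_le_trans _ x0)// invr_gt0.
apply: ge0_integral_bigcup_le.
- move=> m n mn; apply/subsetPset => x /=; rewrite !in_itv/= => /andP[xm ->].
  by rewrite andbT (le_trans _ xm)// lef_pV2 ?posrE// ler_nat.
- by move=> i; exact: measurable_itv.
- exact: mpow.
- by move=> x; rewrite lee_fin powR_ge0.
- move=> n; rewrite integral_powR_itv ?gt_eqF// ?invr_gt0//; last first.
    by rewrite invf_lt1// ltr1n.
  rewrite lee_fin powR1 -[leRHS]mul1r ler_wpM2r ?invr_ge0 ?(ltW s0)//.
Qed.

(** The counterpart at infinity, where [s < 1] enters. *)
Lemma integral_powR_1y_le :
  (\int[mu]_(a in `]1%R, +oo[) (a `^ (s - 2))%:E <= ((1 - s)^-1)%:E)%E.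
Proof.
rewrite integral_itv_obnd_cbnd; last by apply: measurable_funTS; exact: mpow.
rewrite (_ : `[1%R, +oo[%classic = \bigcup_n (`[1, (n.+2%:R : R)]%classic)); last first.
  apply/seteqP; split => [x|x [n _]]/=; rewrite !in_itv/= ?andbT.
    move=> x1; exists (Num.truncn x) => //=; rewrite in_itv/= x1/=.
    by rewrite (le_trans (ltW (truncnS_gt _)))// ler_nat.
  by move=> /andP[].
apply: ge0_integral_bigcup_le.
- move=> m n mn; apply/subsetPset => x /=; rewrite !in_itv/= => /andP[-> xm].
  by rewrite (le_trans xm)// ler_nat.
- by move=> i; exact: measurable_itv.
- exact: mpow.
- by move=> x; rewrite lee_fin powR_ge0.
- move=> n; rewrite (_ : s - 2 = (s - 1) - 1); last by ring.
  rewrite integral_powR_itv//; last 2 first.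
    by rewrite subr_eq0 lt_eqF.
    by rewrite ltr1n.
  rewrite lee_fin powR1 -[1 - s]opprB invrN mulrC.
  rewrite -[leLHS]opprK -mulNr -mulrN opprB ler_piMr ?oppr_ge0 ?invr_le0 ?subr_le0 ?ltW//.
Qed.

Let f (a : R) := a `^ (s - 1) / (1 + a).

Let f0 (a : R) : 0 < a -> 0 <= f a.
Proof. by move=> a0; rewrite divr_ge0 ?powR_ge0// addr_ge0// ltW. Qed.

Let minv : measurable_fun (`]0%R, +oo[ : set R) (fun a : R => (1 + a)^-1).
Proof.
apply: subspace_continuous_measurable_fun => //.
apply: continuous_in_subspaceT => x; rewrite inE/= in_itv/= andbT => x0.
apply: cvgV; first by rewrite gt_eqF// addr_gt0.
by apply: cvgD; [exact: cvg_cst|exact: cvg_id].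
Qed.

Lemma measurable_powR_div1D : measurable_fun (`]0%R, +oo[ : set R) f.
Proof.
by apply: measurable_funM => //; apply: measurable_funTS; exact: measurable_powR.
Qed.

Let mf := measurable_powR_div1D.

Let itvU : `]0%R, +oo[%classic = `]0%R, 1%R] `|` `]1%R, +oo[ :> set R.
Proof.
apply/seteqP; split => [x|x []]/=; rewrite !in_itv/= ?andbT.
- by move=> x0; have [x1|x1] := leP x 1; [left; rewrite x0|right].
- by move=> /andP[].
- exact: lt_trans.
Qed.

Lemma integral_0y_split (g : R -> \bar R) : measurable_fun (`]0%R, +oo[ : set R) g ->
  (forall a : R, (0 < a)%R -> 0 <= g a)%E ->
  (\int[mu]_(a in `]0%R, +oo[) g a =
   \int[mu]_(a in `]0%R, 1%R]) g a + \int[mu]_(a in `]1%R, +oo[) g a)%E.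
Proof.
move=> mg g0; rewrite itvU ge0_integral_setU//.
- by rewrite -itvU.
- by move=> x; rewrite -itvU /= in_itv/= andbT; exact: g0.
- apply/disj_setPS => x [] /=; rewrite !in_itv/= andbT => /andP[_ x1].
  by rewrite ltNge x1.
Qed.

Let sub01 : `]0%R, 1%R] `<=` (`]0%R, +oo[ : set R).
Proof. by rewrite itvU => x; left. Qed.

Let sub1y : `]1%R, +oo[ `<=` (`]0%R, +oo[ : set R).
Proof. by rewrite itvU => x; right. Qed.

(* [a^(s-1) = a^(s-1) / (1+a) + a^s / (1+a)], and
   [\int_0^1 a^s / (1+a) <= ln 2 <= \int_1^oo a^(s-1) / (1+a)]. *)
Lemma integral_powR_01_le0y : (\int[mu]_(a in `]0%R, 1%R]) (a `^ (s - 1))%:E <=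
  \int[mu]_(a in `]0%R, +oo[) (a `^ (s - 1) / (1 + a))%:E)%E.
Proof.
rewrite integral_0y_split; last 2 first.
- exact/measurable_EFinP.
- by move=> a a0; rewrite lee_fin f0.
have mf01 : measurable_fun (`]0%R, 1%R] : set R) f by exact: measurable_funS mf.
have mi01 : measurable_fun (`]0%R, 1%R] : set R) (fun a : R => (1 + a)^-1).
  exact: measurable_funS minv.
have mf1y : measurable_fun (`]1%R, +oo[ : set R) f by exact: measurable_funS mf.
have mi1y : measurable_fun (`]1%R, +oo[ : set R) (fun a : R => (a * (1 + a))^-1).
  apply: subspace_continuous_measurable_fun => //.
  apply: continuous_in_subspaceT => x; rewrite inE/= in_itv/= andbT => x1.
  have x0 : 0 < x by rewrite (lt_trans _ x1).
  apply: cvgV; first by rewrite gt_eqF// mulr_gt0// addr_gt0.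
  by apply: cvgM; [exact: cvg_id|apply: cvgD; [exact: cvg_cst|exact: cvg_id]].
apply: (@le_trans _ _ (\int[mu]_(a in `]0%R, 1%R]) ((f a)%:E + ((1 + a)^-1)%:E))%E).
  apply: ge0_le_integral => //=.
  - by move=> a _; rewrite lee_fin powR_ge0.
  - by apply: measurable_funTS; exact: mpow.
  - by apply: emeasurable_funD; exact/measurable_EFinP.
  move=> a; rewrite in_itv/= => /andP[a0 a1].
  have a10 : 0 < 1 + a by rewrite addr_gt0.
  have fE : f a + (1 + a)^-1 = (a `^ (s - 1) + 1) / (1 + a) by rewrite mulrDl mul1r.
  rewrite -EFinD lee_fin fE ler_pdivlMr// mulrDr mulr1 lerD2l mulrC.
  have e : 1 `^ s = 1 :> R by rewrite powR1.
  by rewrite mulr_powRB1 ?(ltW a0)// -[leRHS]e ge0_ler_powR ?nnegrE// ltW.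
rewrite ge0_integralD//=; last 4 first.
- by move=> a; rewrite in_itv/= => /andP[a0 _]; rewrite lee_fin f0.
- exact/measurable_EFinP.
- by move=> a; rewrite in_itv/= => /andP[a0 _]; rewrite lee_fin invr_ge0 addr_ge0// ltW.
- exact/measurable_EFinP.
apply: leeD => //.
rewrite integral_itv_obnd_cbnd; last exact/measurable_EFinP.
rewrite integral_inv1D_01 -integral_inv1D_1y -integral_itv_obnd_cbnd; last first.
  exact/measurable_EFinP.
apply: ge0_le_integral => //=.
- move=> a; rewrite in_itv/= andbT => a1; rewrite lee_fin invr_ge0.
  by rewrite mulr_ge0 ?addr_ge0// ltW// (lt_trans _ a1).
- exact/measurable_EFinP.
- exact/measurable_EFinP.
move=> a; rewrite in_itv/= andbT => a1; have a0 : 0 < a by exact: lt_trans a1.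
rewrite lee_fin invfM ler_wpM2r ?invr_ge0 ?addr_ge0 ?(ltW a0)//.
by rewrite -powR_inv1 ?(ltW a0)// ler_powR// ?(ltW a1)// lerBrDr addNr ltW.
Qed.

(* [a^(s-2) = a^(s-1) / (1+a) + a^(s-2) / (1+a)], and
   [\int_1^oo a^(s-2) / (1+a) <= ln 2 <= \int_0^1 a^(s-1) / (1+a)]. *)
Lemma integral_powR_1y_le0y : (\int[mu]_(a in `]1%R, +oo[) (a `^ (s - 2))%:E <=
  \int[mu]_(a in `]0%R, +oo[) (a `^ (s - 1) / (1 + a))%:E)%E.
Proof.
rewrite integral_0y_split; last 2 first.
- exact/measurable_EFinP.
- by move=> a a0; rewrite lee_fin f0.
have mf01 : measurable_fun (`]0%R, 1%R] : set R) f by exact: measurable_funS mf.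
have mi01 : measurable_fun (`]0%R, 1%R] : set R) (fun a : R => (1 + a)^-1).
  exact: measurable_funS minv.
have mf1y : measurable_fun (`]1%R, +oo[ : set R) f by exact: measurable_funS mf.
have mi1y : measurable_fun (`]1%R, +oo[ : set R) (fun a : R => (a * (1 + a))^-1).
  apply: subspace_continuous_measurable_fun => //.
  apply: continuous_in_subspaceT => x; rewrite inE/= in_itv/= andbT => x1.
  have x0 : 0 < x by rewrite (lt_trans _ x1).
  apply: cvgV; first by rewrite gt_eqF// mulr_gt0// addr_gt0.
  by apply: cvgM; [exact: cvg_id|apply: cvgD; [exact: cvg_cst|exact: cvg_id]].
apply: (@le_trans _ _ (\int[mu]_(a in `]1%R, +oo[) (((a * (1 + a))^-1)%:E + (f a)%:E))%E).
  apply: ge0_le_integral => //=.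
  - by move=> a _; rewrite lee_fin powR_ge0.
  - by apply: measurable_funTS; exact: mpow.
  - by apply: emeasurable_funD; exact/measurable_EFinP.
  move=> a; rewrite in_itv/= andbT => a1; have a0 : 0 < a by exact: lt_trans a1.
  have a10 : 0 < 1 + a by rewrite addr_gt0.
  rewrite -EFinD lee_fin /f invfM -mulrDl ler_pdivlMr// mulrDr mulr1 lerD//; last first.
    rewrite [leLHS]mulrC (_ : s - 2 = s - 1 - 1); last by ring.
    rewrite [in leLHS]powRB ?(gt_eqF a0)//= ?implybT// powRr1 ?(ltW a0)//.
    by rewrite mulrC divfK// gt_eqF.
  rewrite -powR_inv1 ?(ltW a0)// ler_powR// ?(ltW a1)//.
  by rewrite lerBlDr (le_trans (ltW s1)) //; lra.
rewrite ge0_integralD//=; last 4 first.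
- move=> a; rewrite in_itv/= andbT => a1; rewrite lee_fin invr_ge0.
  by rewrite mulr_ge0 ?addr_ge0// ltW// (lt_trans _ a1).
- exact/measurable_EFinP.
- by move=> a; rewrite in_itv/= andbT => a1; rewrite lee_fin f0// (lt_trans _ a1).
- exact/measurable_EFinP.
apply: leeD => //.
rewrite integral_itv_obnd_cbnd; last exact/measurable_EFinP.
rewrite integral_inv1D_1y -integral_inv1D_01 -integral_itv_obnd_cbnd; last first.
  exact/measurable_EFinP.
apply: ge0_le_integral => //=.
- by move=> a; rewrite in_itv/= => /andP[a0 _]; rewrite lee_fin invr_ge0 addr_ge0// ltW.
- exact/measurable_EFinP.
- exact/measurable_EFinP.
move=> a; rewrite in_itv/= => /andP[a0 a1].
rewrite lee_fin /f -[leLHS]mul1r ler_wpM2r ?invr_ge0 ?addr_ge0 ?(ltW a0)//.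
rewrite -[leLHS](@powRr0 _ a); apply: ger_powR; first by rewrite a0.
by rewrite subr_le0 ltW.
Qed.

End power_integral_comparison.

(** * Gaussian difference forms *)

(* The canonical [SigmaFiniteMeasure] structure of a product measure is only
   found for subprobabilities, hence these two lemmas. *)
Section tonelli_product.
Context d1 d2 d3 (T1 : measurableType d1) (T2 : measurableType d2)
  (T3 : measurableType d3) {R : realType}.
Variables (m1 : {sigma_finite_measure set T1 -> \bar R})
  (m2 : {sigma_finite_measure set T2 -> \bar R})
  (m3 : {sigma_finite_measure set T3 -> \bar R}).
Variable f : T1 * T2 * T3 -> \bar R.
Hypotheses (mf : measurable_fun setT f) (f0 : forall p, (0 <= f p)%E).

Let mfx x : measurable_fun setT (fun q : T2 * T3 => f (x, q.1, q.2)).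
Proof.
apply: (measurableT_comp mf); apply: measurable_fun_pair => //.
exact: measurable_fun_pair.
Qed.

Let mfw w : measurable_fun setT (fun q : T1 * T2 => f (q, w)).
Proof. exact: measurable_fun_pair1 mf. Qed.

Let mF : measurable_fun setT (fun q : T1 * T3 => \int[m2]_y f (q.1, y, q.2))%E.
Proof.
apply: (@measurable_fun_fubini_tonelli_F _ _ _ _ _ m2
  (fun q : T1 * T3 * T2 => f (q.1.1, q.2, q.1.2))) => //.
apply: (measurableT_comp mf); apply: measurable_fun_pair.
  apply: measurable_fun_pair => //.
  exact: measurableT_comp measurable_fst measurable_fst.
exact: measurableT_comp measurable_snd measurable_fst.
Qed.

Lemma measurable_integral_product :
  measurable_fun setT (fun w => \int[m1 \x m2]_z f (z, w))%E.
Proof.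
rewrite [X in measurable_fun _ X](_ : _ = (fun w => \int[m1]_x \int[m2]_y f (x, y, w))%E).
  apply: (@measurable_fun_fubini_tonelli_G _ _ _ _ _ m1 _ mF) => p.
  exact: integral_ge0.
by apply/funext => w; rewrite fubini_tonelli1.
Qed.

Lemma tonelli_product : (\int[m1 \x m2]_z \int[m3]_w f (z, w) =
  \int[m3]_w \int[m1 \x m2]_z f (z, w))%E.
Proof.
rewrite fubini_tonelli1/=; last 2 first.
- exact: (@measurable_fun_fubini_tonelli_F _ _ _ _ _ m3 f).
- by move=> z; exact: integral_ge0.
transitivity (\int[m1]_x \int[m3]_w \int[m2]_y f (x, y, w))%E.
  apply: eq_integral => x _.
  exact: (@fubini_tonelli _ _ _ _ _ m2 m3 (fun q : T2 * T3 => f (x, q.1, q.2))).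
rewrite (@fubini_tonelli _ _ _ _ _ m1 m3 _ mF)/=; last first.
  by move=> p; exact: integral_ge0.
by apply: eq_integral => w _; rewrite fubini_tonelli1.
Qed.

End tonelli_product.

Section variance.
Context d (T : measurableType d) {R : realType}.
Variable nu : {sigma_finite_measure set T -> \bar R}.

(* For the finite measure [g nu], of mass [m], this is
   [2 m \int u^2 - 2 (\int u)^2 <= 2 m \int u^2]. *)
Lemma ge0_integral_sqrB_le (u g : T -> R) (m : R) :
  measurable_fun setT u -> measurable_fun setT g -> (forall x, 0 <= g x) ->
  (\int[nu]_x (g x)%:E = m%:E)%E ->
  (\int[nu]_x (u x ^+ 2 * g x)%:E < +oo)%E ->
  (\int[nu]_x \int[nu]_y ((u x - u y) ^+ 2 * (g x * g y))%:E <=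
   (2 * m)%:E * \int[nu]_x (u x ^+ 2 * g x)%:E)%E.
Proof.
move=> mu mg g0 gm uoo.
have ig : nu.-integrable setT (EFin \o g).
  apply/integrableP; split; first exact/measurable_EFinP.
  by under eq_integral do rewrite /= ger0_norm//; rewrite gm ltry.
have iq : nu.-integrable setT (fun x => (u x ^+ 2 * g x)%:E).
  apply/integrableP; split.
    by apply/measurable_EFinP; apply: measurable_funM => //; exact: measurable_funX.
  apply: le_lt_trans uoo; rewrite le_eqVlt; apply/orP; left; apply/eqP.
  by apply: eq_integral => x _; rewrite gee0_abs// lee_fin mulr_ge0 ?sqr_ge0.
(* By [|u| <= u^2 + 1]; the linear expansions below need a finite first moment. *)
have ib : nu.-integrable setT (fun x => (u x * g x)%:E).
  apply: (@le_integrable _ _ _ nu setT measurableT _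
      (fun x => (u x ^+ 2 * g x)%:E + (g x)%:E)%E).
  - by apply/measurable_EFinP; exact: measurable_funM.
  - move=> x _; rewrite -EFinD lee_fin [leRHS]ger0_norm; last first.
      by rewrite addr_ge0// mulr_ge0 ?sqr_ge0.
    rewrite normrM (ger0_norm (g0 x)) -[X in _ + X]mul1r -mulrDl ler_wpM2r//.
    have := sqr_ge0 (`|u x| - 1); rewrite -(real_normK (num_real (u x))).
    by have := normr_ge0 (u x); nra.
  - exact: integrableD.
pose q := fine (\int[nu]_x (u x ^+ 2 * g x)%:E)%E.
pose b := fine (\int[nu]_x (u x * g x)%:E)%E.
have qE : (\int[nu]_x (u x ^+ 2 * g x)%:E = q%:E)%E by rewrite fineK// integrable_fin_num.
have bE : (\int[nu]_x (u x * g x)%:E = b%:E)%E by rewrite fineK// integrable_fin_num.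
have lin (al be ga : R) : (\int[nu]_x ((al * (u x ^+ 2 * g x) + (be * (u x * g x) + ga * g x))%:E) =
    (al * q + (be * b + ga * m))%:E)%E.
  transitivity (\int[nu]_x (al%:E * (u x ^+ 2 * g x)%:E + (be%:E * (u x * g x)%:E +
      ga%:E * (g x)%:E)))%E.
    by apply: eq_integral => x _; rewrite !EFinD !EFinM.
  rewrite integralD//; [|exact: integrableZl|by apply: integrableD => //; exact: integrableZl].
  rewrite integralD//; [|exact: integrableZl|exact: integrableZl].
  by rewrite !integralZl// qE bE gm.
rewrite qE -EFinM.
apply: (@le_trans _ _ (\int[nu]_x (m * (u x ^+ 2 * g x) +
    (- (2 * b) * (u x * g x) + q * g x))%:E)%E); last first.
  by rewrite lin lee_fin; have := sqr_ge0 b; nra.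
rewrite le_eqVlt; apply/orP; left; apply/eqP; apply: eq_integral => x _.
transitivity (\int[nu]_y (g x * (u y ^+ 2 * g y) +
    (- (2 * (u x * g x)) * (u y * g y) + u x ^+ 2 * g x * g y))%:E)%E.
  by apply: eq_integral => y _; congr EFin; ring.
by rewrite lin; congr EFin; ring.
Qed.

End variance.

(** * The [L^2] bound for the Gaussian form, and its stability under approximation *)

Section gaussian_form.
Context {R : realType}.
Variable d : nat.
Local Notation leb := (lebesgue_rV R d).
Local Notation leb2 := (lebesgue_rV R d \x lebesgue_rV R d)%E.
Implicit Types u v : 'rV[R]_d -> R.

Definition gauss_form (c : R) u : \bar R :=
  (\int[leb2]_z ((u z.1 - u z.2) ^+ 2 * gauss_rV c (z.1 - z.2))%:E)%E.

Lemma measurable_gauss_rVB d' (T : measurableType d') c (f g : T -> 'rV[R]_d) :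
  measurable_fun setT f -> measurable_fun setT g ->
  measurable_fun setT (fun x => gauss_rV c (f x - g x)).
Proof.
move=> mf mg; apply: (measurableT_comp (@measurable_gauss_rV R d c)).
exact: measurable_rVB.
Qed.

Lemma measurable_sqrB u : measurable_fun setT u ->
  measurable_fun setT (fun z : 'rV[R]_d * 'rV[R]_d => (u z.1 - u z.2) ^+ 2).
Proof.
move=> mu; apply: measurable_funX; apply: measurable_funB.
  exact: measurableT_comp mu measurable_fst.
exact: measurableT_comp mu measurable_snd.
Qed.

(** The parallelogram identity [2|x-w|^2 + 2|y-w|^2 = |x-y|^2 + 4|w-(x+y)/2|^2]. Integrated in [w],
    it writes the kernel in [x - y] as a superposition of products of a function of [x] and one of
    [y]. *)
Lemma gauss_rV_convolution c (x y w : 'rV[R]_d) :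
  gauss_rV (2 * c) (x - w) * gauss_rV (2 * c) (y - w) =
  gauss_rV c (x - y) * gauss_rV (4 * c) (w - 2^-1 *: (x + y)).
Proof.
rewrite /gauss_rV -!expRD; congr expR; rewrite !sqr_enorm !mulr_sumr -!sumrN -!big_split/=.
by apply: eq_bigr => i _; rewrite !mxE; field.
Qed.

(** Because [(2c)(2c) = c (4c)]; this removes the auxiliary widths from the constant of
    [gauss_form_le]. *)
Lemma gauss_mass_mul c : 0 < c ->
  gauss_mass (2 * c) * gauss_mass (2 * c) = gauss_mass c * gauss_mass (4 * c) :> R.
Proof.
move=> c0; rewrite /gauss_mass -!sqrtrM ?divr_ge0 ?pi_ge0 ?mulr_ge0 ?(ltW c0)//.
by congr Num.sqrt; field; rewrite gt_eqF.
Qed.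

(** For each centre [w] the variance bound is applied to the density [g w], of mass [m]. Integrating
    over [w] produces [m] once more, so [m4 * Q_c(u) <= 2 m^2 |u|^2], where [m^2 = K_c * m4]. *)
Lemma gauss_form_le c u : 0 < c -> measurable_fun setT u ->
  (\int[leb]_x (u x ^+ 2)%:E < +oo)%E ->
  (gauss_form c u <= (2 * gauss_mass c ^+ d)%:E * \int[leb]_x (u x ^+ 2)%:E)%E.
Proof.
move=> c0 mu uoo.
have c2 : 0 < 2 * c by rewrite mulr_gt0.
have c4 : 0 < 4 * c by rewrite mulr_gt0.
pose m := gauss_mass (2 * c) ^+ d : R; pose m4 := gauss_mass (4 * c) ^+ d : R.
have m0 : 0 < m by rewrite exprn_gt0// gauss_mass_gt0.
have m40 : 0 < m4 by rewrite exprn_gt0// gauss_mass_gt0.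
pose g w (x : 'rV[R]_d) := gauss_rV (2 * c) (x - w).
have g0 w x : 0 <= g w x by exact: gauss_rV_ge0.
have mg w : measurable_fun setT (g w) by exact: measurable_gauss_rVB.
have mg2 : measurable_fun setT (fun p : 'rV[R]_d * 'rV[R]_d => g p.1 p.2).
  exact: measurable_gauss_rVB.
have mquw : measurable_fun setT (fun p : 'rV[R]_d * 'rV[R]_d * 'rV[R]_d =>
    ((u p.1.1 - u p.1.2) ^+ 2 * (g p.2 p.1.1 * g p.2 p.1.2))%:E).
  apply/measurable_EFinP; apply: measurable_funM.
    exact: (measurableT_comp (measurable_sqrB mu) measurable_fst).
  apply: measurable_funM; apply: measurable_gauss_rVB => //.
    exact: measurableT_comp measurable_fst measurable_fst.
  exact: measurableT_comp measurable_snd measurable_fst.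
have quw0 (p : 'rV[R]_d * 'rV[R]_d * 'rV[R]_d) :
    (0 <= ((u p.1.1 - u p.1.2) ^+ 2 * (g p.2 p.1.1 * g p.2 p.1.2))%:E)%E.
  by rewrite lee_fin; apply: mulr_ge0; [exact: sqr_ge0|exact: mulr_ge0].
(* By the convolution identity, the integral over [w] of [g w x * g w y] is [m4] times the kernel at
   [x - y]. *)
have m4E : (m4%:E * gauss_form c u =
    \int[leb]_w \int[leb2]_z ((u z.1 - u z.2) ^+ 2 * (g w z.1 * g w z.2))%:E)%E.
  rewrite -(@tonelli_product _ _ _ _ _ _ _ leb leb leb (fun p => ((u p.1.1 - u p.1.2) ^+ 2 *
    (g p.2 p.1.1 * g p.2 p.1.2))%:E))/=; last 2 first.
  - exact: mquw.
  - exact: quw0.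
  rewrite /gauss_form -ge0_integralZl//; last 3 first.
  - apply/measurable_EFinP; apply: measurable_funM; first exact: measurable_sqrB.
    by apply: measurable_gauss_rVB.
  - by move=> z _; rewrite lee_fin mulr_ge0 ?sqr_ge0 ?gauss_rV_ge0.
  - by rewrite lee_fin ltW.
  apply: eq_integral => -[x y] _ /=.
  under eq_integral do rewrite /g gauss_rV_convolution mulrA EFinM.
  rewrite ge0_integralZl//; last 3 first.
  - by apply/measurable_EFinP; exact: measurable_gauss_rVB.
  - by move=> z _; rewrite lee_fin gauss_rV_ge0.
  - by rewrite lee_fin mulr_ge0 ?sqr_ge0 ?gauss_rV_ge0.
  by rewrite integral_gauss_rV_shift// muleC.
have mq w : measurable_fun setT (fun x => (u x ^+ 2 * g w x)%:E).
  by apply/measurable_EFinP; apply: measurable_funM => //; exact: measurable_funX.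
have g1 w x : g w x <= 1.
  rewrite /g /gauss_rV -[leRHS]expR0 ler_expR oppr_le0.
  by apply: mulr_ge0; [exact: ltW|exact: sqr_ge0].
have qoo w : (\int[leb]_x (u x ^+ 2 * g w x)%:E < +oo)%E.
  apply: le_lt_trans uoo; apply: ge0_le_integral => //.
  - by move=> x _; rewrite lee_fin mulr_ge0 ?sqr_ge0.
  - by apply/measurable_EFinP; exact: measurable_funX.
  - by move=> x _; rewrite lee_fin -[leRHS]mulr1 ler_wpM2l ?sqr_ge0.
have : (m4%:E * gauss_form c u <= (2 * m * m)%:E * \int[leb]_x (u x ^+ 2)%:E)%E.
  rewrite m4E.
  have mqw : measurable_fun setT (fun p : 'rV[R]_d * 'rV[R]_d => (u p.2 ^+ 2 * g p.1 p.2)%:E).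
    apply/measurable_EFinP; apply: measurable_funM => //; apply: measurable_funX.
    exact: measurableT_comp mu measurable_snd.
  apply: (@le_trans _ _ (\int[leb]_w ((2 * m)%:E * \int[leb]_x (u x ^+ 2 * g w x)%:E))%E).
    apply: ge0_le_integral => //.
    - by move=> w _; apply: integral_ge0 => z _; exact: (quw0 (z, w)).
    - by apply: (measurable_integral_product leb leb mquw) => p; exact: quw0.
    - apply: emeasurable_funM => //.
      apply: (@measurable_fun_fubini_tonelli_F _ _ _ _ _ leb _ mqw) => p.
      by rewrite lee_fin mulr_ge0 ?sqr_ge0.
    move=> w _; rewrite fubini_tonelli1/=; last 2 first.
    - exact: (measurable_fun_pair1 w mquw).
    - by move=> z; exact: (quw0 (z, w)).
    apply: (@ge0_integral_sqrB_le _ _ _ leb u (g w) m mu (mg w) (g0 w) _ (qoo w)).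
    exact: (integral_gauss_rV_shift w c2).
  rewrite ge0_integralZl//; last 3 first.
  - apply: (@measurable_fun_fubini_tonelli_F _ _ _ _ _ leb _ mqw) => p.
    by rewrite lee_fin mulr_ge0 ?sqr_ge0.
  - by move=> w _; apply: integral_ge0 => x _; rewrite lee_fin mulr_ge0 ?sqr_ge0.
  - by rewrite lee_fin mulr_ge0// ltW.
  rewrite [in leRHS]EFinM -muleA lee_pmul2l//; last by rewrite lte_fin mulr_gt0.
  rewrite (fubini_tonelli (m1 := leb) (m2 := leb) _ mqw)/=; last first.
    by move=> p; rewrite lee_fin mulr_ge0 ?sqr_ge0.
  rewrite -ge0_integralZl//; last 3 first.
  - by apply/measurable_EFinP; exact: measurable_funX.
  - by move=> x _; rewrite lee_fin sqr_ge0.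
  - by rewrite lee_fin ltW.
  rewrite le_eqVlt; apply/orP; left; apply/eqP; apply: eq_integral => x _.
  under eq_integral do rewrite EFinM.
  rewrite ge0_integralZl//; last 3 first.
  - by apply/measurable_EFinP; exact: measurable_gauss_rVB.
  - by move=> w _; rewrite lee_fin g0.
  - by rewrite lee_fin sqr_ge0.
  rewrite muleC; congr (_ * _)%E.
  rewrite -(integral_gauss_rV_shift x c2); apply: eq_integral => w _.
  by rewrite /g -gauss_rVN opprB.
have -> : 2 * m * m = m4 * (2 * gauss_mass c ^+ d).
  by rewrite -mulrA -exprMn gauss_mass_mul// exprMn -/m4 mulrC -mulrA mulrCA; ring.
by rewrite EFinM -muleA lee_pmul2l.
Qed.

(** Young's inequality. The weight keeps the factor of the main term as close to 1 as desired, at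
    the expense of the error term. *)
Lemma sqrD_le_weighted (e a b : R) : 0 < e ->
  (a + b) ^+ 2 <= (1 + e) * a ^+ 2 + (1 + e^-1) * b ^+ 2.
Proof.
move=> e0; rewrite -subr_ge0.
have -> : (1 + e) * a ^+ 2 + (1 + e^-1) * b ^+ 2 - (a + b) ^+ 2 = e^-1 * (e * a - b) ^+ 2.
  by field; rewrite gt_eqF.
by rewrite mulr_ge0 ?sqr_ge0// invr_ge0 ltW.
Qed.

(** The weighted inequality integrated against the positive kernel. It transfers a bound from an
    approximation [v] to [u] without loss in the constant, since the form of [u - v] is small by the
    [L^2] bound. *)
Lemma gauss_form_approx c (e : R) u v : 0 < e ->
  measurable_fun setT u -> measurable_fun setT v ->
  (gauss_form c u <= (1 + e)%:E * gauss_form c v +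
     (1 + e^-1)%:E * gauss_form c (fun x => u x - v x)%R)%E.
Proof.
move=> e0 mu mv; rewrite /gauss_form.
have mK : measurable_fun setT (fun z : 'rV[R]_d * 'rV[R]_d => gauss_rV c (z.1 - z.2)).
  exact: measurable_gauss_rVB.
have mf (w : 'rV[R]_d -> R) : measurable_fun setT w -> measurable_fun setT
    (fun z : 'rV[R]_d * 'rV[R]_d => ((w z.1 - w z.2) ^+ 2 * gauss_rV c (z.1 - z.2))%:E).
  by move=> mw; apply/measurable_EFinP; apply: measurable_funM => //; exact: measurable_sqrB.
have f0 (w : 'rV[R]_d -> R) (z : 'rV[R]_d * 'rV[R]_d) :
    (0 <= ((w z.1 - w z.2) ^+ 2 * gauss_rV c (z.1 - z.2))%:E)%E.
  by rewrite lee_fin mulr_ge0 ?sqr_ge0 ?gauss_rV_ge0.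
have e1 : 0 <= 1 + e by rewrite addr_ge0// ltW.
have e2 : 0 <= 1 + e^-1 by rewrite addr_ge0// invr_ge0 ltW.
have muv : measurable_fun setT (fun x => u x - v x) by exact: measurable_funB.
rewrite -!ge0_integralZl ?lee_fin//; try exact: mf; try exact: (mf _ muv);
  try by move=> ? _; exact: (f0 (fun x => u x - v x)).
rewrite -ge0_integralD//; last 4 first.
- by move=> z _; apply: mule_ge0; [rewrite lee_fin|exact: f0].
- by apply: emeasurable_funM => //; exact: mf.
- by move=> z _; apply: mule_ge0; [rewrite lee_fin|exact: (f0 (fun x => u x - v x))].
- by apply: emeasurable_funM => //; exact: (mf _ muv).
apply: ge0_le_integral => //.
- exact: mf.
- apply: emeasurable_funD; apply: emeasurable_funM => //; first exact: mf.
  exact: (mf _ muv).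
move=> z _; rewrite -!EFinM -EFinD lee_fin.
have K0 := gauss_rV_ge0 c (z.1 - z.2).
have := ler_wpM2r K0 (sqrD_le_weighted (v z.1 - v z.2) (u z.1 - v z.1 - (u z.2 - v z.2)) e0).
rewrite mulrDl !mulrA; apply: le_trans.
by rewrite le_eqVlt; apply/orP; left; apply/eqP; congr (_ ^+ 2 * _); ring.
Qed.

End gaussian_form.

(** * Test functions *)

Section partial_derivatives.
Context {R : realType}.
Variable d : nat.
Implicit Types (f : 'rV[R]_d -> R) (x y v z : 'rV[R]_d).

Lemma normr_coord_le x i : `|x ord0 i| <= `|x|.
Proof.
rewrite /Num.norm/= mx_normrE.
exact: (le_bigmax _ (fun ij : 'I_1 * 'I_d => `|x ij.1 ij.2|) (ord0, i)).
Qed.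

Lemma normr_rV_le x (M : R) : 0 <= M -> (forall i, `|x ord0 i| <= M) -> `|x| <= M.
Proof.
move=> M0 xM; rewrite /Num.norm/= mx_normrE; apply: bigmax_le => // -[i j] _ /=.
by rewrite (ord1 i).
Qed.

Lemma is_derive_line f x v (t : R) : derivable f (x + t *: v) v ->
  is_derive t (1 : R) (fun t => f (x + t *: v)) ('D_v f (x + t *: v)).
Proof.
move=> df; set g := (fun t => f (x + t *: v)).
have E : (fun h : R => h^-1 *: ((g \o shift t) (h *: (1 : R)) - g t)) =
    (fun h : R => h^-1 *: ((f \o shift (x + t *: v)) (h *: v) - f (x + t *: v))).
  apply/funext => h; rewrite /= /g; congr (_ *: (f _ - _)).
  by rewrite [h *: 1]mulr1 scalerDl addrCA.
by apply: DeriveDef; rewrite /derivable /derive E.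
Qed.

Lemma mean_value_line f v : (forall x, derivable f x v) -> forall x (t : R),
  exists2 c : R, `|c| <= `|t| & f (x + t *: v) - f x = t * 'D_v f (x + c *: v).
Proof.
move=> df x t; set g := (fun t : R => f (x + t *: v)).
have dg (c : R) : is_derive c (1 : R) g ('D_v f (x + c *: v)) by exact: is_derive_line.
have cg : continuous g.
  by move=> c; apply/differentiable_continuous/derivable1_diffP; exact: ex_derive.
have -> : f x = g 0 by rewrite /g scale0r addr0.
have [t0|/ltW t0] := leP 0 t.
  have [c] := MVT_segment t0 (fun c _ => dg c) (continuous_subspaceT cg).
  rewrite in_itv/= => /andP[c0 ct] E; exists c; first by rewrite !ger0_norm.
  by rewrite E subr0 mulrC.
have [c] := MVT_segment t0 (fun c _ => dg c) (continuous_subspaceT cg).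
rewrite in_itv/= => /andP[tc c0] E; exists c; first by rewrite !ler0_norm// lerN2.
by rewrite -[LHS]opprB E sub0r mulrN opprK mulrC.
Qed.

(* The increment is telescoped along the coordinates, with the mean value
   theorem applied to each of them. *)
Lemma mean_value_partial f :
  (forall i x, derivable f x (delta_mx ord0 i)) -> forall x v,
  exists2 xi : 'I_d -> 'rV[R]_d, (forall i, `|xi i - x| <= `|v|) &
    f (x + v) - f x = \sum_i v ord0 i * partial i f (xi i).
Proof.
move=> df x v; pose tr k : 'rV[R]_d := \row_i (if (i < k)%N then v ord0 i else 0).
have trS (i : 'I_d) : tr i.+1 = tr i + v ord0 i *: delta_mx ord0 i.
  apply/rowP => j; rewrite !mxE eqxx/= ltnS leq_eqVlt -val_eqE/=.
  case: eqVneq => [/val_inj ->|ji]; first by rewrite ltnn mulr1 add0r.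
  by rewrite mulr0 addr0.
have ex (i : 'I_d) : exists xi : 'rV[R]_d, `|xi - x| <= `|v| /\
    f (x + tr i.+1) - f (x + tr i) = v ord0 i * partial i f xi.
  have [c cv E] := mean_value_line (df i) (x + tr i) (v ord0 i).
  exists (x + tr i + c *: delta_mx ord0 i); split; last by rewrite trS addrA E.
  (* The displacement from [x] has coordinates [v_j] for [j < i], [c] at [i] and 0 beyond; since
     [|c| <= |v_i|], its sup norm is at most that of [v]. *)
  rewrite addrAC [x + tr i]addrC addrK; apply: normr_rV_le => // j.
  rewrite !mxE eqxx/= -val_eqE/=; case: ltngtP => [ji|ji|ji].
  - by rewrite mulr0 addr0 normr_coord_le.
  - by rewrite mulr0 addr0 normr0.
  - by rewrite mulr1 add0r (le_trans cv)// normr_coord_le.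
have [xi xiP] := choice ex.
exists xi => [i|]; first by have [] := xiP i.
rewrite (eq_bigr (fun i : 'I_d => f (x + tr i.+1) - f (x + tr i))); last first.
  by move=> i _; have [_ ->] := xiP i.
rewrite -(big_mkord xpredT (fun k => f (x + tr k.+1) - f (x + tr k))) telescope_sumr//.
by congr (f (x + _) - f _); apply/rowP => i; rewrite !mxE ?ltn_ord//= addr0.
Qed.

Lemma cvg_bigsum (I : finType) (a : I -> nat -> R) (l : I -> R) :
  (forall i, a i k @[k --> \oo] --> l i) ->
  \sum_i a i k @[k --> \oo] --> \sum_i l i.
Proof.
move=> al; elim: (index_enum I) => [|i s IH].
  by under eq_fun do rewrite big_nil; rewrite big_nil; exact: cvg_cst.
by under eq_fun do rewrite big_cons; rewrite big_cons; apply: cvgD.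
Qed.

(** [Ck] only provides derivatives along the coordinates. The derivative in a general direction
    follows from their continuity, as the intermediate points of the telescoped mean value formula
    tend to [x]. *)
Lemma cvg_difference_quotient f x v (h : nat -> R) : Ck 1 f ->
  (forall k, h k != 0) -> h k @[k --> \oo] --> (0 : R) ->
  (h k)^-1 * (f (x + h k *: v) - f x) @[k --> \oo] --> \sum_i v ord0 i * partial i f x.
Proof.
move=> [_ df] h0 hcvg.
have df' i y : derivable f y (delta_mx ord0 i) by have [] := df i.
have cf i : continuous (partial i f) by have [] := df i.
have /choice[xi xiP] k : exists xi : 'I_d -> 'rV[R]_d,
    (forall i, `|xi i - x| <= `|h k *: v|) /\
    f (x + h k *: v) - f x = \sum_i (h k *: v) ord0 i * partial i f (xi i).
  by have [xi ? ?] := mean_value_partial df' x (h k *: v); exists xi.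
have -> : (fun k => (h k)^-1 * (f (x + h k *: v) - f x)) =
    (fun k => \sum_i v ord0 i * partial i f (xi k i)).
  apply/funext => k; have [_ ->] := xiP k; rewrite mulr_sumr.
  by apply: eq_bigr => i _; rewrite mxE mulrA mulKf.
apply: cvg_bigsum => i; apply: cvgM; first exact: cvg_cst.
apply: (@continuous_cvg _ _ _ _ _ (fun k => xi k i) (partial i f)); first exact: cf.
apply/cvgrPdist_le => e e0.
have hv : `|h k| * `|v| @[k --> \oo] --> (0 : R).
  rewrite -(mul0r `|v|); apply: cvgM; last exact: cvg_cst.
  have h1 := cvg_norm hcvg; rewrite normr0 in h1; exact: h1.
have /cvgrPdist_le/(_ e e0) := hv; apply: filterS => k.
rewrite sub0r normrN -normrZ normr_id; apply: le_trans.
by rewrite distrC; have [] := xiP k.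
Qed.

(** A crude bound with a dimensional factor, meant only as a dominating constant for the difference
    quotients. *)
Lemma increment_le f (L : R) : (forall i x, derivable f x (delta_mx ord0 i)) ->
  (forall i x, `|partial i f x| <= L) -> forall x v,
  `|f (x + v) - f x| <= d%:R * (`|v| * L).
Proof.
move=> df fL x v; have [xi _ ->] := mean_value_partial df x v.
rewrite (le_trans (ler_norm_sum _ _ _))//.
rewrite (le_trans (ler_sum _ (fun i _ => _ : _ <= `|v| * L)))//.
  move=> i _; rewrite normrM ler_pM//; exact: normr_coord_le.
by rewrite sumr_const card_ord mulr_natl.
Qed.

End partial_derivatives.

(** * Bounds and supports of test functions *)

Section compact_support.
Context {R : realType}.
Variable d : nat.
Local Notation leb := (lebesgue_rV R d).
Implicit Types (f phi : 'rV[R]_d -> R).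

Definition cube (r : R) : set 'rV[R]_d := [set x | `|x| <= r].

Lemma cubeE (r : R) : 0 <= r ->
  cube r = [set x | forall i, (`[- r, r]%classic : set R) (x ord0 i)].
Proof.
move=> r0; apply/seteqP; split=> x /=.
  by move=> xr i; rewrite in_itv/= -ler_norml (le_trans (normr_coord_le _ _)).
by move=> xr; apply: normr_rV_le => // i; have := xr i; rewrite in_itv/= -ler_norml.
Qed.

Lemma measurable_cube (r : R) : 0 <= r -> measurable (cube r).
Proof.
move=> r0; rewrite cubeE// [X in measurable X](_ : _ = \bigcap_(i in [set: 'I_d])
   (fun y : 'rV[R]_d => y ord0 i : measurableTypeR R) @^-1` `[- r, r]).
  apply: fin_bigcap_measurable => // i _; rewrite -[X in measurable X]setTI.
  by apply: measurable_coord => //; exact: measurable_itv.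
by apply/seteqP; split=> x /= xr i => [_|]; exact: xr.
Qed.

Lemma lebesgue_cube_lty (r : R) : 0 <= r -> (leb (cube r) < +oo)%E.
Proof.
move=> r0; rewrite cubeE// (@lebesgue_rV_box _ _ (fun=> `[- r, r]%classic)); last first.
  by move=> i; exact: measurable_itv.
suff /andP[] : (0 <= \prod_(i < d) @lebesgue_measure R `[(- r)%R, r] < +oo)%E by [].
elim/big_ind: _ => [|x y /andP[x0 xy] /andP[y0 yy]|i _]; first by rewrite lee_fin ler01 ltry.
  by rewrite mule_ge0//= lte_mul_pinfty// ge0_fin_numE.
by rewrite measure_ge0/= lebesgue_measure_itv/=; case: ifP => _; rewrite ?ltry// -EFinB ltry.
Qed.

Definition bounded_support f := exists L r : R,
  [/\ 0 <= L, 0 <= r, forall x, `|f x| <= L & forall x, ~ cube r x -> f x = 0].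

Lemma bounded_support_sqr_lty f : measurable_fun setT f -> bounded_support f ->
  (\int[leb]_x (f x ^+ 2)%:E < +oo)%E.
Proof.
move=> mf [L [r [L0 r0 fL fr]]].
apply: (@le_lt_trans _ _ (\int[leb]_(x in cube r) (L ^+ 2)%:E)%E); last first.
  rewrite integral_cst; last exact: measurable_cube.
  by rewrite lte_mul_pinfty ?lee_fin ?sqr_ge0//; exact: lebesgue_cube_lty.
rewrite [leRHS]integral_mkcond.
  apply: ge0_le_integral => //.
- by move=> x _; rewrite lee_fin sqr_ge0.
- by apply/measurable_EFinP; exact: measurable_funX.
- apply/(measurable_restrictT _ _).1; first exact: measurable_cube.
    exact: measurable_cst.
move=> x _; rewrite patchE; case: ifPn => [_|/negP xr].
  by rewrite lee_fin -(real_normK (num_real (f x))) ler_sqr ?nnegrE.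
by rewrite fr ?expr0n// => xr'; apply: xr; rewrite inE.
Qed.

Lemma test_function_bounded O phi : test_function O phi -> bounded_support phi.
Proof.
move=> [Cphi [cK _]]; set K := closure _ in cK.
have cphi : continuous phi by have := Cphi 0%N.
have phi0 x : ~ K x -> phi x = 0.
  move=> Kx; apply/eqP; apply: contrapT => /negP p0; apply: Kx.
  exact: subset_closure.
have [M [_ KM]] := compact_bounded cK.
have [L [_ fL]] := compact_bounded (continuous_compact (continuous_subspaceT cphi) cK).
(* [compact_bounded] gives bounds valid for every number strictly above [L] or [M], whence the
   [+ 1]; the maximum with 0 secures the sign. *)
exists (Num.max 0 (L + 1)), (Num.max 0 (M + 1)); split.
- by rewrite le_max lexx.
- by rewrite le_max lexx.
- move=> x; rewrite le_max; have [Kx|/phi0 ->] := pselect (K x); last by rewrite normr0 lexx.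
  by apply/orP; right; apply: (fL (L + 1)); [rewrite ltrDl|exists x].
- move=> x xr; apply: phi0 => Kx; apply: xr; rewrite /cube/= le_max.
  by apply/orP; right; apply: (KM (M + 1)); [rewrite ltrDl|].
Qed.

(** Off the closed support the function is locally zero, so its derivatives vanish there and their
    support is no larger. *)
Lemma test_function_partial O phi i : test_function O phi ->
  test_function O (partial i phi).
Proof.
move=> [Cphi [cK KO]]; set K := closure _ in cK KO.
have sub : closure [set x | partial i phi x != 0] `<=` K.
  have -> : K = closure K by apply/closure_id; exact: closed_closure.
  apply: closureS => x /=; apply: contra_neqP => Kx.
  have nKx : \near x, phi x = cst 0 x.
    have : nbhs x (~` K).
      by apply: open_nbhs_nbhs; split => //; apply: closed_openC; exact: closed_closure.
    apply: filterS => y Ky; apply/eqP; apply: contrapT => /negP p0; apply: Ky.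
    exact: subset_closure.
  by rewrite /partial (near_eq_derive _ nKx) derive_cst.
split=> [k|]; first by have [_ /(_ i)[]] := Cphi k.+1.
split; last exact: subset_trans sub KO.
by apply: subclosed_compact cK sub; exact: closed_closure.
Qed.

Lemma test_function_measurable O phi : test_function O phi -> measurable_fun setT phi.
Proof. by move=> [Cphi _]; apply: continuous_rV_measurable; have := Cphi 0%N. Qed.

End compact_support.

(** * [L^2] increments and the gradient bound for test functions *)

Section increments.
Context {R : realType}.
Variable d : nat.
Local Notation leb := (lebesgue_rV R d).
Implicit Types (f phi : 'rV[R]_d -> R) (x z : 'rV[R]_d).

Definition sqincr f z : \bar R := (\int[leb]_x ((f (x + z) - f x) ^+ 2)%:E)%E.

Lemma measurable_shift f z : measurable_fun setT f ->
  measurable_fun setT (fun x => f (x + z)).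
Proof. by move=> mf; apply: (measurableT_comp mf); exact: measurable_rVD. Qed.

(** The increment over [2 z] is a sum of two increments over [z], of equal [L^2] norm by translation
    invariance; squaring the factor 2 gives 4. *)
Lemma sqincrD f z : measurable_fun setT f -> (sqincr f (z + z) <= 4%:E * sqincr f z)%E.
Proof.
move=> mf; pose g x := (f (x + z) - f x) ^+ 2.
have mg : measurable_fun setT (fun x => (g x)%:E).
  apply/measurable_EFinP; apply: measurable_funX; apply: measurable_funB => //.
  exact: measurable_shift.
have g0 x : (0 <= (g x)%:E)%E by rewrite lee_fin sqr_ge0.
have mgz : measurable_fun setT (fun x => (g (x + z))%:E).
  by apply: (measurableT_comp mg); exact: measurable_rVD.
apply: (@le_trans _ _ (\int[leb]_x (2%:E * ((g (x + z)%R)%:E + (g x)%:E)))%E).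
  apply: ge0_le_integral => //.
  - by move=> x _; rewrite lee_fin sqr_ge0.
  - apply/measurable_EFinP; apply: measurable_funX; apply: measurable_funB => //.
    exact: measurable_shift.
  - by apply: emeasurable_funM => //; exact: emeasurable_funD.
  move=> x _; rewrite -EFinD -EFinM lee_fin /g addrA.
  set a := f (x + z + z); set b := f (x + z); set c := f x.
  by have := sqr_ge0 (a - b - (b - c)); nra.
rewrite ge0_integralZl ?lee_fin//; last 2 first.
- exact: emeasurable_funD.
- by move=> x _; exact: adde_ge0.
rewrite ge0_integralD// (ge0_integral_rV_shift z (f := fun x => (g x)%:E))//.
by rewrite -[X in (2%:E * X)%E]mule2n -mule_natl muleA -EFinM -natrM.
Qed.

(** The right-hand side is the squared [L^2] norm of the difference quotient of step [2^-k]. A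
    finite increment is thus bounded by arbitrarily fine quotients, with no integration along
    segments. *)
Lemma sqincr_dyadic f z k : measurable_fun setT f ->
  (sqincr f z <= (4 ^+ k)%:E * sqincr f ((2 ^- k) *: z))%E.
Proof.
move=> mf; elim: k => [|k IH]; first by rewrite expr0 mul1e invr1 scale1r.
apply: (le_trans IH).
have -> : 2 ^- k *: z = 2 ^- k.+1 *: z + 2 ^- k.+1 *: z.
  by rewrite -scalerDl; congr (_ *: _); rewrite exprS invfM; field; rewrite expf_neq0.
rewrite [4 ^+ k.+1]exprSr EFinM -muleA lee_wpmul2l ?lee_fin ?exprn_ge0//.
exact: sqincrD.
Qed.

(** The limit of the dyadic bound: the quotients converge pointwise to the directional derivative,
    and dominated convergence applies because they are bounded and live in a fixed cube. *)
Lemma sqincr_test O phi z : test_function O phi ->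
  (sqincr phi z <= \int[leb]_x ((\sum_i z ord0 i * partial i phi x) ^+ 2)%:E)%E.
Proof.
move=> tphi; have mphi := test_function_measurable tphi.
have C1 : Ck 1 phi by have [Cphi _] := tphi; exact: Cphi.
have dphi i x : derivable phi x (delta_mx ord0 i) by have [_ /(_ i)[]] := C1.
have mpart i : measurable_fun setT (partial i phi).
  exact: test_function_measurable (test_function_partial i tphi).
have [L L0 partL] : exists2 L : R, 0 <= L & forall i x, `|partial i phi x| <= L.
  have /choice[L LP] i : exists L : R, 0 <= L /\ forall x, `|partial i phi x| <= L.
    have [L [r [L0 _ LP _]]] := test_function_bounded (test_function_partial i tphi).
    by exists L.
  exists (\sum_i L i) => [|i x]; first by apply: sumr_ge0 => i _; have [] := LP i.
  have [_ /(_ x)/le_trans->//] := LP i.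
  rewrite (bigD1 i)//= lerDl sumr_ge0// => j _; by have [] := LP j.
have [_ [r [_ r0 _ phir]]] := test_function_bounded tphi.
pose M := d%:R * (`|z| * L); have M0 : 0 <= M by rewrite !mulr_ge0.
pose h (k : nat) : R := 2 ^- k.
have h0 k : 0 < h k by rewrite invr_gt0 exprn_gt0.
have h1 k : h k <= 1 by rewrite invf_le1 ?exprn_gt0// exprn_ege1// ler1n.
pose F (k : nat) x := ((h k)^-1 * (phi (x + h k *: z) - phi x)) ^+ 2.
have mF k : measurable_fun setT (fun x => (F k x)%:E).
  apply/measurable_EFinP; apply: measurable_funX; apply: measurable_funM => //.
  by apply: measurable_funB => //; exact: measurable_shift.
pose G x := (\sum_i z ord0 i * partial i phi x) ^+ 2.
have mG : measurable_fun setT (EFin \o G).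
  apply/measurable_EFinP; apply: measurable_funX; apply: measurable_sum => i.
  exact: measurable_funM.
have hcvg : h k @[k --> \oo] --> (0 : R).
  have := @cvg_geometric R 1 (2^-1) _.
  rewrite ger0_norm ?invr_ge0// invf_lt1// ltr1n => /(_ isT).
  by rewrite (_ : geometric 1 2^-1 = h)//; apply/funext => k; rewrite /= mul1r exprVn.
have FG x : F k x @[k --> \oo] --> G x.
  rewrite /F /G expr2; under eq_fun do rewrite expr2.
  by apply: cvgM; apply: cvg_difference_quotient => // k; rewrite gt_eqF.
have r'0 : 0 <= r + `|z| by rewrite addr_ge0.
(* As the steps [h k] are at most 1, both [phi x] and [phi (x + h k *: z)] vanish outside this
   enlarged cube. *)
pose B := @cube R d (r + `|z|).
have mB : measurable (B : set 'rV[R]_d) by exact: measurable_cube.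
have FB k x : ((F k x)%:E <= ((fun=> (M ^+ 2)%:E) \_ B) x)%E.
  rewrite patchE; case: ifPn => [_|/negP xB].
    rewrite lee_fin /F -(real_normK (num_real _)) ler_sqr ?nnegrE//.
    rewrite normrM normfV (gtr0_norm (h0 k)) ler_pdivrMl//.
    rewrite (le_trans (increment_le dphi partL x (h k *: z)))//.
    by rewrite normrZ (gtr0_norm (h0 k)) /M !mulrA [d%:R * h k]mulrC.
  rewrite /F !phir ?subrr ?mulr0 ?expr0n//.
    move=> xr; apply: xB; rewrite inE /B /cube/= (le_trans xr)// lerDl.
    exact: normr_ge0.
  move=> xr; apply: xB; rewrite inE /B /cube/=.
  rewrite -[x](addrK (h k *: z)) (le_trans (ler_normB _ _))// lerD//.
  by rewrite normrZ (gtr0_norm (h0 k)) ler_piMl.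
have iB : leb.-integrable setT ((fun=> (M ^+ 2)%:E) \_ B).
  apply/(integrable_mkcond _ mB).1/integrableP; split; first exact: measurable_cst.
  under eq_integral do rewrite /= ger0_norm ?sqr_ge0//.
  by rewrite integral_cst// lte_mul_pinfty ?lee_fin ?sqr_ge0//; exact: lebesgue_cube_lty.
have FGae : {ae leb, forall x, setT x -> (F k x)%:E @[k --> \oo] --> (EFin \o G) x}.
  by apply: nearW => x _; apply: cvg_EFin; [exact: nearW|exact: FG].
have FBae : {ae leb, forall x k, setT x -> (`|(F k x)%:E| <= ((fun=> (M ^+ 2)%:E) \_ B) x)%E}.
  by apply: nearW => x k _; rewrite gee0_abs ?lee_fin ?sqr_ge0.
have [_ _ intcvg] := @dominated_convergence _ _ _ leb setT measurableT
  (fun k x => (F k x)%:E) (EFin \o G) _ mF mG FGae iB FBae.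
rewrite -(cvg_lim _ intcvg)//; apply: lime_ge; first exact: cvgP intcvg.
apply: nearW => k; rewrite (le_trans (sqincr_dyadic z k mphi))// /sqincr.
rewrite -ge0_integralZl ?lee_fin ?exprn_ge0//; last 2 first.
- apply/measurable_EFinP; apply: measurable_funX; apply: measurable_funB => //.
  exact: measurable_shift.
- by move=> x _; rewrite lee_fin sqr_ge0.
rewrite le_eqVlt; apply/orP; left; apply/eqP; apply: eq_integral => x _.
have e4 : (2 ^+ k) ^+ 2 = 4 ^+ k :> R by rewrite -exprM mulnC exprM expr2 -natrM.
by rewrite /F exprMn /h invrK e4 EFinM.
Qed.

(** Substituting [y = x + z] makes the kernel depend on [z] alone, so the integral over [x] can be
    taken first. *)
Lemma gauss_form_shift c f : measurable_fun setT f ->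
  gauss_form c f = (\int[leb]_z ((gauss_rV c z)%:E * sqincr f z))%E.
Proof.
move=> mf.
have mfz : measurable_fun setT (fun p : 'rV[R]_d * 'rV[R]_d =>
    ((f (p.1 + p.2) - f p.1) ^+ 2 * gauss_rV c p.2)%:E).
  apply/measurable_EFinP; apply: measurable_funM.
    apply: measurable_funX; apply: measurable_funB.
      by apply: (measurableT_comp mf); exact: measurable_rVD.
    exact: measurableT_comp mf measurable_fst.
  exact: measurableT_comp (@measurable_gauss_rV R d c) measurable_snd.
have mK : measurable_fun setT (fun p : 'rV[R]_d * 'rV[R]_d =>
    ((f p.1 - f p.2) ^+ 2 * gauss_rV c (p.1 - p.2))%:E).
  apply/measurable_EFinP; apply: measurable_funM; first exact: measurable_sqrB.
  exact: measurable_gauss_rVB.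
rewrite /gauss_form fubini_tonelli1//=; last first.
  by move=> p; rewrite lee_fin mulr_ge0 ?sqr_ge0 ?gauss_rV_ge0.
transitivity (\int[leb]_x \int[leb]_z ((f (x + z)%R - f x) ^+ 2 * gauss_rV c z)%:E)%E.
  apply: eq_integral => x _; rewrite /fubini_F/=.
  rewrite -(ge0_integral_rV_shift x); last 2 first.
  - exact: (measurable_fun_pair2 x mK).
  - by move=> y; rewrite lee_fin mulr_ge0 ?sqr_ge0 ?gauss_rV_ge0.
  apply: eq_integral => z _; congr EFin.
  rewrite -gauss_rVN opprB addrK [z + x]addrC; congr (_ * _).
  by rewrite -sqrrN opprB.
rewrite (fubini_tonelli (m1 := leb) (m2 := leb) _ mfz)/=; last first.
  by move=> p; rewrite lee_fin mulr_ge0 ?sqr_ge0 ?gauss_rV_ge0.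
apply: eq_integral => z _; rewrite /sqincr -ge0_integralZl ?lee_fin ?gauss_rV_ge0//.
- by apply: eq_integral => x _; rewrite -EFinM mulrC.
- apply/measurable_EFinP; apply: measurable_funX; apply: measurable_funB => //.
  exact: measurable_shift.
- by move=> x _; rewrite lee_fin sqr_ge0.
Qed.

(** Once the increment is replaced by the directional derivative, the order is exchanged again and
    [z] is integrated first: the Gaussian moments remove the mixed products and leave [K_c / (2 c)]
    times the squared gradient at [x]. *)
Lemma gauss_form_test_le O c phi : 0 < c -> test_function O phi ->
  (gauss_form c phi <= (gauss_mass c ^+ d / (2 * c))%:E *
     \sum_i \int[leb]_x (partial i phi x ^+ 2)%:E)%E.
Proof.
move=> c0 tphi; have mphi := test_function_measurable tphi.
have mpart i : measurable_fun setT (partial i phi).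
  exact: test_function_measurable (test_function_partial i tphi).
have mS : measurable_fun setT (fun p : 'rV[R]_d * 'rV[R]_d =>
    ((\sum_i p.2 ord0 i * partial i phi p.1) ^+ 2 * gauss_rV c p.2)%:E).
  apply/measurable_EFinP; apply: measurable_funM.
    apply: measurable_funX; apply: measurable_sum => i; apply: measurable_funM.
      exact: measurableT_comp (measurable_coord i) measurable_snd.
    exact: measurableT_comp (mpart i) measurable_fst.
  exact: measurableT_comp (@measurable_gauss_rV R d c) measurable_snd.
have S0 (p : 'rV[R]_d * 'rV[R]_d) :
    (0 <= ((\sum_i p.2 ord0 i * partial i phi p.1) ^+ 2 * gauss_rV c p.2)%:E)%E.
  by rewrite lee_fin mulr_ge0 ?sqr_ge0 ?gauss_rV_ge0.
rewrite gauss_form_shift//.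
apply: (@le_trans _ _ (\int[leb]_z \int[leb]_x
    ((\sum_i z ord0 i * partial i phi x) ^+ 2 * gauss_rV c z)%:E)%E).
  apply: ge0_le_integral => //.
  - by move=> z _; rewrite mule_ge0 ?lee_fin ?gauss_rV_ge0// integral_ge0// => x _;
      rewrite lee_fin sqr_ge0.
  - apply: emeasurable_funM; first by apply/measurable_EFinP; exact: measurable_gauss_rV.
    apply: (@measurable_fun_fubini_tonelli_G _ _ _ _ _ leb
      (fun p => ((phi (p.1 + p.2) - phi p.1) ^+ 2)%:E)).
      apply/measurable_EFinP; apply: measurable_funX; apply: measurable_funB.
        by apply: (measurableT_comp mphi); exact: measurable_rVD.
      exact: measurableT_comp mphi measurable_fst.
    by move=> p; rewrite lee_fin sqr_ge0.
  - exact: (@measurable_fun_fubini_tonelli_G _ _ _ _ _ leb _ mS).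
  move=> z _.
  have mSz : measurable_fun setT
      (fun x => ((\sum_i z ord0 i * partial i phi x) ^+ 2)%:E).
    apply/measurable_EFinP; apply: measurable_funX; apply: measurable_sum => i.
    exact: measurable_funM.
  rewrite (le_trans (lee_wpmul2l _ (sqincr_test z tphi))) ?lee_fin ?gauss_rV_ge0//.
  rewrite -ge0_integralZl ?lee_fin ?gauss_rV_ge0//; last first.
    by move=> x _; rewrite lee_fin sqr_ge0.
  rewrite le_eqVlt; apply/orP; left; apply/eqP; apply: eq_integral => x _.
  by rewrite -EFinM mulrC.
rewrite -(fubini_tonelli (m1 := leb) (m2 := leb) _ mS)//=.
have p0 i x : (0 <= (partial i phi x ^+ 2)%:E)%E by rewrite lee_fin sqr_ge0.
have mp2 i : measurable_fun setT (fun x => (partial i phi x ^+ 2)%:E).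
  by apply/measurable_EFinP; exact: measurable_funX.
rewrite -ge0_integral_sum//.
rewrite -ge0_integralZl//; last 3 first.
- by apply: emeasurable_sum => i _; exact: mp2.
- by move=> x _; apply: sume_ge0 => i _; exact: p0.
- by rewrite lee_fin divr_ge0 ?exprn_ge0 ?mulr_ge0 ?(ltW c0)// ltW// gauss_mass_gt0.
rewrite le_eqVlt; apply/orP; left; apply/eqP; apply: eq_integral => x _.
transitivity (\int[leb]_z ((0 + \sum_i z ord0 i * partial i phi x) ^+ 2 * gauss_rV c z)%:E)%E.
  by apply: eq_integral => z _; rewrite add0r.
rewrite (@integral_affine_sqr_gauss_rV _ _ _ _ (fun i => partial i phi x))//.
by rewrite sumEFin -EFinM; congr EFin; rewrite expr0n add0r; ring.
Qed.

End increments.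

(** * Subordination of the fractional kernel *)

Section fractional_form.
Context {R : realType}.
Variables (n : nat) (s : R).
Local Notation d := n.+1.
Local Notation mu := (@lebesgue_measure R).
Local Notation leb := (lebesgue_rV R d).
Local Notation leb2 := (lebesgue_rV R d \x lebesgue_rV R d)%E.
Hypothesis s01 : 0 < s < 1.

Let p : R := d%:R / 2 + s.
Let Gam : \bar R := gamma_integral p 1.
(** The weight is extended by zero because the Tonelli lemmas integrate over [setT]. *)
Let wt (a : R) : R := \1_(`]0, +oo[%classic : set R) a * a `^ (p - 1).
(** The part of [gauss_mass (a / 4) ^+ d = (4 pi / a)^(d/2)] that does not depend on [a]. *)
Let K : R := Num.sqrt (4 * pi) ^+ d.

Let wt0 a : 0 <= wt a.
Proof. by rewrite mulr_ge0 ?powR_ge0. Qed.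

Let mwt : measurable_fun setT wt.
Proof.
by apply: measurable_funM; [exact: measurable_indic|exact: measurable_powR].
Qed.

Let K0 : 0 < K.
Proof. by rewrite exprn_gt0// sqrtr_gt0 mulr_gt0// pi_gt0. Qed.

Let wtE (h : R -> \bar R) :
  (\int[mu]_a ((wt a)%:E * h a) = \int[mu]_(a in `]0%R, +oo[) ((a `^ (p - 1))%:E * h a))%E.
Proof.
rewrite [RHS]integral_mkcond; apply: eq_integral => a _.
by rewrite patchE /wt indicE; case: ifPn => _; rewrite ?mul1r// mul0r mul0e.
Qed.

Lemma measurable_frac_kernelV : measurable_fun setT (fun z : 'rV[R]_d => (frac_kernel s z)^-1).
Proof.
rewrite [X in measurable_fun _ X](_ : _ = fun z => enorm z `^ (- (d%:R + 2 * s))).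
  exact: measurableT_comp (measurable_powR _) (@measurable_enorm R d).
by apply/funext => z; rewrite powRN.
Qed.

Lemma frac_kernelV_ge0 (z : 'rV[R]_d) : 0 <= (frac_kernel s z)^-1.
Proof. by rewrite invr_ge0 powR_ge0. Qed.

(* [|z|^(-2p) = Gam^-1 \int_0^oo a^(p-1) e^(-a |z|^2 / 4) da]; both sides are
   multiplied by [k] to include [z = 0]. *)
Lemma frac_kernel_subordination (z : 'rV[R]_d) (k : R) : 0 <= k -> (z = 0 -> k = 0) ->
  (\int[mu]_a ((wt a)%:E * (k * gauss_rV (a / 4) z)%:E) =
   Gam * (k * (frac_kernel s z)^-1)%:E)%E.
Proof.
move=> k0 kz; have [z0|z0] := eqVneq (enorm z) 0.
  rewrite (kz (enorm_eq0 z0)) mul0r mule0.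
  by under eq_integral do rewrite mul0r mule0; rewrite integral0.
have ez : 0 < enorm z by rewrite lt_neqAle eq_sym z0 enorm_ge0.
rewrite wtE; transitivity (k%:E * gamma_integral p (enorm z))%E.
  rewrite -ge0_integralZl//.
  - by apply: eq_integral => a _; rewrite -!EFinM /gauss_rV mulrCA.
  - apply/measurable_EFinP; apply: measurable_funTS; exact: measurable_gamma_integrand.
  - by move=> a _; rewrite lee_fin mulr_ge0 ?powR_ge0 ?expR_ge0.
rewrite gamma_integralE// muleA muleC -EFinM; congr (_ * (k * _)%:E)%E.
by rewrite powRN /frac_kernel; congr (_ `^ _)^-1; rewrite /p; field.
Qed.

(** The choice [p = d / 2 + s] makes the dimension disappear: [a^(-d/2)] from the mass cancels
    against [a^(p-1)], leaving [a^(s-1)]. *)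
Let gauss_weight (a : R) : 0 < a -> a `^ (p - 1) * gauss_mass (a / 4) ^+ d = K * a `^ (s - 1).
Proof.
move=> a0; rewrite /gauss_mass (_ : pi / (a / 4) = 4 * pi / a); last by field; rewrite gt_eqF.
rewrite sqrtrM ?mulr_ge0 ?pi_ge0// exprMn mulrCA; congr (_ * _).
rewrite -powR12_sqrt ?invr_ge0 ?(ltW a0)// -(@powR_mulrn _ _ d) ?powR_ge0//.
rewrite -powR_inv1 ?(ltW a0)// -!powRrM -powRD; last by apply/implyP => _; rewrite gt_eqF.
by congr (_ `^ _); rewrite /p; field.
Qed.

Let measurable_gauss_rV_param d' (T : measurableType d') (f : T -> R) (g : T -> 'rV[R]_d) :
  measurable_fun setT f -> measurable_fun setT g ->
  measurable_fun setT (fun x => gauss_rV (f x / 4) (g x)).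
Proof.
move=> mf mg; apply: measurableT_comp => //; apply: measurable_funN.
apply: measurable_funM; first exact: measurable_funM.
by apply: measurable_funX; exact: measurableT_comp (@measurable_enorm R d) mg.
Qed.

Definition frac_form (u : 'rV[R]_d -> R) : \bar R :=
  (\int[leb2]_z ((u z.1 - u z.2) ^+ 2 / frac_kernel s (z.1 - z.2))%:E)%E.

Let measurable_param (u : 'rV[R]_d -> R) : measurable_fun setT u ->
  measurable_fun setT (fun q : 'rV[R]_d * 'rV[R]_d * R =>
    ((wt q.2)%:E * ((u q.1.1 - u q.1.2) ^+ 2 * gauss_rV (q.2 / 4) (q.1.1 - q.1.2))%:E)%E).
Proof.
move=> mu'; apply: emeasurable_funM.
  by apply/measurable_EFinP; exact: measurableT_comp mwt measurable_snd.
apply/measurable_EFinP; apply: measurable_funM.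
  exact: (measurableT_comp (measurable_sqrB mu') measurable_fst).
apply: measurable_gauss_rV_param => //; apply: measurable_rVB.
  exact: measurableT_comp measurable_fst measurable_fst.
exact: measurableT_comp measurable_snd measurable_fst.
Qed.

Lemma measurable_frac_integrand (u : 'rV[R]_d -> R) : measurable_fun setT u ->
  measurable_fun setT (fun z : 'rV[R]_d * 'rV[R]_d =>
    (u z.1 - u z.2) ^+ 2 / frac_kernel s (z.1 - z.2)).
Proof.
move=> mu'; apply: measurable_funM; first exact: measurable_sqrB.
by apply: (measurableT_comp measurable_frac_kernelV); exact: measurable_rVB.
Qed.

Let frac_form_subordination (u : 'rV[R]_d -> R) : measurable_fun setT u ->
  (Gam * frac_form u = \int[mu]_a ((wt a)%:E * gauss_form (a / 4) u))%E.
Proof.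
move=> mu'; have Gam0 : (0 <= Gam)%E by exact/ltW/gamma_integral_gt0.
rewrite /frac_form -ge0_integralZl//; last 2 first.
- by apply/measurable_EFinP; exact: measurable_frac_integrand.
- by move=> z _; rewrite lee_fin mulr_ge0 ?sqr_ge0 ?frac_kernelV_ge0.
transitivity (\int[leb2]_z \int[mu]_a
    ((wt a)%:E * ((u z.1 - u z.2) ^+ 2 * gauss_rV (a / 4) (z.1 - z.2))%:E))%E.
  (* On the diagonal, where the kernel takes its default value, the increment of [u] vanishes. *)
  apply: eq_integral => z _; rewrite frac_kernel_subordination ?sqr_ge0//.
  by move/eqP; rewrite subr_eq0 => /eqP ->; rewrite subrr expr0n.
rewrite (tonelli_product leb leb mu (measurable_param mu'))/=; last first.
  by move=> q; rewrite mule_ge0 ?lee_fin// mulr_ge0 ?sqr_ge0 ?gauss_rV_ge0.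
apply: eq_integral => a _; rewrite /gauss_form -ge0_integralZl ?lee_fin//.
- apply/measurable_EFinP; apply: measurable_funM; first exact: measurable_sqrB.
  exact: measurable_gauss_rVB.
- by move=> z _; rewrite lee_fin mulr_ge0 ?sqr_ge0 ?gauss_rV_ge0.
Qed.

Let T1 : \bar R := (\int[mu]_(a in `]0%R, 1%R]) (a `^ (s - 1))%:E)%E.
Let T2 : \bar R := (\int[mu]_(a in `]1%R, +oo[) (a `^ (s - 2))%:E)%E.
Let J : \bar R := (\int[mu]_(a in `]0%R, +oo[) (a `^ (s - 1) / (1 + a))%:E)%E.

(** At [c = a / 4] the first hypothesis gives [2 K A a^(s-1)]. In the second one
    [1 / (2 c) = 2 / a], which gives [2 K B a^(s-2)]. The factor [2 K] is therefore common to both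
    ranges. *)
Let frac_form_le (u : 'rV[R]_d -> R) (A B : R) : measurable_fun setT u ->
  0 <= A -> 0 <= B ->
  (forall c : R, (0 < c)%R -> gauss_form c u <= (2 * gauss_mass c ^+ d * A)%:E)%E ->
  (forall c : R, (0 < c)%R -> gauss_form c u <= (gauss_mass c ^+ d / (2 * c) * B)%:E)%E ->
  (Gam * frac_form u <= (2 * K)%:E * (A%:E * T1 + B%:E * T2))%E.
Proof.
move=> mu' A0 B0 uA uB; rewrite frac_form_subordination// wtE.
have gf0 a : (0 <= (a `^ (p - 1))%:E * gauss_form (a / 4) u)%E.
  rewrite mule_ge0 ?lee_fin ?powR_ge0// integral_ge0// => z _.
  by rewrite lee_fin mulr_ge0 ?sqr_ge0 ?gauss_rV_ge0.
have mgf : measurable_fun setT (fun a : R => ((a `^ (p - 1))%:E * gauss_form (a / 4) u)%E).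
  apply: emeasurable_funM; first by apply/measurable_EFinP; exact: measurable_powR.
  apply: (measurable_integral_product leb leb (f := fun q : 'rV[R]_d * 'rV[R]_d * R =>
    ((u q.1.1 - u q.1.2) ^+ 2 * gauss_rV (q.2 / 4) (q.1.1 - q.1.2))%:E)).
    apply/measurable_EFinP; apply: measurable_funM.
      exact: (measurableT_comp (measurable_sqrB mu') measurable_fst).
    apply: measurable_gauss_rV_param => //; apply: measurable_rVB.
      exact: measurableT_comp measurable_fst measurable_fst.
    exact: measurableT_comp measurable_snd measurable_fst.
  by move=> q; rewrite lee_fin mulr_ge0 ?sqr_ge0 ?gauss_rV_ge0.
have mpow r : measurable_fun setT (fun a : R => (a `^ r)%:E).
  by apply/measurable_EFinP; exact: measurable_powR.
have K2 : 0 <= 2 * K by rewrite mulr_ge0// ltW.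
rewrite integral_0y_split//; last exact: measurable_funTS.
have T0 : (0 <= T1)%E by apply: integral_ge0 => a _; rewrite lee_fin powR_ge0.
have T20 : (0 <= T2)%E by apply: integral_ge0 => a _; rewrite lee_fin powR_ge0.
rewrite ge0_muleDr ?mule_ge0 ?lee_fin// !muleA -!EFinM.
have KA : 0 <= 2 * K * A by rewrite mulr_ge0.
have KB : 0 <= 2 * K * B by rewrite mulr_ge0.
apply: leeD.
  rewrite /T1 -ge0_integralZl ?lee_fin//; last 2 first.
  - by apply: measurable_funTS; exact: mpow.
  - by move=> a _; rewrite lee_fin powR_ge0.
  apply: ge0_le_integral => //.
  - exact: measurable_funTS.
  - by apply: emeasurable_funM => //; apply: measurable_funTS; exact: mpow.
  move=> a; rewrite /= in_itv/= => /andP[a0 _].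
  apply: (@le_trans _ _ (a `^ (p - 1) * (2 * gauss_mass (a / 4) ^+ d * A))%:E).
    rewrite EFinM; apply: lee_wpmul2l; first by rewrite lee_fin powR_ge0.
    by apply: uA; rewrite divr_gt0.
  rewrite -EFinM lee_fin (_ : _ * (_ * _ * _) =
    2 * A * (a `^ (p - 1) * gauss_mass (a / 4) ^+ d)); last by ring.
  by rewrite gauss_weight// le_eqVlt; apply/orP; left; apply/eqP; ring.
rewrite /T2 -ge0_integralZl ?lee_fin//; last 2 first.
- by apply: measurable_funTS; exact: mpow.
- by move=> a _; rewrite lee_fin powR_ge0.
apply: ge0_le_integral => //.
- exact: measurable_funTS.
- by apply: emeasurable_funM => //; apply: measurable_funTS; exact: mpow.
move=> a; rewrite /= in_itv/= andbT => a1; have a0 : 0 < a by exact: lt_trans a1.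
apply: (@le_trans _ _ (a `^ (p - 1) * (gauss_mass (a / 4) ^+ d / (2 * (a / 4)) * B))%:E).
  rewrite EFinM; apply: lee_wpmul2l; first by rewrite lee_fin powR_ge0.
  by apply: uB; rewrite divr_gt0.
rewrite -EFinM lee_fin !mulrA gauss_weight//.
have -> : a `^ (s - 1) = a `^ (s - 2) * a.
  rewrite (_ : s - 1 = s - 2 + 1); last by ring.
  by rewrite powRD ?powRr1 ?(ltW a0)//; apply/implyP => _; rewrite gt_eqF.
rewrite le_eqVlt; apply/orP; left; apply/eqP.
by field; rewrite gt_eqF.
Qed.

Let I_C : \bar R :=
  (\int[leb]_z ((1 - cos (z ord0 ord0)) / frac_kernel s z)%:E)%E.

Let mcos : measurable_fun setT (fun z : 'rV[R]_d => 1 - cos (z ord0 ord0)).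
Proof.
apply: measurable_funB => //; apply: measurableT_comp (measurable_coord ord0).
exact: continuous_measurable_fun (@continuous_cos R).
Qed.

Let cos0 (z : 'rV[R]_d) : 0 <= 1 - cos (z ord0 ord0).
Proof. by rewrite subr_ge0 cos_le1. Qed.

(** The same subordination applied to [1 - cos]. It brings in the same [Gam] and the same weight
    [K a^(s-1)], which prepares the cancellation in [frac_form_bound]. *)
Let frac_const_integral_ge : (K%:E * J <= Gam * I_C)%E.
Proof.
have Gam0 : (0 <= Gam)%E by exact/ltW/gamma_integral_gt0.
have mI : measurable_fun setT (fun q : 'rV[R]_d * R =>
    ((wt q.2)%:E * ((1 - cos (q.1 ord0 ord0)) * gauss_rV (q.2 / 4) q.1)%:E)%E).
  apply: emeasurable_funM.
    by apply/measurable_EFinP; exact: measurableT_comp mwt measurable_snd.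
  apply/measurable_EFinP; apply: measurable_funM.
    exact: measurableT_comp mcos measurable_fst.
  exact: measurable_gauss_rV_param.
have -> : (Gam * I_C = \int[mu]_a ((wt a)%:E *
    ((1 - expR (- a^-1)) * gauss_mass (a / 4) ^+ d)%:E))%E.
  rewrite /I_C -ge0_integralZl//; last 2 first.
  - apply/measurable_EFinP; apply: measurable_funM => //; exact: measurable_frac_kernelV.
  - by move=> z _; rewrite lee_fin mulr_ge0 ?frac_kernelV_ge0.
  transitivity (\int[leb]_z \int[mu]_a
      ((wt a)%:E * ((1 - cos (z ord0 ord0)) * gauss_rV (a / 4) z)%:E))%E.
    apply: eq_integral => z _; rewrite frac_kernel_subordination//.
    by move=> ->; rewrite mxE trigo.cos0 subrr.
  rewrite (fubini_tonelli (m1 := leb) (m2 := mu) _ mI)/=; last first.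
    by move=> q; rewrite mule_ge0 ?lee_fin// mulr_ge0 ?gauss_rV_ge0.
  apply: eq_integral => a _; rewrite /wt indicE.
  have [a0|a0] := boolP (a \in _); last first.
    rewrite mul0r mul0e (eq_integral (cst 0%E)) ?integral0// => z _.
    by rewrite mul0e.
  have {}a0 : 0 < a by move: a0; rewrite inE/= in_itv/= andbT.
  rewrite mul1r ge0_integralZl ?lee_fin ?powR_ge0//; last 2 first.
  - apply/measurable_EFinP; apply: measurable_funM => //; exact: measurable_gauss_rV.
  - by move=> z _; rewrite lee_fin mulr_ge0 ?gauss_rV_ge0.
  rewrite integral_1Bcos_gauss_rV ?divr_gt0//.
  by congr (_ * ((1 - expR (- _)) * _)%:E)%E; field; rewrite gt_eqF.
rewrite wtE /J -ge0_integralZl ?lee_fin ?(ltW K0)//; last 2 first.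
- by apply/measurable_EFinP; exact: measurable_powR_div1D.
- move=> a; rewrite /= in_itv/= andbT => a0.
  by rewrite lee_fin divr_ge0 ?powR_ge0// addr_ge0// ltW.
have mE : measurable_fun (`]0%R, +oo[ : set R) (fun a : R => expR (- a^-1)).
  apply: measurableT_comp => //; apply: measurable_funN.
  apply: (eq_measurable_fun (fun a : R => a `^ (- 1))).
    by move=> a; rewrite inE/= in_itv/= andbT => a0; rewrite powR_inv1// ltW.
  by apply: measurable_funTS; exact: measurable_powR.
have mG : measurable_fun (`]0%R, +oo[ : set R) (fun a : R => gauss_mass (a / 4) ^+ d : R).
  apply: measurable_funX.
  apply: (eq_measurable_fun (fun a : R => (pi * (4 * a `^ (-1))) `^ (2^-1))).
    move=> a; rewrite inE/= in_itv/= andbT => a0.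
    rewrite /gauss_mass powR_inv1 ?(ltW a0)// powR12_sqrt; last first.
      by rewrite !mulr_ge0 ?pi_ge0 ?invr_ge0 ?(ltW a0).
    by congr Num.sqrt; field; rewrite gt_eqF.
  apply: measurable_funTS; apply: (measurableT_comp (measurable_powR _)).
  by do 2 apply: measurable_funM => //; exact: measurable_powR.
apply: ge0_le_integral => //.
- move=> a; rewrite /= in_itv/= andbT => a0.
  by rewrite -EFinM lee_fin mulr_ge0 ?(ltW K0)// divr_ge0 ?powR_ge0// addr_ge0// ltW.
- apply: emeasurable_funM => //.
  by apply/measurable_EFinP; exact: measurable_powR_div1D.
- apply: emeasurable_funM.
    by apply/measurable_EFinP; apply: measurable_funTS; exact: measurable_powR.
  by apply/measurable_EFinP; apply: measurable_funM => //; exact: measurable_funB.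
move=> a; rewrite /= in_itv/= andbT => a0.
have a10 : 0 < 1 + a by rewrite addr_gt0.
rewrite -!EFinM lee_fin (_ : _ * (_ * _ ^+ _) =
  a `^ (p - 1) * gauss_mass (a / 4) ^+ d * (1 - expR (- a^-1))); last by ring.
rewrite gauss_weight// mulrA ler_wpM2l ?mulr_ge0 ?powR_ge0 ?(ltW K0)//.
(* The inequality [1 / (1 + a) <= 1 - e^(-1/a)] is turned into [1 + 1/a <= e^(1/a)]. *)
rewrite expRN lerBrDr -lerBrDl.
have -> : 1 - (1 + a)^-1 = (1 + a^-1)^-1 by field; rewrite !gt_eqF// addrC.
by rewrite lef_pV2 ?posrE ?expR_gt0 ?expR_ge1Dx// addr_gt0// invr_gt0.
Qed.

(** With [X = frac_form u], the chain is [Gam X <= 2 K (A T1 + B T2) <= 2 (A + B) K J <= 2 (A + B)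
    Gam I_C]. Dividing by [Gam] and multiplying by [C / 2 = 1 / (2 I_C)] leaves [A + B]; degenerate
    values of [Gam] and [I_C] are treated apart. *)
Lemma frac_form_bound (u : 'rV[R]_d -> R) (A B : R) : measurable_fun setT u ->
  0 <= A -> 0 <= B ->
  (forall c : R, 0 < c -> (gauss_form c u <= (2 * gauss_mass c ^+ d * A)%:E)%E) ->
  (forall c : R, 0 < c -> (gauss_form c u <= (gauss_mass c ^+ d / (2 * c) * B)%:E)%E) ->
  (frac_form u < +oo)%E /\
  ((frac_const n s / 2)%:E * frac_form u <= (A + B)%:E)%E.
Proof.
move=> mu' A0 B0 uA uB; have GX := frac_form_le mu' A0 B0 uA uB.
have Gam0 : (0 < Gam)%E by exact: gamma_integral_gt0.
have [s0 s1] := andP s01.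
have X0 : (0 <= frac_form u)%E.
  by apply: integral_ge0 => z _; rewrite lee_fin mulr_ge0 ?sqr_ge0 ?frac_kernelV_ge0.
have T10 : (0 <= T1)%E by apply: integral_ge0 => a _; rewrite lee_fin powR_ge0.
have T20 : (0 <= T2)%E by apply: integral_ge0 => a _; rewrite lee_fin powR_ge0.
have J0 : (0 <= J)%E by exact: le_trans (integral_powR_01_le0y s01).
(* The explicit bounds [1 / s] and [1 / (1 - s)] serve only here, for finiteness; the constant comes
   from [J]. *)
have GXoo : (Gam * frac_form u < +oo)%E.
  apply: (le_lt_trans GX); apply: (@le_lt_trans _ _
      ((2 * K)%:E * (A%:E * (s^-1)%:E + B%:E * ((1 - s)^-1)%:E))%E); last first.
    by rewrite -!EFinM ltry.
  rewrite lee_wpmul2l ?lee_fin ?mulr_ge0 ?(ltW K0)//.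
  apply: leeD; apply: lee_wpmul2l; rewrite ?lee_fin//.
    exact: integral_powR_01_le.
  exact: integral_powR_1y_le.
have Xoo : (frac_form u < +oo)%E.
  by rewrite ltey; apply/eqP => Xy; move: GXoo; rewrite Xy gt0_muley.
split => //.
have I0 : (0 <= I_C)%E.
  by apply: integral_ge0 => z _; rewrite lee_fin mulr_ge0 ?frac_kernelV_ge0.
have cE : frac_const n s = (fine I_C)^-1 by [].
have AB0 : 0 <= A + B by exact: addr_ge0.
(* [fine] sends [+oo] to 0, and [0^-1 = 0]: if [I_C] is zero or infinite, then [frac_const] is 0 and
   the bound is trivial. *)
have [c0|c0] := eqVneq (fine I_C) 0.
  by rewrite cE c0 invr0 mul0r mul0e lee_fin.
have Ifin : I_C \is a fin_num.
  by rewrite ge0_fin_numE// ltey; apply/eqP => Iy; move: c0; rewrite Iy eqxx.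
set c := fine I_C in c0 cE; have IE : I_C = c%:E by rewrite fineK.
have {}c0 : 0 < c by rewrite lt_neqAle eq_sym c0 -lee_fin -IE.
have GX2 : (Gam * frac_form u <= Gam * (2 * (A + B) * c)%:E)%E.
  apply: (le_trans GX); apply: (@le_trans _ _ ((2 * (A + B))%:E * (K%:E * J))%E).
    rewrite muleA -[X in (_ <= X)%E](_ : (2 * K)%:E * ((A + B)%:E * J) = _)%E; last first.
      by rewrite muleA -EFinM; congr (_%:E * _)%E; ring.
    rewrite lee_wpmul2l ?lee_fin ?mulr_ge0 ?(ltW K0)//.
    rewrite EFinD ge0_muleDl ?lee_fin//; apply: leeD; apply: lee_wpmul2l; rewrite ?lee_fin//.
      exact: integral_powR_01_le0y.
    exact: integral_powR_1y_le0y.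
  rewrite [in leRHS]EFinM [leRHS]muleCA; apply: lee_wpmul2l; first by rewrite lee_fin mulr_ge0.
  by rewrite -IE; exact: frac_const_integral_ge.
(* Were [Gam] infinite, finiteness of [Gam * frac_form u] would force the form to vanish. *)
have [Gy|Goo] := eqVneq Gam +oo%E.
  have X00 : frac_form u = 0%E.
    apply/eqP; rewrite eq_le X0 andbT leNgt; apply/negP => X1.
    by move: GXoo; rewrite Gy gt0_mulye.
  by rewrite X00 mule0 lee_fin.
have Gfin : Gam \is a fin_num by rewrite ge0_fin_numE ?(ltW Gam0)// ltey.
have X2 : (frac_form u <= (2 * (A + B) * c)%:E)%E by rewrite -(lee_pmul2l Gfin).
rewrite (le_trans (lee_wpmul2l _ X2)) ?lee_fin ?cE ?divr_ge0 ?invr_ge0 ?(ltW c0)//.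
by rewrite le_eqVlt; apply/orP; left; apply/eqP; field; rewrite gt_eqF.
Qed.

End fractional_form.

(** * Weak gradients and density *)

Lemma integrable_lincomb d (T : measurableType d) (R : realType)
    (mu : {measure set T -> \bar R}) (I : Type) (r : seq I) (a : I -> R)
    (f : I -> T -> R) : (forall i, mu.-integrable setT (EFin \o f i)) ->
  mu.-integrable setT (EFin \o (fun x => \sum_(i <- r) a i * f i x)).
Proof.
move=> fi; rewrite (_ : _ \o _ = fun x => (\sum_(i <- r) (a i)%:E * (EFin \o f i) x)%E).
  by apply: integrable_sum => // i _; exact: integrableZl.
by apply/funext => x /=; rewrite -sumEFin.
Qed.

Lemma Rintegral_lincomb d (T : measurableType d) (R : realType)
    (mu : {measure set T -> \bar R}) (I : Type) (r : seq I) (a : I -> R)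
    (f : I -> T -> R) : (forall i, mu.-integrable setT (EFin \o f i)) ->
  (\int[mu]_x (\sum_(i <- r) a i * f i x) = \sum_(i <- r) a i * \int[mu]_x f i x)%R.
Proof.
move=> fi; elim: r => [|i r IH].
  rewrite big_nil; under eq_Rintegral do rewrite big_nil.
  by rewrite Rintegral_cst// mul0r.
under eq_Rintegral do rewrite big_cons.
rewrite big_cons RintegralD//; last exact: integrable_lincomb.
  by rewrite IH RintegralZl.
rewrite (_ : _ \o _ = fun x => ((a i)%:E * (EFin \o f i) x)%E); last exact/funext.
exact: integrableZl.
Qed.

(** * Inner product and norm on [L^2] *)

Section square_integrable.
Variables (R : realType) (d : nat).
Local Notation leb := (lebesgue_rV R d).
Implicit Types (f g : 'rV[R]_d -> R) (O : set 'rV[R]_d).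
Local Notation Lfun2 := (Lfun leb 2%:E).

Let le12 : (1 <= 2%:E :> \bar R)%E. Proof. by rewrite lee_fin ler1n. Qed.

Lemma Lfun2_measurable f : f \in Lfun2 -> measurable_fun setT f.
Proof. by rewrite inE => /andP[/[!inE]]. Qed.

Lemma Lfun2P f : measurable_fun setT f -> (\int[leb]_x (f x ^+ 2)%:E < +oo)%E ->
  f \in Lfun2.
Proof.
move=> mf f2; rewrite inE; apply/andP; split; first by rewrite inE.
rewrite inE/= /finite_norm unlock /Lnorm poweR_lty//.
by under eq_integral do rewrite /= powR_mulrn// real_normK ?num_real//.
Qed.

Lemma Lfun2B f g : f \in Lfun2 -> g \in Lfun2 -> f \- g \in Lfun2.
Proof.
move=> F G; rewrite (_ : f \- g = f + - g)//.
apply: (Lfun_addr_closed leb le12).2 => //.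
by rewrite rpredN.
Qed.

Lemma Lfun2_lincomb (I : Type) (r : seq I) (a : I -> R) (f : I -> 'rV[R]_d -> R) :
  (forall i, f i \in Lfun2) -> (fun x => \sum_(i <- r) a i * f i x) \in Lfun2.
Proof.
move=> fi; elim: r => [|i r IH].
  rewrite (_ : (fun _ => _) = 0); first exact: (Lfun_addr_closed leb le12).1.
  by apply/funext => x; rewrite big_nil.
rewrite (_ : (fun _ => _) = a i *: f i + (fun x => \sum_(i <- r) a i * f i x)).
  exact: (Lfun_submod_closed leb le12).2.
by apply/funext => x; rewrite big_cons.
Qed.

Lemma Lfun2_mul f g : f \in Lfun2 -> g \in Lfun2 ->
  leb.-integrable setT (EFin \o (fun x => f x * g x)).
Proof. by move=> F G; apply/Lfun1_integrable; exact: Lfun2_mul_Lfun1. Qed.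

Lemma dotL2C f g : dotL2 f g = dotL2 g f.
Proof. by apply: eq_Rintegral => x _; rewrite mulrC. Qed.

Lemma dotL2Bl f g w : f \in Lfun2 -> g \in Lfun2 -> w \in Lfun2 ->
  dotL2 (f \- g) w = dotL2 f w - dotL2 g w.
Proof.
move=> F G W; rewrite /dotL2 -RintegralB//; try exact: Lfun2_mul.
by apply: eq_Rintegral => x _; rewrite mulrBl.
Qed.

Lemma dotL2_lincombl (I : Type) (r : seq I) (a : I -> R) (f : I -> 'rV[R]_d -> R) w :
  (forall i, f i \in Lfun2) -> w \in Lfun2 ->
  dotL2 (fun x => \sum_(i <- r) a i * f i x) w = \sum_(i <- r) a i * dotL2 (f i) w.
Proof.
move=> fi W; rewrite /dotL2 -(Rintegral_lincomb r a (f := fun i x => f i x * w x)).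
  by apply: eq_Rintegral => x _; rewrite mulr_suml; under eq_bigr do rewrite -mulrA.
by move=> i; exact: Lfun2_mul.
Qed.

Lemma sqnormL2_ge0 f : 0 <= sqnormL2 f.
Proof. by apply: Rintegral_ge0 => x _; rewrite -expr2 sqr_ge0. Qed.

Lemma sqnormL2E f : f \in Lfun2 -> (\int[leb]_x (f x ^+ 2)%:E = (sqnormL2 f)%:E)%E.
Proof.
move=> F; rewrite /sqnormL2 /dotL2 /Rintegral fineK.
  by apply: eq_integral.
apply: integrable_fin_num => //; exact: (Lfun2_mul F F).
Qed.

Lemma sqnormL2_lincomb (I : Type) (r : seq I) (a : I -> R) (f : I -> 'rV[R]_d -> R) :
  (forall i, f i \in Lfun2) ->
  sqnormL2 (fun x => \sum_(i <- r) a i * f i x) =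
  \sum_(i <- r) \sum_(j <- r) a i * a j * dotL2 (f i) (f j).
Proof.
move=> fi; rewrite /sqnormL2 dotL2_lincombl//; last exact: Lfun2_lincomb.
apply: eq_bigr => i _; rewrite dotL2C dotL2_lincombl// mulr_sumr.
by apply: eq_bigr => j _; rewrite mulrA dotL2C.
Qed.

Lemma sqnormL2_lin (a : R) f g : f \in Lfun2 -> g \in Lfun2 ->
  sqnormL2 (fun x => a * f x + g x) =
  a ^+ 2 * sqnormL2 f + 2 * a * dotL2 f g + sqnormL2 g.
Proof.
move=> F G; have := @sqnormL2_lincomb bool [:: true; false]
  (fun b => if b then a else 1) (fun b => if b then f else g).
rewrite !big_cons !big_nil !addr0 (dotL2C g f) !mul1r => H.
transitivity (a * a * dotL2 f f + a * 1 * dotL2 f g + (a * dotL2 f g + dotL2 g g)).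
  rewrite -H; last by case.
  by congr sqnormL2; apply/funext => x; rewrite !big_cons !big_nil addr0 mul1r.
by rewrite /sqnormL2; ring.
Qed.

(** Cauchy-Schwarz, from the sign of the quadratic polynomial [t |-> |f - t g|^2]. *)
Lemma dotL2_sqr_le f g : f \in Lfun2 -> g \in Lfun2 ->
  dotL2 f g ^+ 2 <= sqnormL2 f * sqnormL2 g.
Proof.
move=> F G; have Q (t : R) : 0 <= sqnormL2 f - 2 * (t * dotL2 f g) + t ^+ 2 * sqnormL2 g.
  have := sqnormL2_ge0 (fun x => - t * g x + f x); rewrite sqnormL2_lin//.
  by rewrite (dotL2C g f) sqrrN; apply: etrans; congr (0 <= _); ring.
have [g0|g0] := eqVneq (sqnormL2 g) 0.
  rewrite g0 mulr0; have [->|f0] := eqVneq (dotL2 f g) 0; first by rewrite expr0n.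
  (* When [|g|^2 = 0] the polynomial is affine in [t]; this value of [t] would make it equal to
     -1. *)
  have := Q ((sqnormL2 f + 1) / (2 * dotL2 f g)).
  rewrite g0 mulr0 addr0 (_ : _ - _ = -1); last by field.
  by rewrite ler0N1.
have {}g0 : 0 < sqnormL2 g by rewrite lt_neqAle eq_sym g0 sqnormL2_ge0.
have := Q (dotL2 f g / sqnormL2 g).
rewrite -(pmulr_lge0 _ g0) -[_ <= sqnormL2 f * _]subr_ge0; apply: etrans.
by congr (0 <= _); field; rewrite gt_eqF.
Qed.

Lemma dotL2_cvg f (g : nat -> 'rV[R]_d -> R) (g0 : 'rV[R]_d -> R) :
  f \in Lfun2 -> (forall m, g m \in Lfun2) -> g0 \in Lfun2 ->
  sqnormL2 (g m \- g0) @[m --> \oo] --> (0 : R) ->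
  dotL2 (g m) f @[m --> \oo] --> dotL2 g0 f.
Proof.
move=> F G G0 gg0.
apply/cvgrPdist_le => e e0.
have ggf : (sqnormL2 (g m \- g0) * sqnormL2 f) @[m --> \oo] --> (0 : R).
  by rewrite -(mul0r (sqnormL2 f)); apply: cvgM => //; exact: cvg_cst.
have := ggf => /cvgr0Pnorm_le /(_ _ (exprn_gt0 2 e0)).
apply: filterS => m.
rewrite ger0_norm ?mulr_ge0 ?sqnormL2_ge0// => le_e.
rewrite -(ler_pXn2r (n := 2)) ?nnegrE ?(ltW e0)// real_normK ?num_real//.
apply: le_trans le_e; rewrite -sqrrN opprB -dotL2Bl//.
exact: dotL2_sqr_le (Lfun2B (G m) G0) F.
Qed.

Lemma test_function_Lfun2 O phi : test_function O phi -> phi \in Lfun2.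
Proof.
move=> tphi; have mphi := test_function_measurable tphi.
by apply: Lfun2P => //; apply: bounded_support_sqr_lty => //; exact: test_function_bounded tphi.
Qed.

End square_integrable.

(** * Approximation by test functions and uniqueness of weak gradients *)

Section weak_derivatives.
Variables (R : realType) (d : nat) (O : set 'rV[R]_d).
Local Notation leb := (lebesgue_rV R d).
Implicit Types f g u : 'rV[R]_d -> R.
Local Notation Lfun2 := (Lfun leb 2%:E).

Lemma partial_lin (a : R) f g i x : derivable f x (delta_mx ord0 i) ->
  derivable g x (delta_mx ord0 i) ->
  partial i (fun x => a * f x + g x) x = a * partial i f x + partial i g x.
Proof.
move=> df dg; rewrite /partial (_ : (fun _ => _) = (a \*: f) + g)//.
rewrite deriveD //; last exact: derivableZ.
by rewrite deriveZ.
Qed.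

Lemma Ck_lin k (a : R) f g : Ck k f -> Ck k g -> Ck k (fun x => a * f x + g x).
Proof.
have cont f' g' : continuous f' -> continuous g' ->
    continuous (fun x : 'rV[R]_d => a * f' x + g' x : R).
  move=> cf cg x; apply: (@continuousD _ _ _ (fun x => a * f' x) g'); last exact: cg.
  by apply: (@continuousM _ _ (fun=> a) f'); [exact: cst_continuous|exact: cf].
elim: k f g => [|k IH] f g /=; first exact: cont.
move=> [cf df] [cg dg]; split; first exact: cont.
move=> i; have [dfi pf] := df i; have [dgi pg] := dg i; split.
  move=> x; rewrite (_ : (fun _ => _) = (a \*: f) + g)//.
  by apply: derivableD => //; exact: derivableZ.
rewrite (_ : partial i _ = fun x => a * partial i f x + partial i g x).
  exact: IH.
by apply/funext => x; exact: partial_lin.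
Qed.

Lemma test_function_lin (a : R) f g : test_function O f -> test_function O g ->
  test_function O (fun x => a * f x + g x).
Proof.
move=> [Cf [Kf fO]] [Cg [Kg gO]]; split; first by move=> k; exact: Ck_lin.
set F := closure _ in Kf fO; set G := closure _ in Kg gO.
have sub : closure [set x | a * f x + g x != 0] `<=` F `|` G.
  rewrite /F /G -closureU; apply: closureS => x /=.
  have [->|fx _] := eqVneq (f x) 0; last by left.
  by rewrite mulr0 add0r; right.
split; last by move=> x /sub [/fO|/gO].
by apply: subclosed_compact sub; [exact: closed_closure|exact: compactU].
Qed.

Lemma test_function0 : test_function O (fun=> 0).
Proof.
have C0 k : @Ck R d k (fun=> 0).
  elim: k => [|k IH] /=; first by move=> x; exact: cst_continuous.
  split=> [x|i]; first exact: cst_continuous.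
  split=> [x|]; first exact: derivable_cst.
  by rewrite (_ : partial i _ = fun=> 0)//; apply/funext => x; exact: derive_cst.
split => /=; first exact: C0.
rewrite (_ : [set _ | _] = set0); last by apply/seteqP; split => x //=; rewrite eqxx.
by rewrite closure0; split; [exact: compact0|].
Qed.

Lemma test_function_derivable f i x : test_function O f -> derivable f x (delta_mx ord0 i).
Proof. by move=> [/(_ 1%N)[_ /(_ i)[]]]. Qed.

(** The parallelogram law: the square of [- a f + g] is dropped. *)
Lemma sqnormL2_lin_le (a : R) f g : f \in Lfun2 -> g \in Lfun2 ->
  sqnormL2 (fun x => a * f x + g x) <= 2 * a ^+ 2 * sqnormL2 f + 2 * sqnormL2 g.
Proof.
move=> F G; rewrite sqnormL2_lin//.
have := sqnormL2_ge0 (fun x => - a * f x + g x); rewrite sqnormL2_lin// => ?.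
by rewrite -subr_ge0; apply: le_trans (_ : _ <= _); first eassumption; rewrite le_eqVlt; apply/orP; left; apply/eqP; ring.
Qed.

(** The approximation clause of [H10] with an explicit gradient [G] instead of the chosen [wgrad].
    In this form it is stable under linear combinations, whereas [wgrad] of a combination need not
    be the combination of the [wgrad]s pointwise. *)
Definition H10_approx u (G : 'I_d -> 'rV[R]_d -> R) : Prop :=
  [/\ u \in Lfun2, forall i, G i \in Lfun2 &
    exists phi : nat -> 'rV[R]_d -> R,
    [/\ forall m, test_function O (phi m),
        sqnormL2 (phi m \- u) @[m --> \oo] --> (0 : R) &
        forall i, sqnormL2 (partial i (phi m) \- G i) @[m --> \oo] --> (0 : R)]].

Lemma L2_lincomb (I : Type) (r : seq I) (a : I -> R) (f : I -> 'rV[R]_d -> R) :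
  (forall i, L2 O (f i)) -> L2 O (fun x => \sum_(i <- r) a i * f i x).
Proof.
move=> fi; split; first by apply: Lfun2_lincomb => i; exact: (fi i).1.
by move=> x Ox; apply: big1 => i _; rewrite (fi i).2// mulr0.
Qed.

Lemma weak_gradient_lincomb (I : Type) (r : seq I) (a : I -> R)
    (f : I -> 'rV[R]_d -> R) (G : I -> 'I_d -> 'rV[R]_d -> R) :
  (forall k, f k \in Lfun2) -> (forall k, weak_gradient O (f k) (G k)) ->
  weak_gradient O (fun x => \sum_(k <- r) a k * f k x)
    (fun i x => \sum_(k <- r) a k * G k i x).
Proof.
move=> fk wG i; split; first by apply: L2_lincomb => k; exact: (wG k i).1.
move=> phi tphi; rewrite !dotL2_lincombl//; last 3 first.
- by move=> k; exact: (wG k i).1.1.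
- exact: test_function_Lfun2 tphi.
- exact: test_function_Lfun2 (test_function_partial i tphi).
by rewrite -sumrN; apply: eq_bigr => k _; rewrite (wG k i).2// mulrN.
Qed.

Lemma wgradP u : H1 O u -> weak_gradient O u (wgrad O u).
Proof. by move=> [_ [G uG]]; apply: (xgetPex (fun _ _ => 0)); exists G. Qed.

Lemma H10_approx_wgrad u : H10 O u -> H10_approx u (wgrad O u).
Proof.
move=> [Hu [phi [tphi phiu phiG]]]; have wG := wgradP Hu.
by split; [exact: Hu.1.1|move=> i; exact: (wG i).1.1|exists phi].
Qed.

Lemma sqnormL2_lin_cvg0 (a : R) (f g : nat -> 'rV[R]_d -> R) :
  (forall m, f m \in Lfun2) -> (forall m, g m \in Lfun2) ->
  sqnormL2 (f m) @[m --> \oo] --> (0 : R) -> sqnormL2 (g m) @[m --> \oo] --> (0 : R) ->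
  sqnormL2 (fun x => a * f m x + g m x) @[m --> \oo] --> (0 : R).
Proof.
move=> F G f0 g0.
apply: (@squeeze_cvgr _ _ _ _ (fun=> 0)
    (fun m => 2 * a ^+ 2 * sqnormL2 (f m) + 2 * sqnormL2 (g m))).
- by apply: nearW => m; rewrite sqnormL2_ge0 sqnormL2_lin_le.
- exact: cvg_cst.
rewrite -[X in _ --> X](_ : 2 * a ^+ 2 * 0 + 2 * 0 = 0); last by rewrite !mulr0 addr0.
by apply: cvgD; apply: cvgM => //; exact: cvg_cst.
Qed.

Lemma H10_approx_lin (a : R) f F g G : H10_approx f F -> H10_approx g G ->
  H10_approx (fun x => a * f x + g x) (fun i x => a * F i x + G i x).
Proof.
move=> [f2 F2 [phi [tphi phif phiF]]] [g2 G2 [psi [tpsi psig psiG]]].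
have lin (p q : 'rV[R]_d -> R) : p \in Lfun2 -> q \in Lfun2 ->
    (fun x => a * p x + q x) \in Lfun2.
  move=> P Q; have := @Lfun2_lincomb R d bool [:: true; false]
    (fun b => if b then a else 1) (fun b => if b then p else q).
  rewrite (_ : (fun x => \sum_(_ <- _) _) = fun x => a * p x + q x); first by apply; case.
  by apply/funext => x; rewrite !big_cons big_nil addr0 mul1r.
split; [exact: lin|by move=> i; exact: lin|].
exists (fun m x => a * phi m x + psi m x); split.
- by move=> m; exact: test_function_lin.
- rewrite (_ : (fun m => _) = fun m => sqnormL2 (fun x => a * (phi m \- f) x + (psi m \- g) x)).
    by apply: sqnormL2_lin_cvg0 => // m; apply: Lfun2B => //;
      [exact: test_function_Lfun2 (tphi m)|exact: test_function_Lfun2 (tpsi m)].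
  by apply/funext => m; congr sqnormL2; apply/funext => x /=; ring.
- move=> i; rewrite (_ : (fun m => _) = fun m => sqnormL2
      (fun x => a * (partial i (phi m) \- F i) x + (partial i (psi m) \- G i) x)).
    by apply: sqnormL2_lin_cvg0 => // m; apply: Lfun2B => //;
      apply: test_function_Lfun2; apply: test_function_partial;
      [exact: tphi m|exact: tpsi m].
  apply/funext => m; congr sqnormL2; apply/funext => x /=.
  rewrite partial_lin; last 2 first.
    exact: test_function_derivable (tphi m).
    exact: test_function_derivable (tpsi m).
  by ring.
Qed.

Lemma H10_approx_lincomb (I : Type) (r : seq I) (a : I -> R)
    (f : I -> 'rV[R]_d -> R) (G : I -> 'I_d -> 'rV[R]_d -> R) :
  (forall k, H10_approx (f k) (G k)) ->
  H10_approx (fun x => \sum_(k <- r) a k * f k x)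
    (fun i x => \sum_(k <- r) a k * G k i x).
Proof.
move=> fG; elim: r => [|k r IH].
  have L0 : ((fun=> 0) : 'rV[R]_d -> R) \in Lfun2 := test_function_Lfun2 test_function0.
  rewrite (_ : (fun x => _) = fun=> 0); last by apply/funext => x; rewrite big_nil.
  have -> : (fun (i : 'I_d) x => \sum_(k <- [::]) a k * G k i x) = fun _ _ => 0.
    by apply/funext => i; apply/funext => x; rewrite big_nil.
  split => //; exists (fun _ _ => 0); split; first by move=> _; exact: test_function0.
    rewrite (_ : (fun _ => _) = fun=> 0); first exact: cvg_cst.
    by apply/funext => m; rewrite (_ : _ \- _ = fun=> 0) /sqnormL2 /dotL2;
      [rewrite mulr0 Rintegral_cst// mul0r|apply/funext => x /=; rewrite subr0].
  move=> i; rewrite (_ : (fun _ => _) = fun=> 0); first exact: cvg_cst.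
  apply/funext => m; rewrite (_ : _ \- _ = fun=> 0) /sqnormL2 /dotL2.
    by rewrite mulr0 Rintegral_cst// mul0r.
  by apply/funext => x /=; rewrite subr0 [LHS]derive_cst.
rewrite (_ : (fun x => _) = fun x => a k * f k x + \sum_(k <- r) a k * f k x); last first.
  by apply/funext => x; rewrite big_cons.
have -> : (fun (i : 'I_d) x => \sum_(k <- k :: r) a k * G k i x) =
    fun i x => a k * G k i x + \sum_(k <- r) a k * G k i x.
  by apply/funext => i; apply/funext => x; rewrite big_cons.
exact: H10_approx_lin.
Qed.

Lemma sqnormL2_cvg (f : nat -> 'rV[R]_d -> R) g :
  (forall m, f m \in Lfun2) -> g \in Lfun2 ->
  sqnormL2 (f m \- g) @[m --> \oo] --> (0 : R) ->
  sqnormL2 (f m) @[m --> \oo] --> sqnormL2 g.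
Proof.
move=> F G fg; rewrite (_ : (fun m => sqnormL2 (f m)) = fun m =>
    sqnormL2 (f m \- g) + 2 * (dotL2 (f m) g - sqnormL2 g) + sqnormL2 g).
  rewrite -[X in _ --> X](_ : 0 + 2 * (sqnormL2 g - sqnormL2 g) + sqnormL2 g = _); last by ring.
  apply: cvgD; last exact: cvg_cst.
  apply: cvgD => //; apply: cvgM; first exact: cvg_cst.
  by apply: cvgB; [exact: dotL2_cvg|exact: cvg_cst].
apply/funext => m; have := sqnormL2_lin 1 (Lfun2B (F m) G) G.
rewrite dotL2Bl// expr1n mul1r mulr1 => <-; congr sqnormL2.
by apply/funext => x /=; ring.
Qed.

(** For fixed [e], letting the test functions tend to [u] kills the error term, even with its large
    weight [1 + e^-1], because the [L^2] bound controls it. Then [e] tends to 0 and the constant is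
    that of test functions. *)
Lemma gauss_form_H10_le (c : R) u G : 0 < c -> H10_approx u G ->
  (gauss_form c u <= (gauss_mass c ^+ d / (2 * c) * \sum_i sqnormL2 (G i))%:E)%E.
Proof.
move=> c0 [u2 G2 [phi [tphi phiu phiG]]].
set k := gauss_mass c ^+ d / (2 * c); set B := \sum_i _.
have k0 : 0 <= k by rewrite divr_ge0 ?exprn_ge0 ?mulr_ge0 ?(ltW c0)// ltW// gauss_mass_gt0.
have B0 : 0 <= B by apply: sumr_ge0 => i _; exact: sqnormL2_ge0.
have phi2 m : phi m \in Lfun2 by exact: test_function_Lfun2 (tphi m).
have dphi2 m i : partial i (phi m) \in Lfun2.
  exact: test_function_Lfun2 (test_function_partial i (tphi m)).
have gf0 w : (0 <= gauss_form c w)%E.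
  by apply: integral_ge0 => z _; rewrite lee_fin mulr_ge0 ?sqr_ge0 ?gauss_rV_ge0.
have gfle w : w \in Lfun2 -> (gauss_form c w <= (2 * gauss_mass c ^+ d * sqnormL2 w)%:E)%E.
  move=> w2; rewrite EFinM -sqnormL2E//; apply: gauss_form_le => //.
    exact: Lfun2_measurable.
  by rewrite sqnormL2E// ltry.
have Qfin : gauss_form c u \is a fin_num.
  by rewrite ge0_fin_numE// (le_lt_trans (gfle _ u2))// ltry.
rewrite -(fineK Qfin) lee_fin; set Q := fine _.
have Qe (e : R) : 0 < e -> Q <= (1 + e) * (k * B).
  move=> e0; set K := (1 + e^-1) * (2 * gauss_mass c ^+ d).
  have Qm m : Q <= (1 + e) * (k * \sum_i sqnormL2 (partial i (phi m))) +
      K * sqnormL2 (phi m \- u).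
    rewrite -lee_fin /Q fineK//.
    apply: (le_trans (gauss_form_approx c e0 (Lfun2_measurable u2) (Lfun2_measurable (phi2 m)))).
    rewrite [leRHS]EFinD; apply: leeD.
      rewrite [leRHS]EFinM; apply: lee_wpmul2l; first by rewrite lee_fin addr_ge0// ltW.
      apply: (le_trans (gauss_form_test_le c0 (tphi m))).
      rewrite [leRHS]EFinM; under eq_bigr do rewrite sqnormL2E//.
      by rewrite sumEFin.
    rewrite -mulrA [leRHS]EFinM; apply: lee_wpmul2l; first by rewrite lee_fin addr_ge0// invr_ge0 ltW.
    apply: (le_trans (gfle _ (Lfun2B u2 (phi2 m)))).
    rewrite lee_fin le_eqVlt; apply/orP; left; apply/eqP; congr (_ * _).
    by apply: eq_Rintegral => x _ /=; ring.
  have lim : ((1 + e) * (k * \sum_i sqnormL2 (partial i (phi m))) +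
      K * sqnormL2 (phi m \- u)) @[m --> \oo] --> (1 + e) * (k * B) + K * 0.
    apply: cvgD; apply: cvgM; try exact: cvg_cst; last exact: phiu.
    apply: cvgM; first exact: cvg_cst.
    by apply: cvg_bigsum => i; apply: sqnormL2_cvg.
  move: lim; rewrite mulr0 addr0 => /cvgr_to_ge; apply.
  exact: nearW.
apply/ler_addgt0Pr => e e0; have kB0 : 0 <= k * B by exact: mulr_ge0.
have kB1 : 0 < k * B + 1 by rewrite ltr_wpDl.
(* With this weight the excess over [k * B] is at most [e]; the [+ 1] covers [k * B = 0]. *)
apply: (le_trans (Qe (e / (k * B + 1)) _)); first by rewrite divr_gt0.
rewrite mulrDl mul1r lerD2l -mulrA ler_piMr ?(ltW e0)// mulrC ler_pdivrMr// mul1r lerDl.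
exact: ler01.
Qed.

Section basis.
Variable h : nat -> 'rV[R]_d -> R.
Hypothesis basis : L2_orthonormal_basis O h.
Hypothesis hH10 : forall k, H10 O (h k).

(* The basis functions are L^2-limits of test functions, so a function of
   [L2 O] orthogonal to the test functions is orthogonal to the basis. *)
Lemma orthogonal_test_function f g : L2 O f ->
  (forall phi, test_function O phi -> dotL2 f phi = 0) -> g \in Lfun2 ->
  dotL2 f g = 0.
Proof.
move=> Of f0 G; have [hL2 _ hbasis] := basis.
have fh k : dotL2 f (h k) = 0.
  have [_ [phi [tphi phih _]]] := hH10 k.
  rewrite dotL2C; apply/esym; apply: (@cvg_unique _ _ (dotL2 (phi m) f @[m --> \oo])) => //.
    rewrite /= (_ : (fun m => _) = fun=> 0); last by apply/funext => m; rewrite dotL2C f0.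
    exact: cvg_cst.
  apply: dotL2_cvg => //; [exact: Of.1|by move=> m; exact: test_function_Lfun2 (tphi m)|].
  exact: (hL2 k).1.
(* All coefficients of [f] vanish, so the remainders of its expansion, which tend to 0, are
   constantly [f]. *)
have ff : sqnormL2 f = 0.
  apply: (@cvg_unique _ _ (sqnormL2 f @[m --> \oo])) => //; first exact: cvg_cst.
  apply: cvg_trans (hbasis f Of); apply: near_eq_cvg; apply: nearW => m.
  congr sqnormL2; apply/funext => x; rewrite big1 ?subr0// => k _.
  by rewrite fh mul0r.
have := dotL2_sqr_le Of.1 G; rewrite ff mul0r.
by move=> fg; apply/eqP; rewrite -sqrf_eq0 eq_le fg sqr_ge0.
Qed.

(** The difference of two weak gradients is orthogonal to the test functions. Stating the result
    through pairings avoids almost everywhere equality and is all that the norms require. *)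
Lemma weak_gradient_unique u G1 G2 i g : weak_gradient O u G1 ->
  weak_gradient O u G2 -> g \in Lfun2 -> dotL2 (G1 i) g = dotL2 (G2 i) g.
Proof.
move=> /(_ i)[L1 w1] /(_ i)[L2' w2] Lg; apply/eqP; rewrite -subr_eq0; apply/eqP.
rewrite -dotL2Bl ?L1.1 ?L2'.1//; apply: orthogonal_test_function => //.
  split; first exact: Lfun2B L1.1 L2'.1.
  by move=> x Ox /=; rewrite L1.2// L2'.2// subrr.
move=> phi tphi; rewrite dotL2Bl ?L1.1 ?L2'.1//; last exact: test_function_Lfun2 tphi.
by apply/eqP; rewrite subr_eq0 -eqr_opp -w1// -w2.
Qed.

End basis.

End weak_derivatives.

(** * Galerkin matrices *)

Section galerkin_forms.
Variables (R : realType) (n : nat) (O : set 'rV[R]_n.+1) (s : R).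
Local Notation d := n.+1.
Local Notation leb := (lebesgue_rV R d).
Local Notation leb2 := (leb \x leb)%E.
Local Notation Lfun2 := (Lfun leb 2%:E).
Hypothesis s01 : 0 < s < 1.
Implicit Types u v : 'rV[R]_d -> R.

Lemma frac_form_H10_le u G : H10_approx O u G ->
  (frac_form s u < +oo)%E /\
  ((frac_const n s / 2)%:E * frac_form s u <=
   (sqnormL2 u + \sum_i sqnormL2 (G i))%:E)%E.
Proof.
move=> uG; have [u2 _ _] := uG.
apply: frac_form_bound => //.
- exact: Lfun2_measurable.
- exact: sqnormL2_ge0.
- by apply: sumr_ge0 => i _; exact: sqnormL2_ge0.
- move=> c c0; rewrite EFinM -sqnormL2E//; apply: gauss_form_le => //.
    exact: Lfun2_measurable.
  by rewrite sqnormL2E// ltry.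
- by move=> c c0; exact: gauss_form_H10_le uG.
Qed.

Lemma frac_const_ge0 : 0 <= frac_const n s.
Proof.
rewrite invr_ge0; apply: Rintegral_ge0 => z _.
by rewrite mulr_ge0 ?frac_kernelV_ge0// subr_ge0 cos_le1.
Qed.

Lemma measurable_Ms_integrand u v : measurable_fun setT u -> measurable_fun setT v ->
  measurable_fun setT (Ms_integrand s u v).
Proof.
have incr (w : 'rV[R]_d -> R) : measurable_fun setT w ->
    measurable_fun setT (fun z : 'rV[R]_d * 'rV[R]_d => w z.1 - w z.2).
  move=> mw; apply: measurable_funB.
    exact: measurableT_comp mw measurable_fst.
  exact: measurableT_comp mw measurable_snd.
move=> mu' mv; apply: measurable_funM.
  by apply: measurable_funM; exact: incr.
apply: (measurableT_comp (measurable_frac_kernelV s)).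
by apply: measurable_rVB; [exact: measurable_fst|exact: measurable_snd].
Qed.

(** By [|a b| <= a^2 + b^2]. Integrability makes the off-diagonal values finite, so that [fine] in
    [M_mx] loses nothing and the form can be expanded bilinearly. *)
Lemma integrable_Ms_integrand u v : measurable_fun setT u -> measurable_fun setT v ->
  (frac_form s u < +oo)%E -> (frac_form s v < +oo)%E ->
  leb2.-integrable setT (EFin \o Ms_integrand s u v).
Proof.
move=> mu' mv uoo voo.
have mf (w : 'rV[R]_d -> R) : measurable_fun setT w -> measurable_fun setT
  (fun z : 'rV[R]_d * 'rV[R]_d => ((w z.1 - w z.2) ^+ 2 / frac_kernel s (z.1 - z.2))%:E).
  by move=> mw; apply/measurable_EFinP; exact: measurable_frac_integrand.
have f0 (w : 'rV[R]_d -> R) (z : 'rV[R]_d * 'rV[R]_d) :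
    (0 <= ((w z.1 - w z.2) ^+ 2 / frac_kernel s (z.1 - z.2))%:E)%E.
  by rewrite lee_fin mulr_ge0 ?sqr_ge0 ?frac_kernelV_ge0.
apply/integrableP; split.
  by apply/measurable_EFinP; exact: measurable_Ms_integrand.
apply: (@le_lt_trans _ _ (frac_form s u + frac_form s v)%E); last exact: lte_add_pinfty.
rewrite /frac_form -ge0_integralD//; try exact: mf.
apply: ge0_le_integral => //.
- apply: measurableT_comp => //; apply/measurable_EFinP.
  exact: measurable_Ms_integrand.
- by apply: emeasurable_funD; exact: mf.
move=> z _; rewrite abse_EFin -EFinD lee_fin /Ms_integrand -mulrDl normrM.
rewrite [`|_^-1|]ger0_norm ?frac_kernelV_ge0//.
apply: ler_wpM2r; first exact: frac_kernelV_ge0.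
set a := u _ - _; set b := v _ - _.
rewrite ler_norml; apply/andP; split; nra.
Qed.

Lemma Ms_diag u : Ms s u u = ((frac_const n s / 2)%:E * frac_form s u)%E.
Proof. by congr (_ * _)%E; apply: eq_integral => z _; rewrite /Ms_integrand -expr2. Qed.

Section combination.
Variables (h : nat -> 'rV[R]_d -> R).
Hypothesis h_int : forall k j : nat,
  leb2.-integrable setT (EFin \o Ms_integrand s (h k) (h j)).
Variable N : nat.
Local Notation M := (M_mx s h N).

Lemma M_mxE k j : M k j = frac_const n s / 2 * (\int[leb2]_z Ms_integrand s (h k) (h j) z)%R.
Proof.
by rewrite mxE /Ms fineM//; exact: integrable_fin_num (h_int k j).
Qed.

Lemma M_mx_sym : M^T = M.
Proof.
apply/matrixP => k j; rewrite mxE !M_mxE; congr (_ * _).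
by apply: eq_Rintegral => z _; rewrite /Ms_integrand; congr (_ / _); exact: mulrC.
Qed.

(** The integrand is bilinear pointwise, and each pair is integrable, so the finite sum over pairs
    of indices leaves the integral. *)
Lemma dotv_M_mx (U : 'cV[R]_N) :
  (dotv (M *m U) U)%:E = Ms s (galerkin_fun h U) (galerkin_fun h U).
Proof.
pose f (p : 'I_N * 'I_N) := Ms_integrand s (h p.1) (h p.2).
pose a (p : 'I_N * 'I_N) := U p.1 ord0 * U p.2 ord0.
have fint p : leb2.-integrable setT (EFin \o f p) by exact: h_int.
have uE z : Ms_integrand s (galerkin_fun h U) (galerkin_fun h U) z = \sum_p a p * f p z.
  have gE : galerkin_fun h U z.1 - galerkin_fun h U z.2 =
      \sum_(k < N) U k ord0 * (h k z.1 - h k z.2).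
    by rewrite /galerkin_fun -sumrB; apply: eq_bigr => k _; rewrite mulrBr.
  rewrite /Ms_integrand gE big_distrlr/= pair_bigA/= mulr_suml; apply: eq_bigr => p _.
  by rewrite /a /f /Ms_integrand; ring.
rewrite /Ms (_ : (\int[_]_z _)%E = (\sum_p a p * \int[leb2]_z f p z)%:E)%R; last first.
  rewrite -(Rintegral_lincomb (index_enum ('I_N * 'I_N)%type) a fint).
  rewrite /Rintegral fineK.
    by apply: eq_integral => z _; rewrite uE.
  exact: integrable_fin_num (integrable_lincomb _ _ fint).
rewrite -EFinM; congr EFin; rewrite mulr_sumr.
rewrite (eq_bigr (fun p => M p.1 p.2 * U p.2 ord0 * U p.1 ord0)); last first.
  by move=> p _; rewrite M_mxE /a /f; ring.
rewrite -(pair_bigA _ (fun k j => M k j * U j ord0 * U k ord0))/=.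
by apply: eq_bigr => k _; rewrite mxE mulr_suml.
Qed.

End combination.

End galerkin_forms.

(** * Galerkin combinations of eigenfunctions *)

Section eigenbasis.
Variables (R : realType) (n : nat) (O : set 'rV[R]_n.+1).
Variables (lam : nat -> R) (h : nat -> 'rV[R]_n.+1 -> R).
Local Notation leb := (lebesgue_rV R n.+1).
Local Notation Lfun2 := (Lfun leb 2%:E).
Hypothesis eigen : dirichlet_eigenbasis O lam h.

Let hH10 k : H10 O (h k). Proof. by have [_ /(_ k)[]] := eigen. Qed.
Let h2 k : h k \in Lfun2. Proof. by have [[/(_ k)[]]] := eigen. Qed.
Let wgrad_h k : weak_gradient O (h k) (wgrad O (h k)).
Proof. exact: wgradP (hH10 k).1. Qed.

Lemma eigenvalue_ge k : lam 0%N <= lam k.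
Proof.
have [_ _ _ lamS] := eigen.
by elim: k => // k /le_trans; apply.
Qed.

Lemma sqnormL2_galerkin N (U : 'cV[R]_N) : sqnormL2 (galerkin_fun h U) = dotv U U.
Proof.
have [[_ orth _] _ _ _] := eigen.
rewrite sqnormL2_lincomb//; apply: eq_bigr => k _.
rewrite (bigD1 k)//= orth eqxx mulr1 big1 ?addr0// => j jk.
by rewrite orth (_ : (k == j :> nat) = false) ?mulr0//; apply/negbTE; rewrite eq_sym.
Qed.

(** The weak eigenvalue equation of [h k], tested with [h j], gives [lam k] times the Kronecker
    symbol, so only the diagonal of the double sum survives. *)
Lemma sum_sqnormL2_wgrad N (U : 'cV[R]_N) :
  \sum_i sqnormL2 (fun x => \sum_(k < N) U k ord0 * wgrad O (h k) i x) =
  \sum_(k < N) lam k * U k ord0 ^+ 2.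
Proof.
have [[_ orth _] eig _ _] := eigen.
rewrite (eq_bigr (fun i => \sum_(k < N) \sum_(j < N) U k ord0 * U j ord0 *
    dotL2 (wgrad O (h k) i) (wgrad O (h j) i))); last first.
  by move=> i _; apply: sqnormL2_lincomb => k; exact: (wgrad_h k i).1.1.
rewrite exchange_big; apply: eq_bigr => k _; rewrite exchange_big/=.
rewrite (eq_bigr (fun j : 'I_N => U k ord0 * U j ord0 * (lam k * (k == j)%:R))); last first.
  move=> j _; rewrite -mulr_sumr; congr (_ * _).
  by rewrite -orth -(eig k).2//; exact: hH10.
rewrite (bigD1 k)//= eqxx mulr1 big1 ?addr0; last first.
  by move=> j; rewrite eq_sym => /negbTE ->; rewrite !mulr0.
by rewrite mulrC expr2.
Qed.

Lemma sqnorm_grad_galerkin N (U : 'cV[R]_N) :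
  sqnorm_grad O (galerkin_fun h U) = \sum_(k < N) lam k * U k ord0 ^+ 2.
Proof.
have [basis _ _ _] := eigen.
set G := fun (i : 'I_n.+1) x => \sum_(k < N) U k ord0 * wgrad O (h k) i x.
have wG : weak_gradient O (galerkin_fun h U) G.
  by apply: weak_gradient_lincomb => // k; exact: wgrad_h.
have wu : weak_gradient O (galerkin_fun h U) (wgrad O (galerkin_fun h U)).
  apply: wgradP; split; last by exists G.
  by apply: L2_lincomb => k; exact: (hH10 k).1.1.
rewrite -sum_sqnormL2_wgrad; apply: eq_bigr => i _.
(* The chosen gradient is replaced by the combination [G] in one factor of the square at a time, the
   other factor acting as the test element. *)
rewrite (weak_gradient_unique basis hH10 i wu wG); last exact: (wu i).1.1.
by rewrite dotL2C (weak_gradient_unique basis hH10 i wu wG)//; exact: (wG i).1.1.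
Qed.

Lemma dotv_le_eigen N (U : 'cV[R]_N) :
  lam 0%N * dotv U U <= \sum_(k < N) lam k * U k ord0 ^+ 2.
Proof.
rewrite /dotv mulr_sumr; apply: ler_sum => k _.
by rewrite -expr2 ler_wpM2r ?sqr_ge0// eigenvalue_ge.
Qed.

Lemma dotv_Lambda_mx N (U : 'cV[R]_N) :
  dotv (Lambda_mx lam N *m U) U = \sum_(k < N) lam k * U k ord0 ^+ 2.
Proof.
by apply: eq_bigr => k _; rewrite mul_diag_mx !mxE expr2 mulrA.
Qed.

Variable s : R.
Hypothesis s01 : 0 < s < 1.

Lemma integrable_Ms_eigen k j :
  (leb \x leb)%E.-integrable setT (EFin \o Ms_integrand s (h k) (h j)).
Proof.
have hk i := (frac_form_H10_le s01 (H10_approx_wgrad (hH10 i))).1.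
by apply: integrable_Ms_integrand => //; exact: Lfun2_measurable.
Qed.

(** In [C_s] the 1 comes from the gradient term, and [1 / lam 0] from the Poincare inequality
    [lam 0 * |u|^2 <= |grad u|^2] on the span, which absorbs the [L^2] term. *)
Lemma Ms_galerkin_le N (U : 'cV[R]_N) : (Ms s (galerkin_fun h U) (galerkin_fun h U) <=
  (C_s lam * \sum_(k < N) lam k * U k ord0 ^+ 2)%:E)%E.
Proof.
have [_ _ lam0 _] := eigen.
have uG : H10_approx O (galerkin_fun h U)
    (fun (i : 'I_n.+1) x => \sum_(k < N) U k ord0 * wgrad O (h k) i x).
  by apply: H10_approx_lincomb => k; exact: H10_approx_wgrad.
rewrite Ms_diag; apply: (le_trans (frac_form_H10_le s01 uG).2).
rewrite sqnormL2_galerkin sum_sqnormL2_wgrad lee_fin /C_s mulrDl mul1r addrC lerD2l.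
by rewrite -(ler_pM2l lam0) mulrA divff ?gt_eqF// mul1r dotv_le_eigen.
Qed.

End eigenbasis.

Theorem lemma4p1 (R : realType) (n : nat) (O : set 'rV[R]_n.+1)
    (s theta beta : R) (lam : nat -> R) (h : nat -> 'rV[R]_n.+1 -> R) :
  bounded_domain O -> C11_boundary O ->
  0 < s < 1 -> 0 < theta -> 0 < beta ->
  dirichlet_eigenbasis O lam h ->
  forall N : nat,
  let M := M_mx s h N in
  let Lam := Lambda_mx lam N in
  let A := A_mx s theta beta lam h N in
  let Cs := C_s lam in
  (forall k j : 'I_N,
     (lebesgue_rV R n.+1 \x lebesgue_rV R n.+1)%E.-integrable setT
       (EFin \o Ms_integrand s (h k) (h j))) /\
  M^T = M /\
  (forall U : 'cV[R]_N, 0 <= dotv (M *m U) U) /\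
  (forall U : 'cV[R]_N, let u := galerkin_fun h U in
     [/\ 0 <= dotv (M *m U) U,
         (dotv (M *m U) U)%:E = Ms s u u,
         Ms s u u = sqseminorm_Hs s u,
         (sqseminorm_Hs s u <= (Cs * sqnorm_grad O u)%:E)%E &
         Cs * sqnorm_grad O u =
           Cs * \sum_(k < N) lam k * U k ord0 ^+ 2]) /\
  A^T = A /\
  (forall U : 'cV[R]_N,
     [/\ theta * lam 0%N * dotv U U <= theta * dotv (Lam *m U) U,
         theta * dotv (Lam *m U) U <= dotv (A *m U) U &
         dotv (A *m U) U <= (theta + beta * Cs) * dotv (Lam *m U) U]).
Proof.
move=> _ _ s01 theta0 beta0 eigen N M Lam A Cs.
have h_int k j := integrable_Ms_eigen eigen s01 k j.
have Msym : M^T = M by exact: M_mx_sym.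
have ME U := dotv_M_mx h_int U.
have M0 U : 0 <= dotv (M *m U) U.
  rewrite -lee_fin ME Ms_diag mule_ge0//.
    by rewrite lee_fin divr_ge0// frac_const_ge0.
  by apply: integral_ge0 => z _; rewrite lee_fin mulr_ge0 ?sqr_ge0 ?frac_kernelV_ge0.
have Mle U := Ms_galerkin_le eigen s01 U.
(* The bounds on [A] are read off this splitting: the lower one from [M >= 0], the upper one from
   the estimate of [M] by [Cs] times [Lam]. *)
have AE U : dotv (A *m U) U = theta * dotv (Lam *m U) U + beta * dotv (M *m U) U.
  rewrite /A /A_mx mulmxDl -!scalemxAl /dotv !mulr_sumr -big_split/=.
  by apply: eq_bigr => k _; rewrite !mxE mulrDl !mulrA.
split; first by move=> k j; exact: h_int.
split=> //; split=> //; split.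
  by move=> U u; split => //; rewrite /u (sqnorm_grad_galerkin eigen)// Mle.
split.
  by rewrite /A /A_mx linearD !linearZ/= -/M Msym tr_diag_mx.
move=> U; rewrite AE; split.
- by rewrite -mulrA ler_pM2l// dotv_Lambda_mx (dotv_le_eigen eigen).
- by rewrite lerDl mulr_ge0// ltW.
- rewrite mulrDl lerD2l -mulrA ler_pM2l// -lee_fin ME dotv_Lambda_mx.
  exact: Mle.
Qed.
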